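(* Assume that $X_1$ is of Pareto-type with index $\alpha=1$, i.e. $1-F(x)\sim x^{-1}\ell(x)$ as $x\to\infty$ with $\ell$ slowly varying, and that $\mu_1=\infty$. Let the counting process $\{N(t);\,t\geq 0\}$ $\mathcal{D}$-average in time to the random variable $\Lambda$. Let $(a_t)_{t>0}$ be defined by $\lim_{t\to\infty}t\,a_t^{-1}\ell(a_t)=1$ and $(a^\prime_t)_{t>0}$ by $\lim_{t\to\infty}t\,(a^{\prime}_t)^{-1}\tilde\ell(a^\prime_t)=1$, where $\tilde\ell(x)=\int_0^x\frac{\ell(u)}{u}\,du\in\mathrm{RV}_0$. Then $$\left(\frac{a^\prime_t}{a_t}\right)^2T_{N(t)}\stackrel{\mathcal{D}}{\longrightarrow}\frac{U_1}{\Lambda^2}\quad\text{as } t\rightarrow\infty,$$ where the random vector $(U_1,\Lambda)^\prime$ has the Laplace transform $$\mathbb{E}\left\{e^{-rU_1-s\Lambda}\right\}=\mathbb{E}\left\{e^{-\sqrt{r\pi}\,\Lambda}\right\},\quad r>0,\ s\geq 0.$$ In particular, $U_1$ has the Laplace transform $\mathbb{E}\{e^{-rU_1}\}=\mathbb{E}\{e^{-r^{1/2}\Gamma(1/2)\,\Lambda}\}$ for $r\geq 0$.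
   Context: $\{X_1,X_2,\ldots\}$ is a sequence of i.i.d. positive random variables with distribution function $F$, and $\{N(t);\,t\geq 0\}$ is a counting process (nonnegative integer-valued, nondecreasing in $t$) independent of the $X_i$'s. For fixed $t\ge 0$, $$T_{N(t)}:=\frac{X_1^2+\cdots+X_{N(t)}^2}{(X_1+\cdots+X_{N(t)})^2}$$ if $N(t)\geq 1$, and $T_{N(t)}:=0$ otherwise. $\mu_\beta:=\mathbb{E}X_1^\beta\le\infty$ for $\beta>0$. $X_1$ (or $F$) is of Pareto-type with index $\alpha>0$ if $1-F(x)\sim x^{-\alpha}\ell(x)$ as $x\to\infty$ for a slowly varying function $\ell$. $\mathrm{RV}_0$ denotes the class of slowly varying functions. The counting process $\mathcal{D}$-averages in time to the random variable $\Lambda$ if $N(t)/t\stackrel{\mathcal{D}}{\longrightarrow}\Lambda$ as $t\to\infty$, where $\mathbb{P}[\Lambda>0]=1$. $\stackrel{\mathcal{D}}{\longrightarrow}$ denotes convergence in distribution and $\Gamma$ is the gamma function.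
   Formalization: The printed transform loses s and cannot hold (as s→∞ the left side tends to 0); it is corrected to E e^{-rU_1-sΛ} = E e^{-sΛ-√(rπ)Λ}. Also made explicit: U_1 ≥ 0 a.s., a_t, a'_t → ∞, and ℓ(u)/u is integrable near 0. *)

(* Defs.v *)
(* MathComp-Analysis *)
From HB Require Import structures.
From mathcomp Require Export all_boot all_order all_algebra.
From mathcomp Require Export all_classical all_reals all_analysis.
Export Order.TTheory GRing.Theory Num.Theory.
Export numFieldNormedType.Exports.

Set Implicit Arguments.
Unset Strict Implicit.
Unset Printing Implicit Defensive.

Local Open Scope classical_set_scope.
Local Open Scope ring_scope.

(* RV_0: measurable, ultimately positive, and l (c x) / l x --> 1 for c > 0.
   Values on ]-oo, 0] are irrelevant. *)
Definition slowly_varying (R : realType) (l : R -> R) : Prop :=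
  [/\ measurable_fun (`]0, +oo[ : set R) l,
      (\forall x \near +oo, 0 < l x) &
      forall c : R, 0 < c -> l (c * x) / l x @[x --> +oo] --> (1 : R)].

Definition pareto_type (R : realType) (F : R -> R) (alpha : R) (l : R -> R)
    : Prop :=
  slowly_varying l /\
  (1 - F x) / (x `^ (- alpha) * l x) @[x --> +oo] --> (1 : R).

Definition log_primitive (R : realType) (l : R -> R) (x : R) : R :=
  \int[lebesgue_measure]_(u in `]0, x]) (l u / u).

(* Makes [log_primitive] a genuine (finite) integral:
   slow variation says nothing about the behaviour of l near 0. *)
Definition log_integrable (R : realType) (l : R -> R) : Prop :=
  forall x : R, 0 < x ->
    lebesgue_measure.-integrable `]0, x] (EFin \o (fun u : R => l u / u)).

(* a_t / l (a_t) ~ t with a_t --> +oo.  Divergence of a_t has to be required: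
   since l is only constrained at infinity, the asymptotic relation alone may
   have spurious solutions (e.g. a_t = 1 / t when l x = x ^ 2 near 0). *)
Definition norming (R : realType) (l a : R -> R) : Prop :=
  a t @[t --> +oo] --> +oo /\
  t * (a t)^-1 * l (a t) @[t --> +oo] --> (1 : R).

Definition Gamma (R : realType) (z : R) : R :=
  \int[lebesgue_measure]_(x in `]0, +oo[) (x `^ (z - 1) * expR (- x)).

Definition mutually_independent d (Omega : measurableType d) (R : realType)
    (P : probability Omega R) (X : nat -> {RV P >-> R}) : Prop :=
  forall (s : seq nat) (B : nat -> set R), uniq s ->
    (forall i, measurable (B i)) ->
    P (\bigcap_(i in [set` s]) X i @^-1` B i) =
    (\prod_(i <- s) P (X i @^-1` B i))%E.

Definition identically_distributed d (Omega : measurableType d)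
    (R : realType) (P : probability Omega R) (X : nat -> {RV P >-> R}) : Prop :=
  forall i (B : set R), measurable B ->
    distribution P (X i) B = distribution P (X 0%N) B.

Definition sigma_generated d (Omega : measurableType d) d'
    (T : measurableType d') (I : Type) (D : set I) (Y : I -> Omega -> T)
    : set (set Omega) :=
  <<s \bigcup_(i in D) preimage_set_system setT (Y i) measurable >>.

(* Only the times t >= 0 matter; N t for t < 0 is unconstrained. *)
Definition counting_process d (Omega : measurableType d) (R : realType)
    (P : probability Omega R) (N : R -> {RV P >-> nat}) : Prop :=
  forall (w : Omega) (s t : R), 0 <= s -> s <= t -> (N s w <= N t w)%N.

Definition process_independent_of d (Omega : measurableType d) (R : realType)
    (P : probability Omega R) (N : R -> {RV P >-> nat})
    (X : nat -> {RV P >-> R}) : Prop :=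
  forall A B : set Omega,
    sigma_generated `[0, +oo[ (fun t : R => N t : Omega -> nat) A ->
    sigma_generated setT (fun i => X i : Omega -> R) B ->
    P (A `&` B) = (P A * P B)%E.

(* Y_t --> Z in distribution as t --> +oo: the distribution functions converge
   at every continuity point of the limiting one. *)
Definition cvg_in_distribution d (Omega : measurableType d) d'
    (Omega' : measurableType d') (R : realType) (P : probability Omega R)
    (Y : R -> Omega -> R) (P' : probability Omega' R) (Z : Omega' -> R)
    : Prop :=
  forall x : R,
    {for x, continuous (fun y : R => P' [set w | Z w <= y])} ->
    P [set w | Y t w <= x] @[t --> +oo] --> P' [set w | Z w <= x].

Definition D_averages_in_time d (Omega : measurableType d) d'
    (Omega' : measurableType d') (R : realType) (P : probability Omega R)
    (N : R -> {RV P >-> nat}) (P' : probability Omega' R)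
    (Lam : {RV P' >-> R}) : Prop :=
  P' [set w | 0 < Lam w] = 1%E /\
  cvg_in_distribution P (fun t w => (N t w)%:R / t) P' Lam.

(* X is indexed from 0: X i stands for X_(i+1). *)
Definition T_stat (Omega : Type) (R : realType) (X : nat -> Omega -> R)
    (n : Omega -> nat) (w : Omega) : R :=
  if (1 <= n w)%N then
    (\sum_(i < n w) X i w ^+ 2) / (\sum_(i < n w) X i w) ^+ 2
  else 0.

(* (U, L) is a vector with nonnegative first component, with second component
   distributed as Lam, and with the prescribed joint Laplace transform.  The
   right-hand side is E exp (- s Lam - sqrt (r pi) Lam): letting r --> 0 it must
   reduce to the Laplace transform of Lam in s. *)
Definition limit_vector d (Omega : measurableType d) d'
    (Omega' : measurableType d') (R : realType) (P : probability Omega R)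
    (Lam : {RV P >-> R}) (P' : probability Omega' R) (U L : {RV P' >-> R})
    : Prop :=
  [/\ P' [set w | 0 <= U w] = 1%E,
      (forall B : set R, measurable B ->
        distribution P' L B = distribution P Lam B) &
      forall r s : R, 0 < r -> 0 <= s ->
        ('E_P'[fun w => expR (- r * U w - s * L w)] =
         'E_P'[fun w => expR (- s * L w - Num.sqrt (r * pi) * L w)])%E].

(* Main.v *)
(** Write Y = |X_1|, m(x) = E min(Y, x) and let A_t, B_t be the sums of Y_i^2 / a_t^2 and
    Y_i / a'_t over i <= N(t), so that the normalised statistic is A_t / B_t^2.  Since
    m(x) is the integral of P(Y > u) over [0, x], it is equivalent to the primitive of
    l(u) / u and is slowly varying, and x P(Y > x) = o(m(x)).  From P(Y > x) one computes
    t (1 - E exp (- r Y^2 / a_t^2 - s Y / a'_t)) --> sqrt (r pi) + s: the quadratic part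
    lives on the scale a_t, which is negligible with respect to a'_t, so that the two parts
    do not interact.  Conditioning on N(t) and using N(t) / t --> Lambda gives
    E exp (- r A_t - s B_t) --> E exp (- (sqrt (r pi) + s) Lambda), the joint Laplace
    transform of (U, L).

    Joint Laplace transforms at integer points are the moments of (exp (- A), exp (- B)) in
    the unit square, so by Bernstein approximation they determine the limits of expectations
    of Lipschitz functions; convergence of the law of the ratio follows by sandwiching
    indicators, as L > 0 almost surely.

    The vector (U, L) exists: if Z is a centred Gaussian of variance 1/2 independent of L,
    then U = pi / 4 * (L / Z)^2 works because the integral of exp (- x^2 - c^2 / x^2) over
    the line is sqrt pi * exp (- 2 c). *)
From HB Require Import structures.
Require Import Defs.
From mathcomp Require Import measurable_realfun ring lra.

Set Implicit Arguments.
Unset Strict Implicit.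
Unset Printing Implicit Defensive.

Local Open Scope classical_set_scope.
Local Open Scope ring_scope.

(** * Bounded expectations and the layer-cake formula *)

(** The constant [pi] comes from t P(Y > u a_t) --> 1 / u: integrated against 2 u exp (- u^2), the
    derivative of 1 - exp (- u^2), this gives the Gaussian integral sqrt pi. The two parts decouple
    because m(e a_t) / m(a'_t) --> 1 for every e > 0: although a_t = o(a'_t), nearly all of the
    truncated mean already comes from values below e a_t, where the quadratic exponential is close
    to 1. Karamata's theorem is replaced by comparisons between x and x / 2, iterated over dyadic
    scales ([tail_ratio_lt], [second_moment_bound]). The obstacle in the last passage is that A /
    B^2 is unbounded and singular at B = 0. What is tested is the inequality A <= x B^2, on values
    of A and B truncated at fixed heights, which are Lipschitz functions of exp (- A) and exp (- B);
    a second test function controls B near 0 and near infinity. Positivity of X_i, U and L holds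
    only almost surely, and that of a'_t only eventually; absolute values restore the sign
    conditions at every point. *)

Lemma measurable_invr (R : realType) : measurable_fun [set: R] (fun x : R => x^-1).
Proof.
(* [powR] is measurable, but [powR_inv1] asks for a nonnegative base, hence the square. At 0 both
   sides are 0, as the inverse of 0 is 0. *)
rewrite (_ : (fun x => _) = fun x : R => x * (x ^+ 2) `^ (-1)); last first.
  apply/funext => x; have [->|x0] := eqVneq x 0; first by rewrite invr0 mul0r.
  by rewrite powR_inv1 ?sqr_ge0//; field.
apply: measurable_funM => //.
apply: (@measurableT_comp _ _ _ _ _ _ (@powR R ^~ (-1)) _ (fun x : R => x ^+ 2)).
  exact: measurable_powR.
exact: measurable_funX.
Qed.

Lemma indic_set (R : realType) (T : Type) (Q : T -> bool) w :
  \1_[set x | Q x] w = (Q w)%:R :> R.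
Proof. by rewrite indicE; congr ((nat_of_bool _)%:R); apply/idP/idP; rewrite inE. Qed.

Section bounded_expectation.
Context d (T : measurableType d) (R : realType) (P : probability T R).
Implicit Types f g : T -> R.

(** Unlike integrability, this is stable under products; on a probability space it implies
    integrability, so the whole algebra of expectations can be done in this class. *)
Definition mbounded f := measurable_fun setT f /\ exists M, forall x, `|f x| <= M.

Lemma mbounded_integrable f : mbounded f -> P.-integrable setT (EFin \o f).
Proof.
move=> [mf [M fM]]; apply: measurable_bounded_integrable => //.
  by apply: (le_lt_trans (probability_le1 P measurableT)); exact: ltry.
exists M; split; first exact: num_real.
by move=> y My x _; apply: le_trans (fM x) (ltW My).
Qed.

Lemma mbounded_cst (c : R) : mbounded (cst c).
Proof. by split => //; exists `|c|. Qed.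

Lemma mboundedD f g : mbounded f -> mbounded g -> mbounded (fun x => f x + g x).
Proof.
move=> [mf [M fM]] [mg [N gN]]; split; first exact: measurable_funD.
by exists (M + N) => x; apply: le_trans (ler_normD _ _) _; apply: lerD.
Qed.

Lemma mboundedN f : mbounded f -> mbounded (fun x => - f x).
Proof.
move=> [mf [M fM]]; split; first exact: measurableT_comp.
by exists M => x; rewrite normrN.
Qed.

Lemma mboundedB f g : mbounded f -> mbounded g -> mbounded (fun x => f x - g x).
Proof. by move=> mf mg; apply: mboundedD => //; exact: mboundedN. Qed.

Lemma mboundedM f g : mbounded f -> mbounded g -> mbounded (fun x => f x * g x).
Proof.
move=> [mf [M fM]] [mg [N gN]]; split; first exact: measurable_funM.
by exists (M * N) => x; rewrite normrM ler_pM.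
Qed.

Lemma mbounded_prod (I : Type) (s : seq I) (Q : pred I) (F : I -> T -> R) :
  (forall i, mbounded (F i)) -> mbounded (fun x => \prod_(i <- s | Q i) F i x).
Proof.
move=> mF; elim: s => [|i s IH].
  by under eq_fun do rewrite big_nil; exact: mbounded_cst.
under eq_fun do rewrite big_cons.
by case: (Q i) => //; exact: mboundedM.
Qed.

Lemma mbounded_indic (A : set T) : measurable A -> mbounded (\1_A : T -> R).
Proof.
move=> mA; split; first exact: measurable_indic.
by exists 1 => x; rewrite indicE ger0_norm ?ler0n// lern1 leq_b1.
Qed.

Lemma mboundedP f (M : R) : measurable_fun setT f -> (forall x, 0 <= f x <= M) ->
  mbounded f.
Proof.
move=> mf f01; split => //; exists M => x.
by have /andP[f0 f1] := f01 x; rewrite ger0_norm.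
Qed.

Lemma ExD f g : mbounded f -> mbounded g ->
  \int[P]_x (f x + g x) = \int[P]_x f x + \int[P]_x g x.
Proof. by move=> mf mg; rewrite RintegralD//; exact: mbounded_integrable. Qed.

Lemma ExB f g : mbounded f -> mbounded g ->
  \int[P]_x (f x - g x) = \int[P]_x f x - \int[P]_x g x.
Proof. by move=> mf mg; rewrite RintegralB//; exact: mbounded_integrable. Qed.

Lemma ExZ (c : R) f : mbounded f -> \int[P]_x (c * f x) = c * \int[P]_x f x.
Proof. by move=> mf; rewrite RintegralZl//; exact: mbounded_integrable. Qed.

Lemma Ex_le f g : mbounded f -> mbounded g -> (forall x, f x <= g x) ->
  \int[P]_x f x <= \int[P]_x g x.
Proof. by move=> mf mg fg; apply: le_Rintegral => //; exact: mbounded_integrable. Qed.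

Lemma Ex_ge0 f : (forall x, 0 <= f x) -> 0 <= \int[P]_x f x.
Proof. by move=> f0; exact: Rintegral_ge0. Qed.

Lemma Ex_cst (c : R) : \int[P]_x c = c.
Proof. rewrite Rintegral_cst// -[RHS]mulr1; congr (_ * _).
by rewrite -[RHS]/(fine 1%E); congr fine; exact: probability_setT. Qed.

Lemma Ex_indic (A : set T) : measurable A -> \int[P]_x (\1_A x : R) = fine (P A).
Proof. by move=> mA; rewrite /Rintegral integral_indic// setIT. Qed.

Lemma Ex_abs f : mbounded f -> `|\int[P]_x f x| <= \int[P]_x `|f x|.
Proof. by move=> mf; apply: le_normr_Rintegral => //; exact: mbounded_integrable. Qed.

Lemma EFin_Ex f : mbounded f -> (\int[P]_x f x)%:E = (\int[P]_x (f x)%:E)%E.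
Proof.
move=> mf; rewrite /Rintegral fineK//.
by apply: integrable_fin_num => //; exact: mbounded_integrable.
Qed.

Lemma Ex_ae_eq f g (A : set T) : measurable_fun setT f -> measurable_fun setT g ->
  measurable A -> P A = 1%E ->
  (forall x, A x -> f x = g x) -> \int[P]_x f x = \int[P]_x g x.
Proof.
move=> mf mg mA PA fg; rewrite /Rintegral; congr fine.
apply: ae_eq_integral => //; [exact/measurable_EFinP|exact/measurable_EFinP|].
exists (~` A); split; first exact: measurableC.
  by have := probability_setC P mA; rewrite PA subee.
move=> x /= h Ax; apply: h => _; by rewrite fg.
Qed.

Lemma Ex_le_indic f (A : set T) : mbounded f -> measurable A ->
  (forall x, f x <= 1) -> (forall x, ~ A x -> f x <= 0) -> \int[P]_x f x <= fine (P A).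
Proof.
move=> mf mA f1 f0; rewrite -Ex_indic//; apply: Ex_le => //; first exact: mbounded_indic.
move=> x; rewrite indicE; case: (boolP (x \in A)) => [_|]; first exact: f1.
by rewrite notin_setE => /f0.
Qed.

Lemma Ex_ge_indic f (A : set T) : mbounded f -> measurable A ->
  (forall x, 0 <= f x) -> (forall x, A x -> 1 <= f x) -> fine (P A) <= \int[P]_x f x.
Proof.
move=> mf mA f1 f0; rewrite -Ex_indic//; apply: Ex_le => //; first exact: mbounded_indic.
move=> x; rewrite indicE; case: (boolP (x \in A)) => [|_]; last exact: f1.
by rewrite inE => /f0.
Qed.

End bounded_expectation.

Lemma measurable_fun_gt d (T : measurableType d) (R : realType) (X : T -> R) (y : R) :
  measurable_fun setT X -> measurable [set w | y < X w].
Proof.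
move=> mX; rewrite (_ : [set w | _] = X @^-1` `]y, +oo[); last first.
  by apply/seteqP; split => w /=; rewrite in_itv/= andbT.
by rewrite -[X in measurable X]setTI; exact: mX.
Qed.

Section layer_cake.
Context d (T : measurableType d) (R : realType) (P : {sigma_finite_measure set T -> \bar R}).
Local Notation mu := (@lebesgue_measure R).
Local Open Scope ereal_scope.

(** Tonelli's theorem for W w * g y on the region 0 < y < X w; where X w <= 0 the inner interval is
    empty. The weight serves twice: as the remaining factors of a product of independent variables,
    and as a density with respect to Lebesgue measure, which is why the measure is merely
    sigma-finite. *)
Lemma weighted_layer_cake (W X : T -> R) (g : R -> R) :
  measurable_fun setT W -> (forall w, 0 <= W w)%R -> measurable_fun setT X ->
  measurable_fun setT g -> (forall y, 0 <= g y)%R ->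
  \int[P]_w ((W w)%:E * \int[mu]_(y in `]0%R, X w[) (g y)%:E) =
  \int[mu]_(y in `]0%R, +oo[) ((g y)%:E * \int[P]_w (W w * \1_[set w | y < X w]%R w)%:E).
Proof.
move=> mW W0 mX mg g0.
pose h (p : T * measurableTypeR R) : \bar R :=
  (W p.1 * (g p.2 * \1_(`]0%R, X p.1[%classic) p.2))%:E.
have m2 : measurable_fun setT (fun p : T * measurableTypeR R => (p.2 : R)).
  exact: measurable_snd.
have m1 : measurable_fun setT (fun p : T * measurableTypeR R => X p.1).
  by apply: measurableT_comp => //; exact: measurable_fst.
have mset : measurable [set p : T * measurableTypeR R | `]0%R, X p.1[%classic p.2].
  have b1 : measurable_fun setT (fun p : T * measurableTypeR R => 0 < (p.2 : R))%R.
    exact: measurable_fun_ltr.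
  have b2 : measurable_fun setT (fun p : T * measurableTypeR R => (p.2 : R) < X p.1)%R.
    exact: measurable_fun_ltr.
  rewrite [X in measurable X](_ : _ =
    (fun p : T * measurableTypeR R => 0 < (p.2 : R))%R @^-1` [set true] `&`
    (fun p : T * measurableTypeR R => (p.2 : R) < X p.1)%R @^-1` [set true]).
    by apply: measurableI; rewrite -[X in measurable X]setTI; [exact: b1|exact: b2].
  by apply/seteqP; split => p /=; rewrite in_itv/= => /andP.
have mh : measurable_fun setT h.
  apply/measurable_EFinP; apply: measurable_funM.
    by apply: measurableT_comp => //; exact: measurable_fst.
  apply: measurable_funM; first exact: measurableT_comp.
  rewrite [X in measurable_fun _ X](_ : _ =
    \1_[set p : T * measurableTypeR R | `]0%R, X p.1[%classic p.2]).
    exact: measurable_indic.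
  by apply/funext => p; rewrite !indicE; congr ((nat_of_bool _)%:R);
    apply/idP/idP; rewrite !inE.
have h0 p : 0 <= h p by rewrite lee_fin !mulr_ge0.
transitivity (\int[P]_w \int[mu]_y h (w, y)).
  apply: eq_integral => w _; rewrite integral_mkcond -ge0_integralZl_EFin//.
  - apply: eq_integral => y _; rewrite /h /= patchE indicE.
    by case: ifPn; rewrite ?mulr1 ?mulr0// mule0.
  - move=> y _; rewrite patchE; case: ifP => // _; rewrite lee_fin; exact: g0.
  - apply/(measurable_restrictT _ _).1 => //; apply/measurable_EFinP.
    exact: measurable_funTS.
rewrite fubini_tonelli// [RHS]integral_mkcond; apply: eq_integral => y _.
rewrite patchE; case: ifPn => [|] yI.
  have y0 : (0 < y)%R by move: yI; rewrite inE/= in_itv/= andbT.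
  have mA : measurable [set w | y < X w]%R by exact: measurable_fun_gt.
  rewrite -ge0_integralZl_EFin//.
  - apply: eq_integral => w _; rewrite /h /= -EFinM mulrCA; congr (_ * (W w * _))%:E.
    rewrite !indicE; congr ((nat_of_bool _)%:R).
    by apply/idP/idP; rewrite !inE/= ?in_itv/= y0.
  - by move=> w _; rewrite lee_fin mulr_ge0.
  - by apply/measurable_EFinP; apply: measurable_funM => //; exact: measurable_indic.
rewrite -[RHS](@integral0 _ _ _ P setT); apply: eq_integral => w _.
rewrite /h /= indicE memNset ?mulr0//= in_itv/= => /andP[y0 _].
by move: yI; rewrite notin_setE/= in_itv/= y0.
Qed.

Lemma layer_cake (X : T -> R) (g : R -> R) : measurable_fun setT X ->
  measurable_fun setT g -> (forall y, 0 <= g y)%R ->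
  \int[P]_w (\int[mu]_(y in `]0%R, X w[) (g y)%:E) =
  \int[mu]_(y in `]0%R, +oo[) ((g y)%:E * P [set w | y < X w]%R).
Proof.
move=> mX mg g0.
have := @weighted_layer_cake (cst 1%R) X g (measurable_cst _) (fun=> ler01) mX mg g0.
under eq_integral do rewrite mul1e.
move=> ->; apply: eq_integral => y _; congr (_ * _).
under eq_integral do rewrite mul1r.
by rewrite integral_indic ?setIT//; exact: measurable_fun_gt.
Qed.

End layer_cake.

(** * Dominated convergence along a real parameter *)

Section dominated_pinfty.
Context d (T : measurableType d) (R : realType) (mu : {measure set T -> \bar R}).

Lemma cvg_dominated_pinfty (D : set T) (f : R -> T -> R) (g h : T -> R) :
  measurable D -> (forall t, measurable_fun D (f t)) -> measurable_fun D g ->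
  mu.-integrable D (EFin \o h) ->
  {ae mu, forall x, D x -> f t x @[t --> +oo] --> g x} ->
  (\forall t \near +oo, forall x, D x -> `|f t x| <= h x) ->
  \int[mu]_(x in D) f t x @[t --> +oo] --> \int[mu]_(x in D) g x.
Proof.
move=> mD mf mg ih fg [M [_ fh]].
apply/cvg_pinftyP => u uoo.
(* The domination is assumed only for t > M. Pushing the sequence beyond M changes finitely many
   terms, since u n tends to infinity, and makes the bound hold for every n. *)
pose v n := Num.max (u n) (M + 1).
have voo : v n @[n --> \oo] --> +oo.
  apply/cvgryPge => A; have /cvgryPge/(_ A) := uoo; apply: filterS => n.
  by rewrite /v le_max => ->.
suff H : \int[mu]_(x in D) f (v n) x @[n --> \oo] --> \int[mu]_(x in D) g x.
  apply: cvg_trans H; apply: near_eq_cvg.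
  have /cvgryPge/(_ (M + 1)) := uoo; apply: filterS => n un.
  by rewrite /v max_l.
have [|||||ig _ cvgi] := @dominated_convergence _ _ _ mu D mD
    (fun n => EFin \o f (v n)) (EFin \o g) (EFin \o h).
- by move=> n; apply/measurable_EFinP.
- exact/measurable_EFinP.
- case: fg => N [mN N0 sN]; exists N; split => // x /= Hx; apply: sN => /= Hx'.
  apply: Hx => Dx; apply: cvg_EFin; first exact: nearW.
  by have /cvg_pinftyP := Hx' Dx; apply.
- exact: ih.
- apply: aeW => x n Dx; rewrite /= lee_fin; apply: fh => //.
  by rewrite /v lt_max ltrDl ltr01 orbT.
- apply: fine_cvg; rewrite fineK//; exact: integrable_fin_num.
Qed.

End dominated_pinfty.

(** * Bernstein approximation *)

Section bernstein.
Context (R : realType).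
Implicit Types (f g : nat -> R) (x y : R).

(* [bern n f x] is the expectation of [f] under the binomial law (n, x). *)
Fixpoint bern n f x : R :=
  if n is m.+1 then x * bern m (f \o succn) x + (1 - x) * bern m f x else f 0%N.

Lemma bern_cst n c x : bern n (fun=> c) x = c.
Proof. by elim: n => //= n IH; rewrite /comp !IH; ring. Qed.

Lemma bernD n f g x : bern n (fun i => f i + g i) x = bern n f x + bern n g x.
Proof.
elim: n f g => //= n IH f g.
rewrite [bern n (_ \o _) x](IH (f \o succn) (g \o succn)) IH; ring.
Qed.

Lemma bernZ n c f x : bern n (fun i => c * f i) x = c * bern n f x.
Proof.
elim: n f => //= n IH f.
rewrite [bern n (_ \o _) x](IH (f \o succn)) IH; ring.
Qed.

Lemma bern_le n f g x : 0 <= x <= 1 -> (forall i, (i <= n)%N -> f i <= g i) ->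
  bern n f x <= bern n g x.
Proof.
move=> /andP[x0 x1]; elim: n f g => /= [f g|n IH f g] fg; first exact: fg.
apply: lerD; apply: ler_wpM2l => //; rewrite ?subr_ge0//.
  by apply: IH => i ni /=; apply: fg.
by apply: IH => i ni; apply: fg; apply: leqW.
Qed.

(** Variance plus squared bias of the binomial law. The centre c is arbitrary because a success
    turns c into c - 1 in the induction. *)
Lemma bern_sqr n c x :
  bern n (fun i => (i%:R - c) ^+ 2) x = n%:R * x * (1 - x) + (n%:R * x - c) ^+ 2.
Proof.
elim: n c => [|n IH] c /=; first ring.
rewrite (_ : _ \o _ = fun i => (i%:R - (c - 1)) ^+ 2); last first.
  by apply/funext => i /=; rewrite -natr1; ring.
rewrite !IH -natr1; ring.
Qed.

(** A substitute for the Cauchy-Schwarz inequality: it bounds a first absolute moment by a second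
    moment, at the price of a parameter e chosen later. *)
Lemma norm_le_add_sqr (e u : R) : 0 < e -> `|u| <= e + e^-1 * u ^+ 2.
Proof.
move=> e0; have [ue|eu] := leP `|u| e.
  by apply: le_trans ue _; rewrite lerDl mulr_ge0 ?sqr_ge0// invr_ge0 ltW.
apply: le_trans (_ : e^-1 * u ^+ 2 <= _); last by rewrite lerDr ltW.
rewrite -[leLHS]mul1r -real_normK ?num_real// expr2 mulrA ler_wpM2r//.
by rewrite ler_pdivlMl// mulr1 ltW.
Qed.

Lemma bern_norm n x (e : R) : (0 < n)%N -> 0 <= x <= 1 -> 0 < e ->
  bern n (fun i => `|i%:R / n%:R - x|) x <= e + e^-1 / n%:R.
Proof.
move=> n0 x01 e0; have nR : (0 : R) < n%:R by rewrite ltr0n.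
apply: le_trans
  (_ : bern n (fun i => e + (e^-1 / n%:R ^+ 2) * (i%:R - n%:R * x) ^+ 2) x <= _).
  apply: bern_le => // i _; apply: le_trans (norm_le_add_sqr _ e0) _.
  rewrite lerD2l -mulrA ler_wpM2l ?invr_ge0 ?(ltW e0)//.
  rewrite le_eqVlt; apply/orP; left; apply/eqP.
  by field; rewrite gt_eqF.
rewrite bernD bern_cst bernZ bern_sqr subrr expr0n addr0 lerD2l -!mulrA.
rewrite ler_wpM2l ?invr_ge0 ?(ltW e0)//.
rewrite (_ : _ * _ = x * (1 - x) / n%:R); last by field; rewrite gt_eqF.
by rewrite -[leRHS]mul1r ler_wpM2r ?invr_ge0 ?ltW//; have /andP[]:= x01; nra.
Qed.

Definition bern2 n (h : nat -> nat -> R) x y := bern n (fun i => bern n (h i) y) x.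

Lemma bern_sub_le n f x c : 0 <= x <= 1 ->
  `|bern n f x - c| <= bern n (fun i => `|f i - c|) x.
Proof.
move=> x01; rewrite ler_norml; apply/andP; split.
  have := @bern_le n (fun i => c + -1 * `|f i - c|) f x x01.
  rewrite bernD bern_cst bernZ => /(_ _) H.
  suff: c + -1 * bern n (fun i => `|f i - c|) x <= bern n f x by lra.
  apply: H => i _; have := ler_norm (c - f i); rewrite distrC; lra.
have := @bern_le n f (fun i => c + `|f i - c|) x x01.
rewrite bernD bern_cst => /(_ _) H.
suff: bern n f x <= c + bern n (fun i => `|f i - c|) x by lra.
apply: H => i _; have := ler_norm (f i - c); lra.
Qed.

Lemma bern2_approx (H : R -> R -> R) (K e : R) :
  0 <= K ->
  (forall x y x' y', 0 <= x <= 1 -> 0 <= y <= 1 -> 0 <= x' <= 1 -> 0 <= y' <= 1 ->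
    `|H x y - H x' y'| <= K * (`|x - x'| + `|y - y'|)) ->
  0 < e -> exists n, forall x y, 0 <= x <= 1 -> 0 <= y <= 1 ->
    `|bern2 n (fun i j => H (i%:R / n%:R) (j%:R / n%:R)) x y - H x y| <= e.
Proof.
move=> K0 HL e0.
(* Each coordinate contributes at most b + b^-1 / n <= 2 b once n >= b^-2, so the total error is at
   most 4 K b <= e. Using K + 1 keeps the denominator positive when K = 0. *)
pose b := e / (4 * (K + 1)).
have K1 : 0 < 4 * (K + 1) by lra.
have b0 : 0 < b by rewrite divr_gt0.
pose n := (Num.truncn (b^-1 ^+ 2)).+1.
have nb : b^-1 / n%:R <= b.
  rewrite ler_pdivrMr ?ltr0n// -ler_pdivrMl//.
  by rewrite -expr2; apply/ltW/Num.Theory.truncnS_gt.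
exists n => x y x01 y01.
have nR : (0 : R) < n%:R by rewrite ltr0n.
have frac (i : nat) : (i <= n)%N -> 0 <= (i%:R / n%:R : R) <= 1.
  move=> ni; rewrite divr_ge0 ?ler0n//= ler_pdivrMr// mul1r ler_nat//.
apply: le_trans (bern_sub_le _ _ _ x01) _.
apply: le_trans (_ : bern n (fun i => K * `|i%:R / n%:R - x| + K * (b + b^-1 / n%:R)) x <= _).
  apply: bern_le => // i ni.
  apply: le_trans (bern_sub_le _ _ _ y01) _.
  apply: le_trans (_ : bern n (fun j => K * `|i%:R / n%:R - x| + K * `|j%:R / n%:R - y|) y <= _).
    apply: bern_le => // j nj; rewrite -mulrDr; by apply: HL => //; exact: frac.
  rewrite bernD bern_cst bernZ lerD2l ler_wpM2l//.
  exact: bern_norm.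
rewrite bernD bern_cst bernZ -mulrDr.
apply: le_trans (_ : K * ((b + b^-1 / n%:R) + (b + b^-1 / n%:R)) <= _).
  by rewrite ler_wpM2l// lerD2r; exact: bern_norm.
apply: le_trans (_ : (K + 1) * (4 * b) <= _).
  apply: le_trans (_ : (K + 1) * (b + b^-1 / n%:R + (b + b^-1 / n%:R)) <= _).
    by rewrite ler_wpM2r ?lerDl// !addr_ge0 ?(ltW b0)// divr_ge0 ?invr_ge0 ?(ltW b0)// ltW.
  by rewrite ler_wpM2l ?addr_ge0//; lra.
by rewrite /b le_eqVlt; apply/orP; left; apply/eqP; field; lra.
Qed.

End bernstein.

(** * From mixed moments in the unit square to expectations of Lipschitz functions *)

Section moment_convergence.
Context d (T : measurableType d) d' (T' : measurableType d') (R : realType).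
Context (P : probability T R) (P' : probability T' R).
Variables (p q : R -> T -> R) (p' q' : T' -> R).
Hypothesis mp : forall t, measurable_fun setT (p t).
Hypothesis mq : forall t, measurable_fun setT (q t).
Hypothesis mp' : measurable_fun setT p'.
Hypothesis mq' : measurable_fun setT q'.
Hypothesis p01 : forall t w, 0 <= p t w <= 1.
Hypothesis q01 : forall t w, 0 <= q t w <= 1.
Hypothesis p'01 : forall w, 0 <= p' w <= 1.
Hypothesis q'01 : forall w, 0 <= q' w <= 1.

(** Boundedness is recorded next to the convergence so that the class is closed under linear
    combinations; starting from the monomials it then reaches all Bernstein polynomials. *)
Let good (h : R -> R -> R) := [/\
  (forall t, mbounded (fun w => h (p t w) (q t w))),
  mbounded (fun w => h (p' w) (q' w)) &
  \int[P]_w h (p t w) (q t w) @[t --> +oo] --> \int[P']_w h (p' w) (q' w)].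

Hypothesis moments : forall j k : nat,
  \int[P]_w (p t w ^+ j * q t w ^+ k) @[t --> +oo] -->
  \int[P']_w (p' w ^+ j * q' w ^+ k).

Let eq_good h1 h2 : (forall x y, h1 x y = h2 x y) -> good h1 -> good h2.
Proof. by move=> h12; have -> : h2 = h1 by apply/funext => x; apply/funext => y. Qed.

Let goodD h1 h2 : good h1 -> good h2 -> good (fun x y => h1 x y + h2 x y).
Proof.
move=> [a1 b1 c1] [a2 b2 c2]; split.
- by move=> t; exact: mboundedD.
- exact: mboundedD.
- rewrite ExD//; under eq_fun do rewrite ExD//.
  exact: cvgD.
Qed.

Let goodZ c h : good h -> good (fun x y => c * h x y).
Proof.
move=> [a1 b1 c1]; split.
- by move=> t; apply: mboundedM => //; exact: mbounded_cst.
- by apply: mboundedM => //; exact: mbounded_cst.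
- rewrite ExZ//; under eq_fun do rewrite ExZ//.
  by apply: cvgM => //; exact: cvg_cst.
Qed.

Let good_monomial j k : good (fun x y => x ^+ j * y ^+ k).
Proof.
have H dd (S : measurableType dd) (u v : S -> R) :
    measurable_fun setT u -> measurable_fun setT v ->
    (forall w, 0 <= u w <= 1) -> (forall w, 0 <= v w <= 1) ->
    mbounded (fun w => u w ^+ j * v w ^+ k).
  move=> mu mv u01 v01; apply: (@mboundedP _ _ _ _ 1).
    by apply: measurable_funM; exact: measurable_funX.
  move=> w; have /andP[u0 u1] := u01 w; have /andP[v0 v1] := v01 w.
  by rewrite mulr_ge0 ?exprn_ge0//= mulr_ile1 ?exprn_ge0 ?exprn_ile1.
by split; [move=> t; exact: H|exact: H|exact: moments].
Qed.

(** The recursion of [bern] multiplies by x and by 1 - x, so the induction has to carry a free power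
    x^j. The coefficients [G i] may depend on the variables: they will be the inner Bernstein
    polynomials in y. *)
Let good_bern_x n (G : nat -> R -> R -> R) :
  (forall i j, good (fun x y => x ^+ j * G i x y)) ->
  forall j, good (fun x y => x ^+ j * bern n (fun i => G i x y) x).
Proof.
elim: n G => [|n IH] G gG j /=; first exact: gG.
have g1 := IH (fun i => G i.+1) (fun i => gG i.+1).
have g2 := IH G gG.
apply: eq_good (goodD (g1 j.+1) (goodD (g2 j) (goodZ (-1) (g2 j.+1)))) => x y.
rewrite !exprS; set B1 := bern _ _ _; set B2 := bern _ _ _.
ring.
Qed.

Let good_bern_y n (h : nat -> R) j :
  forall k, good (fun x y => x ^+ j * (y ^+ k * bern n h y)).
Proof.
elim: n h => [|n IH] h k /=.
  by apply: eq_good (goodZ (h 0%N) (good_monomial j k)) => x y; ring.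
apply: eq_good (goodD (IH (h \o succn) k.+1) (goodD (IH h k) (goodZ (-1) (IH h k.+1)))) => x y.
rewrite !exprS; ring.
Qed.

Lemma cvg_lipschitz_of_moments (H : R -> R -> R) (K : R) : 0 <= K ->
  (forall x y x' y', 0 <= x <= 1 -> 0 <= y <= 1 -> 0 <= x' <= 1 -> 0 <= y' <= 1 ->
    `|H x y - H x' y'| <= K * (`|x - x'| + `|y - y'|)) ->
  (forall t, mbounded (fun w => H (p t w) (q t w))) ->
  mbounded (fun w => H (p' w) (q' w)) ->
  \int[P]_w H (p t w) (q t w) @[t --> +oo] --> \int[P']_w H (p' w) (q' w).
Proof.
move=> K0 HL mH mH'; apply/cvgrPdist_le => e e0.
have e3 : 0 < e / 3 by lra.
have [n Hn] := bern2_approx K0 HL e3.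
set B := bern2 n _ in Hn.
have gB : good B.
  apply: eq_good (@good_bern_x n _ _ 0%N) => [x y|i j]; first by rewrite expr0 mul1r.
  by apply: eq_good (@good_bern_y n (fun j => H (i%:R / n%:R) (j%:R / n%:R)) j 0) => x y;
    rewrite expr0 mul1r.
have [mB mB' cB] := gB.
have close dd (S : measurableType dd) (Q : probability S R) (u v : S -> R) :
    mbounded (fun w => H (u w) (v w)) -> mbounded (fun w => B (u w) (v w)) ->
    (forall w, 0 <= u w <= 1) -> (forall w, 0 <= v w <= 1) ->
    `|\int[Q]_w B (u w) (v w) - \int[Q]_w H (u w) (v w)| <= e / 3.
  move=> m1 m2 u01 v01; rewrite -ExB//.
  apply: le_trans (Ex_abs _ (mboundedB m2 m1)) _.
  rewrite -[leRHS](Ex_cst Q); apply: Ex_le; last by move=> w; exact: Hn.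
    have [mm [M HM]] := mboundedB m2 m1; split; first exact: measurableT_comp.
    by exists M => w; rewrite normr_id.
  exact: mbounded_cst.
have /cvgrPdist_le/(_ _ e3) := cB; apply: filterS => t /= Ht.
have C1 := close _ _ P (p t) (q t) (mH t) (mB t) (p01 t) (q01 t).
have C2 := close _ _ P' p' q' mH' mB' p'01 q'01.
move: Ht C1 C2; rewrite !ler_norml; set a1 := \int[_]_w _; set a2 := \int[_]_w _;
 set a3 := \int[_]_w _; set a4 := \int[_]_w _ => /andP[? ?] /andP[? ?] /andP[? ?].
by apply/andP; split; lra.
Qed.

End moment_convergence.

(** * Convergence of ratios from Laplace transforms *)

Section truncated_logarithm.
Context (R : realType).
Implicit Types (p q u v M : R).

(** The inverse of u |-> exp (- u), stopped at height M: - ln is not Lipschitz near 0, but becomes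
    so, with constant exp M, once its argument is kept above exp (- M). *)
Definition truncated_log M p := - ln (Num.max p (expR (- M))).

Lemma truncated_log_expR M u : truncated_log M (expR (- u)) = Num.min u M.
Proof.
rewrite /truncated_log; have [uM|Mu] := leP u M.
  by rewrite max_l ?ler_expR ?lerN2// expRK opprK.
by rewrite max_r ?ler_expR ?lerN2 ?(ltW Mu)// expRK opprK.
Qed.

Lemma ln_lipschitz c p q : 0 < c -> c <= p -> c <= q ->
  `|ln p - ln q| <= c^-1 * `|p - q|.
Proof.
move=> c0; wlog pq : p q / q <= p => [H cp cq|cp cq].
  have [/H|/ltW/H] := leP q p; first exact.
  by rewrite distrC (distrC p); apply.
have q0 := lt_le_trans c0 cq; have p0 := lt_le_trans c0 cp.
rewrite !ger0_norm ?subr_ge0 ?ler_ln ?posrE//.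
apply: le_trans (_ : p / q - 1 <= _).
  rewrite lerBrDl -[leRHS]lnK ?posrE ?divr_gt0// lnM ?posrE ?invr_gt0// lnV ?posrE//.
  exact: expR_ge1Dx.
rewrite (_ : _ - 1 = q^-1 * (p - q)); last by field; rewrite gt_eqF.
by rewrite ler_wpM2r ?subr_ge0// lef_pV2 ?posrE.
Qed.

Lemma max_lipschitz p q c : `|Num.max p c - Num.max q c| <= `|p - q|.
Proof.
wlog pq : p q / q <= p => [H|].
  have [/H//|/ltW/H] := leP q p.
  by rewrite distrC (distrC p).
rewrite [leRHS]ger0_norm ?subr_ge0// ger0_norm ?subr_ge0; last first.
  by rewrite le_max2.
by have [] := leP p c; have [] := leP q c; lra.
Qed.

Lemma truncated_log_lipschitz M p q :
  `|truncated_log M p - truncated_log M q| <= expR M * `|p - q|.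
Proof.
rewrite /truncated_log opprK addrC.
apply: le_trans (ln_lipschitz (expR_gt0 (- M)) _ _) _; rewrite ?le_max ?lexx ?orbT//.
by rewrite -expRN opprK ler_wpM2l ?expR_ge0// distrC max_lipschitz.
Qed.

Lemma truncated_log_ge0 M p : 0 <= M -> p <= 1 -> 0 <= truncated_log M p.
Proof.
move=> M0 p1; rewrite /truncated_log oppr_ge0 ln_le0// ge_max p1.
by rewrite -[leRHS]expR0 ler_expR oppr_le0.
Qed.

Lemma truncated_log_le M p : truncated_log M p <= M.
Proof.
rewrite /truncated_log lerNl -[leLHS]expRK ler_ln ?posrE ?lt_max ?expR_gt0 ?orbT//.
by rewrite le_max lexx orbT.
Qed.

(** Composed with an affine map this is the Lipschitz ramp that replaces indicators in the sandwich
    arguments. *)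
Definition clamp (z : R) := Num.max (Num.min z 1) 0.

Lemma clamp_ge0 z : 0 <= clamp z. Proof. by rewrite /clamp le_max lexx orbT. Qed.

Lemma clamp_le1 z : clamp z <= 1.
Proof. by rewrite /clamp ge_max ge_min lexx ler01 orbT. Qed.

Lemma clamp_eq0 z : z <= 0 -> clamp z = 0.
Proof. by move=> z0; rewrite /clamp max_r// ge_min z0. Qed.

Lemma clamp_eq1 z : 1 <= z -> clamp z = 1.
Proof. by move=> z1; rewrite /clamp min_r// max_l. Qed.

Lemma clamp_lipschitz y z : `|clamp y - clamp z| <= `|y - z|.
Proof.
apply: le_trans (max_lipschitz _ _ _) _.
rewrite -(opprK (Num.min y 1)) -(opprK (Num.min z 1)) !oppr_min -opprD normrN.
by apply: le_trans (max_lipschitz _ _ _) _; rewrite -opprD normrN.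
Qed.

Lemma measurable_clamp d (T : measurableType d) (f : T -> R) :
  measurable_fun setT f -> measurable_fun setT (fun w => clamp (f w)).
Proof. by move=> mf; apply: measurable_maxr => //; exact: measurable_minr. Qed.

End truncated_logarithm.

Section ratio_convergence.
Context d (T : measurableType d) d' (T' : measurableType d') (R : realType).
Context (P : probability T R) (P' : probability T' R).
Variables (A B : R -> T -> R) (U L : T' -> R).
Hypothesis mA : forall t, measurable_fun setT (A t).
Hypothesis mB : forall t, measurable_fun setT (B t).
Hypothesis mU : measurable_fun setT U.
Hypothesis mL : measurable_fun setT L.
Hypothesis A0 : forall t w, 0 <= A t w.
Hypothesis B0 : forall t w, 0 <= B t w.
Hypothesis U0 : forall w, 0 <= U w.
Hypothesis L0 : forall w, 0 <= L w.
Hypothesis L_pos : P' [set w | 0 < L w] = 1%E.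
Hypothesis laplace_cvg : forall j k : nat,
  \int[P]_w expR (- (j%:R * A t w + k%:R * B t w)) @[t --> +oo] -->
  \int[P']_w expR (- (j%:R * U w + k%:R * L w)).

(** With p = exp (- A) and q = exp (- B), the moments of p^j q^k are Laplace transforms at integer
    points, and [truncated_log] rewrites phi (min A M) (min B N) as a Lipschitz function of (p, q)
    on the unit square. *)
Lemma cvg_lipschitz_of_laplace (phi : R -> R -> R) (M N K : R) :
  0 <= M -> 0 <= N -> 0 <= K ->
  (forall u v u' v', 0 <= u <= M -> 0 <= v <= N -> 0 <= u' <= M -> 0 <= v' <= N ->
    `|phi u v - phi u' v'| <= K * (`|u - u'| + `|v - v'|)) ->
  (forall u v, 0 <= phi u v <= 1) ->
  (forall dd (S : measurableType dd) (f g : S -> R), measurable_fun setT f ->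
    measurable_fun setT g -> measurable_fun setT (fun w => phi (f w) (g w))) ->
  \int[P]_w phi (Num.min (A t w) M) (Num.min (B t w) N) @[t --> +oo] -->
  \int[P']_w phi (Num.min (U w) M) (Num.min (L w) N).
Proof.
move=> M0 N0 K0 phiL phi01 mphi.
pose H p q := phi (truncated_log M p) (truncated_log N q).
have HE u v : phi (Num.min u M) (Num.min v N) = H (expR (- u)) (expR (- v)).
  by rewrite /H !truncated_log_expR.
under eq_fun do under eq_Rintegral do rewrite HE.
have -> : \int[P']_w phi (Num.min (U w) M) (Num.min (L w) N) =
    \int[P']_w H (expR (- U w)) (expR (- L w)) by apply: eq_Rintegral => w _; exact: HE.
have e01 (u : R) : 0 <= u -> 0 <= expR (- u) <= 1.
  by move=> u0; rewrite expR_ge0/= -[leRHS]expR0 ler_expR oppr_le0.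
have mexp dd (S : measurableType dd) (f : S -> R) : measurable_fun setT f ->
    measurable_fun setT (fun w => expR (- f w)).
  move=> mf; apply: measurableT_comp; first exact: measurable_expR.
  exact: measurableT_comp.
have mH dd (S : measurableType dd) (f g : S -> R) : measurable_fun setT f ->
    measurable_fun setT g ->
    mbounded (fun w => H (expR (- f w)) (expR (- g w))).
  move=> mf mg; apply: (@mboundedP _ _ _ _ 1); last by move=> w; exact: phi01.
  under eq_fun do rewrite -HE; apply: mphi; exact: measurable_minr.
apply: (@cvg_lipschitz_of_moments _ _ _ _ _ P P' (fun t w => expR (- A t w))
  (fun t w => expR (- B t w)) (fun w => expR (- U w)) (fun w => expR (- L w))
  _ _ _ _ _ _ _ _ _ H (K * (expR M + expR N))) => //.
- by move=> t; exact: mexp.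
- by move=> t; exact: mexp.
- exact: mexp.
- exact: mexp.
- by move=> *; exact: e01.
- by move=> *; exact: e01.
- by move=> *; exact: e01.
- by move=> *; exact: e01.
- move=> j k.
  have E (u v : R) : expR (- u) ^+ j * expR (- v) ^+ k = expR (- (j%:R * u + k%:R * v)).
    by rewrite -!expRM_natl -expRD; congr expR; ring.
  under eq_fun do under eq_Rintegral do rewrite E.
  have -> : \int[P']_w (expR (- U w) ^+ j * expR (- L w) ^+ k) =
    \int[P']_w expR (- (j%:R * U w + k%:R * L w)) by apply: eq_Rintegral => w _; exact: E.
  exact: laplace_cvg.
- by rewrite mulr_ge0// addr_ge0// expR_ge0.
- move=> x y x' y' /andP[_ x1] /andP[_ y1] /andP[_ x'1] /andP[_ y'1].
  apply: le_trans (phiL _ _ _ _ _ _ _ _) _; rewrite ?truncated_log_ge0 ?truncated_log_le//.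
  rewrite -mulrA ler_wpM2l//.
  apply: le_trans (lerD (truncated_log_lipschitz _ _ _) (truncated_log_lipschitz _ _ _)) _.
  have := expR_ge0 M; have := expR_ge0 N.
  have := normr_ge0 (x - x'); have := normr_ge0 (y - y'); nra.
- by move=> t; exact: mH.
- exact: mH.
Qed.

(** A test function between the indicator of u <= a v^2 with e <= v <= N and the indicator of u < b
    v^2. The bound on the ratio is used in product form, which is polynomial and hence Lipschitz on
    bounded sets, without any division by v. *)
Let test_ratio (a b e N : R) : a < b -> 0 < e -> 0 <= N ->
  exists phi : R -> R -> R, [/\
  (forall dd (S : measurableType dd) (f g : S -> R), measurable_fun setT f ->
    measurable_fun setT g -> mbounded (fun w => phi (f w) (g w))),
  (forall u v, 0 <= phi u v <= 1),
  (forall u v, 0 <= u -> e <= v <= N -> u <= a * v ^+ 2 -> 1 <= phi u v),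
  (forall u v, 0 <= u -> 0 <= v -> ~ (u < b * v ^+ 2) -> phi u v <= 0) &
  \int[P]_w phi (A t w) (B t w) @[t --> +oo] --> \int[P']_w phi (U w) (L w)].
Proof.
move=> ab e0 N0.
(* The slope for which the ramp rises from 0 at u = b v^2 to 1 at u = a v^2 already when v = e; a
   larger v leaves more room. *)
pose K := ((b - a) * e ^+ 2)^-1.
have K0 : 0 < K by rewrite invr_gt0 mulr_gt0 ?subr_gt0 ?exprn_gt0.
(* When u exceeds M, its truncation M is still at least b (min v N)^2, so truncating does not
   destroy the vanishing of the ramp. *)
pose M := `|b| * N ^+ 2.
have M0 : 0 <= M by rewrite mulr_ge0 ?exprn_ge0.
pose psi u v := clamp (K * (b * v ^+ 2 - u)).
exists (fun u v => psi (Num.min u M) (Num.min v N)).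
have mpsi dd (S : measurableType dd) (f g : S -> R) : measurable_fun setT f ->
    measurable_fun setT g -> measurable_fun setT (fun w => psi (f w) (g w)).
  move=> mf mg; apply: measurable_clamp; apply: measurable_funM => //.
  apply: measurable_funB => //; apply: measurable_funM => //.
  exact: measurable_funX.
have psi01 u v : 0 <= psi u v <= 1 by rewrite clamp_ge0 clamp_le1.
split => //.
- move=> dd S f g mf mg; apply: (@mboundedP _ _ _ _ 1) => //.
  by apply: mpsi; exact: measurable_minr.
- move=> u v u0 /andP[ev vN] uv; rewrite /psi (min_l vN) clamp_eq1//.
  have -> : 1 = K * ((b - a) * e ^+ 2).
    by rewrite mulVf// gt_eqF// mulr_gt0 ?subr_gt0// exprn_gt0.
  rewrite ler_wpM2l ?(ltW K0)//.
  have h1 : Num.min u M <= u by rewrite ge_min lexx.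
  have h2 : e ^+ 2 <= v ^+ 2 by rewrite ler_pXn2r ?nnegrE// ltW// (lt_le_trans e0).
  have : (b - a) * e ^+ 2 <= (b - a) * v ^+ 2 by rewrite ler_wpM2l// subr_ge0 ltW.
  lra.
- move=> u v u0 v0 uv; rewrite /psi clamp_eq0// pmulr_rle0// subr_le0.
  rewrite leNgt; apply/negP => h; apply: uv.
  have v'v : Num.min v N ^+ 2 <= v ^+ 2.
    by rewrite ler_pXn2r ?nnegrE ?le_min ?v0// ge_min lexx.
  have v'N : Num.min v N ^+ 2 <= N ^+ 2.
    by rewrite ler_pXn2r ?nnegrE ?le_min ?v0// ge_min lexx orbT.
  have v'0 : 0 <= Num.min v N ^+ 2 by rewrite sqr_ge0.
  move: h; have [uM|Mu] := leP u M => h.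
    have b0 : 0 < b.
      rewrite ltNge; apply/negP => b0; move: h; apply/negP; rewrite -leNgt.
      by apply: le_trans u0; rewrite mulr_le0_ge0.
    by apply: lt_le_trans h _; rewrite ler_wpM2l// ltW.
  exfalso; move: h; apply/negP; rewrite -leNgt /M.
  apply: le_trans (_ : `|b| * Num.min v N ^+ 2 <= _); last by rewrite ler_wpM2l.
  by rewrite ler_wpM2r// ler_norm.
- apply: (@cvg_lipschitz_of_laplace psi M N (K * (`|b| * (2 * N) + 1))) => //.
    by rewrite mulr_ge0 ?(ltW K0)// addr_ge0// !mulr_ge0.
  move=> u v u' v' _ /andP[v0 vN] _ /andP[v'0 v'N].
  apply: le_trans (clamp_lipschitz _ _) _.
  rewrite -mulrBr normrM (ger0_norm (ltW K0)) -mulrA ler_wpM2l ?(ltW K0)//.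
  rewrite (_ : _ - _ = b * ((v + v') * (v - v')) - (u - u')); last ring.
  apply: le_trans (ler_normB _ _) _.
  rewrite !normrM (ger0_norm (addr_ge0 v0 v'0)).
  have h1 : (v + v') * `|v - v'| <= 2 * N * `|v - v'|.
    by rewrite ler_wpM2r//; lra.
  have h2 := ler_wpM2l (normr_ge0 b) h1.
  have h3 : 0 <= `|b| * (2 * N) * `|u - u'| by rewrite !mulr_ge0.
  have h4 := normr_ge0 (v - v').
  lra.
Qed.

(** Tightness of [B t] inside ]0, +oo[ is read off from the limit: the test function is 1 outside
    [e, N] and vanishes on [2 e, N - 1], the gaps leaving room for Lipschitz ramps. *)
Let test_tails (e N : R) : 0 < e -> e <= N ->
  exists phi : R -> R, [/\
  (forall dd (S : measurableType dd) (f : S -> R), measurable_fun setT f ->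
    mbounded (fun w => phi (f w))),
  (forall v, 0 <= phi v <= 1),
  (forall v, 0 <= v -> ~ (e <= v <= N) -> 1 <= phi v),
  (forall v, 0 <= v -> e * 2 <= v <= N - 1 -> phi v <= 0) &
  \int[P]_w phi (B t w) @[t --> +oo] --> \int[P']_w phi (L w)].
Proof.
move=> e0 eN; have N0 : 0 <= N by apply: le_trans eN; exact: ltW.
pose psi (v : R) := clamp (2 - e^-1 * v) + clamp (v - (N - 1)).
have mpsi dd (S : measurableType dd) (f : S -> R) : measurable_fun setT f ->
    measurable_fun setT (fun w => clamp (psi (f w))).
  move=> mf; apply: measurable_clamp; apply: measurable_funD; apply: measurable_clamp.
    by apply: measurable_funB => //; exact: measurable_funM.
  exact: measurable_funB.
exists (fun v => clamp (psi (Num.min v N))); split.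
- move=> dd S f mf; apply: (@mboundedP _ _ _ _ 1).
    by apply: mpsi; exact: measurable_minr.
  by move=> x; rewrite clamp_ge0 clamp_le1.
- by move=> v; rewrite clamp_ge0 clamp_le1.
- move=> v v0 /negP; rewrite negb_and -!ltNge => /orP[ve|Nv].
    rewrite clamp_eq1// /psi (@clamp_eq1 _ (2 - _)) ?lerDl ?clamp_ge0//.
    rewrite min_l; last by rewrite ltW// (lt_le_trans ve).
    have : e^-1 * v <= 1 by rewrite ler_pdivrMl// mulr1 ltW.
    lra.
  rewrite /psi min_r ?(ltW Nv)// (@clamp_eq1 _ (N - _)); last lra.
  have h : 1 <= clamp (2 - e^-1 * N) + 1 by rewrite lerDr clamp_ge0.
  by rewrite clamp_eq1.
- move=> v v0 /andP[ev vN]; rewrite clamp_eq0// /psi min_l; last by lra.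
  rewrite !clamp_eq0 ?addr0//; first lra.
  have : 2 <= e^-1 * v by rewrite ler_pdivlMl.
  lra.
- apply: (@cvg_lipschitz_of_laplace (fun _ v => clamp (psi v)) 0 N (e^-1 + 1)) => //.
  + by rewrite addr_ge0 ?invr_ge0 ?ltW.
  + move=> u v u' v' _ _ _ _; apply: le_trans (clamp_lipschitz _ _) _.
    rewrite /psi (_ : _ - _ = (clamp (2 - e^-1 * v) - clamp (2 - e^-1 * v')) +
      (clamp (v - (N - 1)) - clamp (v' - (N - 1)))); last ring.
    apply: le_trans (ler_normD _ _) _.
    apply: le_trans (lerD (clamp_lipschitz _ _) (clamp_lipschitz _ _)) _.
    rewrite (_ : _ - _ - _ = - (e^-1 * (v - v'))); last ring.
    rewrite (_ : _ - _ - (v' - _) = v - v'); last ring.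
    have ei : 0 <= e^-1 by rewrite invr_ge0 ltW.
    rewrite normrN normrM (ger0_norm ei) mulrDr !mulrDl.
    have := mulr_ge0 ei (normr_ge0 (u - u')).
    have := normr_ge0 (u - u'); lra.
  + by move=> u v; rewrite clamp_ge0 clamp_le1.
  + by move=> dd S f g _ mg; exact: mpsi.
Qed.

Let mratio dd (S : measurableType dd) (f g : S -> R) (x : R) :
  measurable_fun setT f -> measurable_fun setT g ->
  measurable [set w | f w / g w ^+ 2 <= x].
Proof.
move=> mf mg.
have m : measurable_fun setT (fun w => f w / g w ^+ 2).
  apply: measurable_funM => //; apply: measurableT_comp (measurable_funX _ mg).
  exact: measurable_invr.
rewrite (_ : [set w | _] = (fun w => f w / g w ^+ 2) @^-1` `]-oo, x]); last first.
  by apply/seteqP; split => w /=; rewrite in_itv.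
by rewrite -[X in measurable X]setTI; exact: m.
Qed.

Let mitv dd (S : measurableType dd) (g : S -> R) (a b : R) :
  measurable_fun setT g -> measurable [set w | a <= g w <= b].
Proof.
move=> mg; rewrite (_ : [set w | _] = g @^-1` `[a, b]); last first.
  by apply/seteqP; split => w /=; rewrite in_itv.
by rewrite -[X in measurable X]setTI; exact: mg.
Qed.

Let tails_small (eps : R) : 0 < eps -> exists e N : R,
  [/\ 0 < e, e <= N & 1 - eps <= fine (P' [set w | e * 2 <= L w <= N - 1])].
Proof.
move=> eps0.
pose E (n : nat) := [set w | n.+1%:R^-1 <= L w <= n%:R].
have mE n : measurable (E n) by exact: mitv.
have UE : \bigcup_n E n = [set w | 0 < L w].
  apply/seteqP; split => [w [n _ /andP[h _]]|w /= Lw]; first exact: lt_le_trans h.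
  have [n hn] : exists n : nat, (L w)^-1 <= n%:R /\ L w <= n%:R.
    exists (Num.truncn (Num.max (L w)^-1 (L w))).+1.
    by split; apply: ltW; apply: le_lt_trans (Num.Theory.truncnS_gt _);
      rewrite le_max lexx ?orbT.
  exists n => //; rewrite /E /=; case: hn => h1 ->; rewrite andbT.
  rewrite -[leRHS]invrK lef_pV2 ?posrE ?invr_gt0//.
  by apply: le_trans h1 _; rewrite ler_nat.
have mUE : measurable (\bigcup_n E n) by exact: bigcup_measurable.
have ndE : nondecreasing_seq E.
  move=> m n mn; apply/subsetPset => w /= /andP[h1 h2]; apply/andP; split.
    by apply: le_trans h1; rewrite lef_pV2 ?posrE// ler_nat.
  by apply: le_trans h2 _; rewrite ler_nat.
have cE : (P' \o E) n @[n --> \oo] --> P' [set w | 0 < L w].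
  by rewrite -UE; exact: nondecreasing_cvg_mu.
rewrite L_pos in cE; have cE' : fine (P' (E n)) @[n --> \oo] --> (1 : R) by apply: fine_cvg; exact: cE.
have /cvgrPdist_le/(_ _ eps0) := cE'; move=> [n _ /(_ n (leqnn n)) /=].
rewrite ler_norml => /andP[_ h].
(* Chosen so that the interval [2 e, N - 1] is the one defining [E n], whose probabilities increase
   to P'(L > 0) = 1. *)
exists (n.+1%:R^-1 / 2), (n%:R + 1); split.
- by rewrite divr_gt0 ?invr_gt0.
- apply: le_trans (_ : 1 <= _); last by rewrite lerDr.
  rewrite ler_pdivrMr// mul1r; apply: le_trans (_ : 1 <= _); last by rewrite ler1n.
  by rewrite invf_le1// ler1n.
- by rewrite divfK// addrK; rewrite /E in h; lra.
Qed.

(** [phi1], with thresholds x - eta and x, lies below the indicator of the event; [phi2], with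
    thresholds x and x + eta, lies above it up to [psi], which pays for B outside [e, N]. The three
    expectations converge and continuity at x closes the gap; at most four errors of eps / 5 add up
    on either side. *)
Lemma cvg_ratio_of_laplace (x : R) :
  {for x, continuous (fun y => fine (P' [set w | U w / L w ^+ 2 <= y]))} ->
  fine (P [set w | A t w / B t w ^+ 2 <= x]) @[t --> +oo] -->
  fine (P' [set w | U w / L w ^+ 2 <= x]).
Proof.
move=> cx; apply/cvgrPdist_le => eps eps0.
pose F y := fine (P' [set w | U w / L w ^+ 2 <= y]).
have e5 : 0 < eps / 5 by lra.
have [eta eta0 Fx] : exists2 eta : R, 0 < eta & forall y, `|x - y| <= eta -> `|F x - F y| <= eps / 5.
  have /cvgrPdist_le/(_ _ e5)/nbhs_ballP[r /= r0 hr] := cx.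
  exists (r / 2); first by rewrite divr_gt0.
  by move=> y xy; apply: hr; rewrite /ball/=; apply: le_lt_trans xy _; lra.
have [e [N [ee eN tl]]] := tails_small e5.
have N0 : 0 <= N by apply: le_trans eN; exact: ltW.
have [phi2 [m2 p2 ge2 le2 c2]] := @test_ratio x (x + eta) e N (ltac:(lra)) ee N0.
have [phi1 [m1 p1 ge1 le1 c1]] := @test_ratio (x - eta) x e N (ltac:(lra)) ee N0.
have [psi [mp pp gep lep cp]] := test_tails ee eN.
have mR2 : measurable [set w | U w / L w ^+ 2 <= x + eta] by exact: mratio.
have mR1 : measurable [set w | U w / L w ^+ 2 <= x - eta] by exact: mratio.
have mTl : measurable [set w | e * 2 <= L w <= N - 1] by exact: mitv.
have PTl : fine (P' (~` [set w | e * 2 <= L w <= N - 1])) <= eps / 5.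
  rewrite probability_setC// fineB ?fin_num_measure//=; lra.
(* For v = 0 the premise reads u < 0, which is impossible, so the convention x / 0 = 0 does no
   harm. *)
have ratio_lt (u v y : R) : 0 <= u -> 0 <= v -> u < y * v ^+ 2 -> u / v ^+ 2 <= y.
  move=> u0; rewrite le_eqVlt => /predU1P[<-|v0 uv]; first by rewrite expr0n mulr0 ltNge u0.
  by rewrite ler_pdivrMr ?exprn_gt0// ltW.
have ratio_le (u v y : R) : 0 < v -> u / v ^+ 2 <= y -> u <= y * v ^+ 2.
  by move=> v0; rewrite ler_pdivrMr ?exprn_gt0.
have L2 : \int[P']_w phi2 (U w) (L w) <= F (x + eta).
  apply: Ex_le_indic => //; first exact: m2.
    by move=> w; have /andP[] := p2 (U w) (L w).
  by move=> w /= h; apply: le2 => // h'; apply: h; exact: ratio_lt.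
have Lp : \int[P']_w psi (L w) <= eps / 5.
  apply: le_trans PTl; apply: Ex_le_indic => //.
  - exact: mp.
  - exact: measurableC.
  - by move=> w; have /andP[] := pp (L w).
  - by move=> w /= /contrapT h; apply: lep.
have L1 : F (x - eta) - eps / 5 <= \int[P']_w phi1 (U w) (L w).
  have : fine (P' ([set w | U w / L w ^+ 2 <= x - eta] `&` [set w | e * 2 <= L w <= N - 1]))
      <= \int[P']_w phi1 (U w) (L w).
    apply: Ex_ge_indic; [exact: m1|exact: measurableI| |].
      by move=> w; have /andP[] := p1 (U w) (L w).
    move=> w [/= h1 /andP[h2 h3]].
    have Lw : 0 < L w by apply: lt_le_trans h2; rewrite mulr_gt0.
    by apply: ge1 => //; [apply/andP; split; lra|exact: ratio_le].
  apply: le_trans; rewrite lerBlDr.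
  pose S1 := [set w | U w / L w ^+ 2 <= x - eta] `&` [set w | e * 2 <= L w <= N - 1].
  pose S2 := ~` [set w | e * 2 <= L w <= N - 1].
  have mS1 : measurable S1 by exact: measurableI.
  have mS2 : measurable S2 by exact: measurableC.
  have h : F (x - eta) <= fine (P' S1) + fine (P' S2).
    rewrite -fineD ?fin_num_measure//.
    apply: fine_le; rewrite ?fin_numD ?fin_num_measure//.
    rewrite -measureU//.
      apply: le_measure; rewrite ?inE//; first exact: measurableU.
      move=> w h; have [h'|h'] := pselect ([set w | e * 2 <= L w <= N - 1] w);
        [by left|by right].
    by apply/seteqP; split => // w [[_ h]].
  by apply: le_trans h _; rewrite lerD2l.
have F2 : F (x + eta) <= F x + eps / 5.
  have := Fx (x + eta); rewrite opprD addrA subrr sub0r normrN (ger0_norm (ltW eta0)) lexx.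
  by move=> /(_ isT); rewrite ler_norml => /andP[? ?]; lra.
have F1 : F x - eps / 5 <= F (x - eta).
  have := Fx (x - eta); rewrite opprB addrC subrK (ger0_norm (ltW eta0)) lexx.
  by move=> /(_ isT); rewrite ler_norml => /andP[? ?]; lra.
move/cvgrPdist_le : c1 => /(_ _ e5); move/cvgrPdist_le : c2 => /(_ _ e5).
move/cvgrPdist_le : cp => /(_ _ e5).
apply: filterS3 => t /=; rewrite !ler_norml => /andP[t1 t2] /andP[t3 t4] /andP[t5 t6].
have mRt : measurable [set w | A t w / B t w ^+ 2 <= x] by exact: mratio.
have up : fine (P [set w | A t w / B t w ^+ 2 <= x]) <=
    \int[P]_w phi2 (A t w) (B t w) + \int[P]_w psi (B t w).
  rewrite -ExD; [|exact: m2|exact: mp].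
  apply: Ex_ge_indic => //; first by apply: mboundedD; [exact: m2|exact: mp].
    by move=> w; have /andP[? _] := p2 (A t w) (B t w); have /andP[? _] := pp (B t w);
      exact: addr_ge0.
  move=> w /= h; have [h'|h'] := pselect (e <= B t w <= N).
    have Bw : 0 < B t w by have /andP[+ _] := h'; exact: lt_le_trans.
    by rewrite -[leLHS]addr0 lerD//; [apply: ge2 => //; exact: ratio_le|have /andP[] := pp (B t w)].
  by rewrite -[leLHS]add0r lerD//; [have /andP[] := p2 (A t w) (B t w)|exact: gep].
have dn : \int[P]_w phi1 (A t w) (B t w) <= fine (P [set w | A t w / B t w ^+ 2 <= x]).
  apply: Ex_le_indic => //; first exact: m1.
    by move=> w; have /andP[] := p1 (A t w) (B t w).
  by move=> w /= h; apply: le1 => // h'; apply: h; exact: ratio_lt.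
rewrite -/(F x); apply/andP; split; lra.
Qed.

End ratio_convergence.

(** * Tails and truncated means *)

Section pinfty.
Context (R : realType).

Lemma cvg_scale_pinfty (c : R) : 0 < c -> c * x @[x --> +oo] --> +oo.
Proof.
move=> c0; apply/cvgryPge => A.
have := nbhs_pinfty_ge (num_real (A / c)); apply: filterS => x.
by rewrite ler_pdivrMr// mulrC.
Qed.

Lemma near_scale_pinfty (Q : R -> Prop) (c : R) : 0 < c ->
  (\forall x \near +oo, Q x) -> \forall x \near +oo, Q (c * x).
Proof. by move=> c0 nQ; exact: (cvg_scale_pinfty c0). Qed.

Lemma near_pinfty_and (P Q : R -> Prop) : (\forall x \near +oo, P x) ->
  (\forall x \near +oo, Q x) -> \forall x \near +oo, P x /\ Q x.
Proof. by move=> nP nQ; apply: filterS2 nP nQ. Qed.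

Lemma cvg_at_pinfty_comp (f a : R -> R) (l : R) :
  f x @[x --> +oo] --> l -> a t @[t --> +oo] --> +oo -> f (a t) @[t --> +oo] --> l.
Proof. by move=> fl aoo; exact: cvg_comp aoo fl. Qed.

End pinfty.

Section tail.
Context d (T : measurableType d) (R : realType) (P : probability T R).
Variable Y : T -> R.
Hypothesis mY : measurable_fun setT Y.
Hypothesis Y0 : forall w, 0 <= Y w.
Implicit Types x y c : R.

Definition tail (x : R) : R := fine (P [set w | x < Y w]).
(** Truncating by a minimum instead of an indicator makes this a primitive of [tail], hence concave,
    and it is finite even when Y has infinite mean. *)
Definition truncated_mean (x : R) : R := \int[P]_w Num.min (Y w) x.

Local Notation m := truncated_mean.

Let mgt x : measurable [set w | x < Y w].
Proof. exact: measurable_fun_gt. Qed.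

Lemma EFin_tail x : (tail x)%:E = P [set w | x < Y w].
Proof. by rewrite fineK// fin_num_measure. Qed.

Lemma tail_ge0 x : 0 <= tail x.
Proof. by rewrite fine_ge0. Qed.

Lemma tail_le1 x : tail x <= 1.
Proof.
by rewrite -[leRHS]/(fine 1%E) fine_le ?fin_num_measure//; exact: probability_le1.
Qed.

Lemma tail_nonincreasing x y : x <= y -> tail y <= tail x.
Proof.
move=> xy; rewrite fine_le ?fin_num_measure//; apply: le_measure; rewrite ?inE//.
by move=> w /=; exact: le_lt_trans.
Qed.

Lemma measurable_tail : measurable_fun setT tail.
Proof. by apply: nonincreasing_measurable => // x y; exact: tail_nonincreasing. Qed.

Lemma mbounded_min x : 0 <= x -> mbounded (fun w => Num.min (Y w) x).
Proof.
move=> x0; apply: (@mboundedP _ _ _ _ x); first exact: measurable_minr.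
by move=> w; rewrite le_min Y0 x0 ge_min lexx orbT.
Qed.

Lemma tailE x : tail x = \int[P]_w (\1_[set w | x < Y w] w : R).
Proof. by rewrite Ex_indic. Qed.

(** An integral-free form of m' = [tail]: pointwise, min Y y - min Y x lies between (y - x) 1_{Y >
    y} and (y - x) 1_{Y > x}. Most estimates on m rest on it. *)
Lemma truncated_mean_incr x y : 0 <= x -> x <= y ->
  (y - x) * tail y <= m y - m x <= (y - x) * tail x.
Proof.
move=> x0 xy; have y0 := le_trans x0 xy.
have mi z : mbounded (\1_[set w | z < Y w] : T -> R).
  exact: mbounded_indic.
rewrite /truncated_mean -ExB; [|exact: mbounded_min|exact: mbounded_min].
rewrite !tailE -!ExZ//.
apply/andP; split; apply: Ex_le; rewrite ?mbounded_min //.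
- by apply: mboundedM => //; exact: mbounded_cst.
- by apply: mboundedB; exact: mbounded_min.
- move=> w; rewrite indic_set; have [h|h] := ltP y (Y w).
    by rewrite mulr1 min_r// (le_trans xy)// ltW.
  by rewrite mulr0 subr_ge0 ge_min lexx.
- by apply: mboundedB; exact: mbounded_min.
- by apply: mboundedM => //; exact: mbounded_cst.
- move=> w; rewrite indic_set; have [h|h] := ltP x (Y w).
    by rewrite mulr1 lerB// ge_min lexx orbT.
  by rewrite mulr0 min_l ?(le_trans h)// subr_le0.
Qed.

Lemma truncated_mean0 : m 0 = 0.
Proof.
rewrite /truncated_mean (_ : (fun w => Num.min (Y w) 0) = cst 0) ?Ex_cst//.
by apply/funext => w; rewrite min_r.
Qed.

Lemma truncated_mean_nd x y : 0 <= x -> x <= y -> m x <= m y.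
Proof.
move=> x0 xy; have /andP[h _] := truncated_mean_incr x0 xy.
by rewrite -subr_ge0; apply: le_trans h; rewrite mulr_ge0 ?tail_ge0 ?subr_ge0.
Qed.

Lemma truncated_mean_ge0 x : 0 <= x -> 0 <= m x.
Proof. by move=> x0; rewrite -[leLHS]truncated_mean0 truncated_mean_nd. Qed.

Lemma truncated_mean_ge x : 0 <= x -> x * tail x <= m x.
Proof.
move=> x0; have /andP[h _] := truncated_mean_incr (lexx 0) x0.
by move: h; rewrite truncated_mean0 !subr0.
Qed.

Lemma truncated_meanE x : 0 <= x ->
  m x = \int[lebesgue_measure]_(u in `]0, x]) tail u.
Proof.
move=> x0; pose g : R -> R := \1_(`]0, x]%classic).
have mg : measurable_fun setT g by exact: measurable_indic.
have g0 y : 0 <= g y by rewrite /g indicE.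
have := layer_cake P mY mg g0; rewrite /truncated_mean /Rintegral.
have -> : (\int[P]_w \int[lebesgue_measure]_(y in `]0%R, Y w[) (g y)%:E =
           \int[P]_w (Num.min (Y w) x)%:E)%E.
  apply: eq_integral => w _.
  rewrite integral_indic//; have [Yx|xY] := leP (Y w) x.
    rewrite setIidr; last first.
      by move=> u /=; rewrite !in_itv/= => /andP[-> /ltW/le_trans]; exact.
    rewrite /= lebesgue_measure_itv/= lte_fin oppr0 adde0.
    by case: ltgtP (Y0 w) => // <-.
  rewrite setIidl; last first.
    by move=> u /=; rewrite !in_itv/= => /andP[-> /le_lt_trans]; exact.
  rewrite /= lebesgue_measure_itv/= lte_fin oppr0 adde0.
  by case: ltgtP x0 => // <-.
move=> ->; congr fine.
rewrite -[in RHS](setIidr (_ : `]0, x] `<=` `]0%R, +oo[)%classic); last first.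
  by move=> u /=; rewrite !in_itv/= andbT => /andP[].
rewrite integral_mkcondr; apply: eq_integral => u _.
rewrite patchE /g indicE; by case: ifPn => _; rewrite ?mul0e// mul1e EFin_tail.
Qed.

Lemma truncated_mean_cvgy : 'E_P[Y]%E = +oo%E -> m x @[x --> +oo] --> +oo.
Proof.
move=> EY.
have mn : (\int[P]_w (Num.min (Y w) n%:R)%:E)%E @[n --> \oo] --> +oo%E.
  have YL w : limn (fun n => (Num.min (Y w) n%:R)%:E) = (Y w)%:E.
    apply/cvg_lim => //; apply: cvg_EFin; first exact: nearW.
    apply: cvg_near_cst; near=> n; rewrite /= min_l//; near: n.
    exact: nbhs_infty_ger.
  rewrite -EY unlock -(eq_integral _ _ (fun w _ => YL w)).
  apply: cvg_monotone_convergence => //.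
  - by move=> n; apply/measurable_EFinP; exact: measurable_minr.
  - by move=> n w _; rewrite lee_fin le_min Y0 ler0n.
  - move=> w _ n k nk; rewrite lee_fin le_min ge_min lexx/= ge_min.
    by rewrite ler_nat nk orbT.
apply/cvgryPge => A; have /cvgeyPge/(_ A)[n _ /(_ n (leqnn n)) /=] := mn.
rewrite -EFin_Ex; last exact: mbounded_min.
rewrite lee_fin => An; have := nbhs_pinfty_ge (num_real (n%:R : R)).
by apply: filterS => x nx; apply: le_trans An _; exact: truncated_mean_nd.
Unshelve. all: by end_near. Qed.

(** * Tails that are regularly varying of index -1 *)

Section regular_variation.
Variable l : R -> R.
Hypothesis l_sv : slowly_varying l.
Hypothesis tail_l : tail x / (x^-1 * l x) @[x --> +oo] --> (1 : R).
Hypothesis EY : 'E_P[Y]%E = +oo%E.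

(** A zero of [tail] would persist to its right by monotonicity, against the ratio of [tail] to x^-1
    l(x) tending to 1. *)
Lemma tail_gt0 x : 0 < tail x.
Proof.
have : \forall y \near +oo, 0 < tail y.
  have [_ l0 _] := l_sv.
  have := nbhs_pinfty_gt (num_real (0 : R)).
  have /cvgr_gt/(_ _ (ltr01)) := tail_l.
  apply: filterS2 => y h y0; rewrite lt_neqAle tail_ge0 andbT.
  by apply: contraTN h => /eqP <-; rewrite mul0r ltxx.
move=> [M [_ HM]].
have := HM (Num.max x (M + 1)); rewrite lt_max ltrDl ltr01 orbT => /(_ isT) h.
by apply: lt_le_trans h _; apply: tail_nonincreasing; rewrite le_max lexx.
Qed.

Lemma tail_rv c : 0 < c -> tail (c * x) / tail x @[x --> +oo] --> c^-1.
Proof.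
move=> c0; have [_ l0 lc] := l_sv.
have h1 : tail (c * x) / ((c * x)^-1 * l (c * x)) @[x --> +oo] --> (1 : R).
  exact: cvg_at_pinfty_comp tail_l (cvg_scale_pinfty c0).
have h2 : (tail x / (x^-1 * l x))^-1 @[x --> +oo] --> (1^-1 : R).
  by apply: cvgV; rewrite ?oner_neq0.
have h3 : tail (c * x) / ((c * x)^-1 * l (c * x)) * (l (c * x) / l x) *
    (tail x / (x^-1 * l x))^-1 * c^-1 @[x --> +oo] --> 1 * 1 * 1^-1 * c^-1.
  by apply: cvgM; [apply: cvgM => //; apply: cvgM => //; exact: lc|exact: cvg_cst].
rewrite !mul1r invr1 mul1r in h3.
apply: cvg_trans h3; apply: near_eq_cvg.
have l0c := near_scale_pinfty c0 l0.
have := nbhs_pinfty_gt (num_real (0 : R)).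
apply: filterS3 l0 l0c => x lx lcx x0 /=.
have tx := tail_gt0 x.
by field; rewrite !gt_eqF// mulr_gt0.
Qed.

(** For index -1 all dyadic scales contribute about equally to m. Passing from x / 2 to x adds at
    least (x / 2) tail(x), while the bound at x / 2 is almost preserved because (x / 2) tail(x / 2)
    is close to x tail(x); hence k / 4 can be raised to (k + 1) / 4. *)
Lemma tail_ratio_lt k : \forall x \near +oo, k%:R / 4 * (x * tail x) <= m x.
Proof.
elim: k => [|k IH].
  have := nbhs_pinfty_ge (num_real (0 : R)); apply: filterS => x x0.
  by rewrite !mul0r truncated_mean_ge0.
have h2 : 0 < (2^-1 : R) by rewrite invr_gt0.
have IH2 := near_scale_pinfty h2 IH.
(* A relative loss of 1 / (k + 1) is affordable: k / 4 * (1 - 1 / (k + 1)) + 1 / 2 still exceeds (k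
   + 1) / 4, by 1 / (4 (k + 1)). *)
have k2 : 2 * (1 - k.+1%:R^-1) < (2^-1)^-1 :> R.
  have : 0 < k.+1%:R^-1 :> R by rewrite invr_gt0.
  rewrite invrK; move: (k.+1%:R^-1) => z; lra.
have /cvgr_gt/(_ _ k2) := tail_rv h2.
have := nbhs_pinfty_gt (num_real (0 : R)).
apply: filterS3 IH2 => x H x0 rx.
have x2 : 0 <= 2^-1 * x by rewrite mulr_ge0// ltW.
have x2x : 2^-1 * x <= x by lra.
have /andP[h _] := truncated_mean_incr x2 x2x.
have tx := tail_gt0 x.
move: rx; rewrite ltr_pdivlMr// => rx.
have h' : x * (1 - k.+1%:R^-1) * tail x <= 2^-1 * x * tail (2^-1 * x).
  have := ler_wpM2l x2 (ltW rx); move: (k.+1%:R^-1) => z; lra.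
have h'' := ler_wpM2l (_ : 0 <= k%:R / 4) h'.
have kR : k%:R / 4 * (1 - k.+1%:R^-1) + 2^-1 >= k.+1%:R / 4 :> R.
  rewrite -subr_ge0 (_ : _ - _ = k.+1%:R^-1 / 4) ?divr_ge0//.
  by rewrite -natr1; field; rewrite ?natr1 ?nat1r ?pnatr_eq0 /=; lra.
have := ler_wpM2r (mulr_ge0 (ltW x0) (ltW tx)) kR.
have := h'' (ltac:(by rewrite divr_ge0)).
move: H h; set z : R := k.+1%:R^-1; set k1 : R := k.+1%:R; set k0 : R := k%:R.
set p := tail (2^-1 * x); set q := tail x; set r := m x; set r' := m (2^-1 * x).
move: z k1 k0 p q r r' => z k1 k0 p q r r'; lra.
Qed.

Lemma truncated_mean_gt0 x : 0 < x -> 0 < m x.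
Proof.
move=> x0; apply: lt_le_trans (truncated_mean_ge (ltW x0)).
by rewrite mulr_gt0 ?tail_gt0.
Qed.

Lemma tail_truncated_mean : x * tail x / m x @[x --> +oo] --> (0 : R).
Proof.
apply/cvgrPdist_le => e e0.
have [k hk] : exists k : nat, 4 / e < k%:R.
  by exists (Num.truncn (4 / e)).+1; exact: Num.Theory.truncnS_gt.
have := nbhs_pinfty_gt (num_real (0 : R)).
apply: filterS2 (tail_ratio_lt k) => x h x0.
have mx := truncated_mean_gt0 x0; have tx := tail_gt0 x.
rewrite sub0r normrN ger0_norm ?divr_ge0 ?mulr_ge0 ?(ltW mx) ?(ltW x0) ?tail_ge0//.
rewrite ler_pdivrMr//.
have k0 : (0 : R) < k%:R by apply: lt_trans hk; rewrite divr_gt0.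
rewrite -(ler_pM2l (_ : 0 < k%:R / 4)) ?divr_gt0//.
apply: le_trans h _; rewrite mulrA ler_peMl ?ltW//.
by move: hk; rewrite ltr_pdivrMr//; lra.
Qed.

(** For c >= 1 the increment m(c x) - m(x) is at most (c - 1) x tail(x) = o(m(x)). For c < 1 this is
    applied to c^-1 at the point c x and inverted. *)
Lemma truncated_mean_sv c : 0 < c -> m (c * x) / m x @[x --> +oo] --> (1 : R).
Proof.
have main b : 1 <= b -> m (b * x) / m x @[x --> +oo] --> (1 : R).
  move=> b1; apply/cvgrPdist_le => e e0.
  have e1 : 0 < e / b by rewrite divr_gt0// (lt_le_trans ltr01).
  have /cvgrPdist_le/(_ _ e1) := tail_truncated_mean.
  have := nbhs_pinfty_gt (num_real (0 : R)).
  apply: filterS2 => x x0; rewrite sub0r normrN.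
  have mx := truncated_mean_gt0 x0; have tx := tail_gt0 x.
  rewrite ger0_norm ?divr_ge0 ?mulr_ge0 ?(ltW mx) ?(ltW x0) ?tail_ge0// => h.
  have xb : x <= b * x by rewrite ler_peMl// ltW.
  have /andP[_ h2] := truncated_mean_incr (ltW x0) xb.
  have h3 := truncated_mean_nd (ltW x0) xb.
  rewrite distrC ger0_norm; last by rewrite subr_ge0 ler_pdivlMr// mul1r.
  rewrite lerBlDr ler_pdivrMr// mulrDl mul1r.
  move: h; rewrite ler_pdivrMr// => h.
  have b0 : 0 <= b by rewrite (le_trans ler01).
  have := ler_wpM2l b0 h.
  rewrite (_ : b * (e / b * m x) = e * m x); last by field; rewrite gt_eqF// (lt_le_trans ltr01).
  have : 0 <= x * tail x by rewrite mulr_ge0 ?ltW.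
  lra.
move=> c0; have [c1|c1] := leP 1 c; first exact: main.
have ci : 1 <= c^-1 by rewrite invf_ge1// ltW.
have h := cvg_at_pinfty_comp (main _ ci) (cvg_scale_pinfty c0).
have h2 : (m (c^-1 * (c * x)) / m (c * x))^-1 @[x --> +oo] --> (1^-1 : R).
  by apply: cvgV; rewrite ?oner_neq0.
rewrite invr1 in h2; apply: cvg_trans h2; apply: near_eq_cvg; apply: nearW => x.
by rewrite mulKf ?gt_eqF// invf_div.
Qed.

Hypothesis l_int : log_integrable l.

Local Notation mu := (@lebesgue_measure R).

Let itv_split (f : R -> R) (x y : R) : 0 <= x -> x <= y ->
  mu.-integrable `]0, y] (EFin \o f) ->
  \int[mu]_(u in `]0, y]) f u = \int[mu]_(u in `]0, x]) f u + \int[mu]_(u in `]x, y]) f u.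
Proof.
move=> x0 xy fi.
have := @Rintegral_itvB _ f (BRight 0) (BRight y) x fi.
by rewrite !bnd_simp => /(_ x0 xy) <-; rewrite addrC subrK.
Qed.

Let tail_int x : mu.-integrable `]0, x] (EFin \o tail).
Proof.
apply: measurable_bounded_integrable => //.
- by rewrite /= lebesgue_measure_itv/=; case: ifP => _; rewrite ?ltry// -EFinB ltry.
- exact: measurable_funTS measurable_tail.
- exists 1; split; first exact: num_real.
  move=> y y1 u _; apply: le_trans (ltW y1).
  by rewrite ger0_norm ?tail_ge0 ?tail_le1.
Qed.

(** Beyond some x0 the integrands l(u) / u and tail(u) differ by a small multiple of tail(u). What
    precedes x0 contributes a constant, absorbed because m tends to infinity when the mean is
    infinite. *)
Lemma log_primitive_equiv : log_primitive l x / m x @[x --> +oo] --> (1 : R).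
Proof.
apply/cvgrPdist_le => e e0.
pose e3 := e / 3.
have e30 : 0 < e3 by rewrite divr_gt0.
have [_ l0 _] := l_sv.
have inv : (tail x / (x^-1 * l x))^-1 @[x --> +oo] --> (1^-1 : R).
  by apply: cvgV; rewrite ?oner_neq0.
rewrite invr1 in inv.
have [M [_ HM]] : \forall u \near +oo, `|l u / u - tail u| <= e3 * tail u.
  have /cvgrPdist_le/(_ _ e30) := inv.
  have := nbhs_pinfty_gt (num_real (0 : R)).
  apply: filterS3 l0 => u lu u0; rewrite invf_div => h.
  have tu := tail_gt0 u.
  rewrite (_ : l u / u - tail u = - (1 - u^-1 * l u / tail u) * tail u); last first.
    by field; rewrite !gt_eqF.
  by rewrite normrM normrN (gtr0_norm tu) ler_wpM2r// ltW.
pose x0 := Num.max M 1.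
have x00 : 0 < x0 by rewrite lt_max ltr01 orbT.
pose C := `|log_primitive l x0 - m x0|.
have /cvgryPge/(_ (C / e3)) := truncated_mean_cvgy EY.
have := nbhs_pinfty_ge (num_real x0).
apply: filterS2 => x xx0 mC.
have xp : 0 < x by apply: lt_le_trans xx0.
have mx := truncated_mean_gt0 xp.
have li := l_int xp.
have sub : `]x0, x] `<=` `]0, x].
  by move=> u /=; rewrite !in_itv/= => /andP[h ->]; rewrite andbT (lt_trans x00).
have lS : mu.-integrable `]x0, x] (EFin \o (fun u : R => l u / u)) by exact: integrableS li.
have tS : mu.-integrable `]x0, x] (EFin \o tail) by exact: integrableS (tail_int x).
have E1 : log_primitive l x = log_primitive l x0 + \int[mu]_(u in `]x0, x]) (l u / u).
  by rewrite /log_primitive (itv_split (ltW x00) xx0).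
have E2 : m x = m x0 + \int[mu]_(u in `]x0, x]) tail u.
  by rewrite !truncated_meanE ?(ltW xp) ?(ltW x00)// (itv_split (ltW x00) xx0).
have dS : mu.-integrable `]x0, x] (EFin \o (fun u : R => l u / u - tail u)).
  by apply: (integrableB _ lS tS).
have D : `|\int[mu]_(u in `]x0, x]) (l u / u) - \int[mu]_(u in `]x0, x]) tail u| <= e3 * m x.
  rewrite -RintegralB//.
  apply: le_trans (le_normr_Rintegral _ _) _ => //.
  apply: le_trans (_ : \int[mu]_(u in `]x0, x]) (e3 * tail u) <= _).
    apply: le_Rintegral => //.
    - exact: integrable_norm.
    - by apply: (@integrableZl _ _ _ mu _ _ e3 _ tS).
    - move=> u /=; rewrite in_itv/= => /andP[h _]; apply: HM.
      by apply: le_lt_trans h; rewrite le_max lexx.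
  rewrite RintegralZl// ler_wpM2l ?(ltW e30)// E2 lerDr.
  by rewrite truncated_mean_ge0// ltW.
rewrite distrC -[X in `|_ - X|](divff (lt0r_neq0 mx)) -mulrBl normrM.
rewrite [`|(m x)^-1|]gtr0_norm ?invr_gt0// ler_pdivrMr//.
have -> : log_primitive l x - m x = (log_primitive l x0 - m x0) +
    (\int[mu]_(u in `]x0, x]) (l u / u) - \int[mu]_(u in `]x0, x]) tail u).
  by rewrite E1 E2; ring.
apply: le_trans (ler_normD _ _) _.
move: mC; rewrite ler_pdivrMr// -/C => mC.
have -> : e * m x = e3 * m x + e3 * m x + e3 * m x by rewrite /e3; field.
have := mulr_gt0 e30 mx; rewrite -/C; lra.
Qed.

(** Slow variation includes measurability. It comes from the continuity of an indefinite integral on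
    each [0, n + 1]; adding the endpoint 0 does not affect integrability. *)
Lemma measurable_log_primitive : measurable_fun (`]0, +oo[ : set R) (log_primitive l).
Proof.
have E : (`]0, +oo[%classic : set R) = \bigcup_n `]0, n.+1%:R]%classic.
  apply/seteqP; split => x /=; rewrite ?in_itv/= ?andbT; last first.
    by move=> [n _ /=]; rewrite in_itv/= => /andP[].
  move=> x0.
    exists (Num.truncn x) => //; rewrite /= in_itv/= x0/= ltW//.
    exact: Num.Theory.truncnS_gt.
rewrite E; apply/measurable_fun_bigcup => // n.
have lo := l_int (ltr0Sn R n).
have li : mu.-integrable `[0, n.+1%:R] (EFin \o (fun u : R => l u / u)).
  have /integrableP[ml il] := lo.
  apply/integrableP; split; first exact/emeasurable_fun_itv_obnd_cbndP.
  rewrite -integral_itv_obnd_cbnd//.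
  exact: measurableT_comp.
have := parameterized_integral_continuous (ler0n R n.+1) li.
move=> /subspace_continuous_measurable_fun => /(_ (measurable_itv _)) H.
apply: (eq_measurable_fun (fun x => parameterized_integral mu 0 x (fun u => l u / u))).
  move=> x; rewrite inE/= in_itv/= => /andP[x0 _].
  by rewrite /parameterized_integral -Rintegral_itv_obnd_cbnd//; exact: l_int.
apply: measurable_funS H => //.
by move=> x /=; rewrite !in_itv/= => /andP[/ltW -> ->].
Qed.

Lemma log_primitive_sv : slowly_varying (log_primitive l).
Proof.
have mp : \forall x \near +oo, 0 < log_primitive l x.
  have /cvgr_gt/(_ _ (ltr01)) := log_primitive_equiv.
  have := nbhs_pinfty_gt (num_real (0 : R)).
  apply: filterS2 => x x0; rewrite pmulr_lgt0// invr_gt0.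
  exact: truncated_mean_gt0.
split => //; first exact: measurable_log_primitive.
move=> c c0.
have h1 := cvg_at_pinfty_comp log_primitive_equiv (cvg_scale_pinfty c0).
have h2 : (log_primitive l x / m x)^-1 @[x --> +oo] --> (1^-1 : R).
  by apply: cvgV; [rewrite oner_neq0|exact: log_primitive_equiv].
have h3 : log_primitive l (c * x) / m (c * x) * (m (c * x) / m x) *
    (log_primitive l x / m x)^-1 @[x --> +oo] --> (1 * 1 * 1^-1 : R).
  by apply: cvgM => //; apply: cvgM => //; exact: truncated_mean_sv.
rewrite invr1 !mul1r in h3; apply: cvg_trans h3; apply: near_eq_cvg.
have := nbhs_pinfty_gt (num_real (0 : R)).
apply: filterS2 mp => x px x0 /=.
field; rewrite !gt_eqF ?truncated_mean_gt0 ?mulr_gt0//.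
Qed.

End regular_variation.
End tail.

(** * The quadratic exponent *)

Section gauss.
Context (R : realType).
Local Notation mu := (@lebesgue_measure R).
Implicit Types x y z : R.

Lemma is_derive_gauss x : is_derive x 1 (fun y : R => - expR (- y ^+ 2)) (2 * x * expR (- x ^+ 2)).
Proof.
apply: is_derive_eq.
rewrite /GRing.scale/=; ring.
Qed.

Let gfun y := 2 * y * expR (- y ^+ 2).

Lemma continuous_gfun : continuous gfun.
Proof.
move=> y; apply: cvgM.
  by apply: cvgM; [exact: cvg_cst|exact: cvg_id].
apply: (continuous_comp (f := fun y : R => - y ^+ 2) (g := expR)); last exact: continuous_expR.
by apply: cvgN; exact: exprn_continuous.
Qed.

Lemma measurable_gfun : measurable_fun setT gfun.
Proof. by apply: continuous_measurable_fun; exact: continuous_gfun. Qed.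

Lemma integral_gfun x y : x <= y ->
  (\int[mu]_(u in `[x, y]) (gfun u)%:E = (expR (- x ^+ 2) - expR (- y ^+ 2))%:E)%E.
Proof.
rewrite le_eqVlt => /predU1P[<-|xy].
  by rewrite set_itv1 integral_set1 subrr.
rewrite (@continuous_FTC2 _ gfun (fun y => - expR (- y ^+ 2)))//.
- by rewrite -EFinB; congr EFin; ring.
- by apply: continuous_subspaceT; exact: continuous_gfun.
- have dd : forall u, derivable (fun y => - expR (- y ^+ 2) : R) u 1.
    by move=> u; have [] := is_derive_gauss u.
  have cc : continuous (fun y => - expR (- y ^+ 2) : R).
    by move=> u; apply: differentiable_continuous; exact/derivable1_diffP.
  by split => //; [exact: cvg_at_right_filter (cc x)|exact: cvg_at_left_filter (cc y)].
- by move=> u _; rewrite derive1E; have [] := is_derive_gauss u.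
Qed.

Lemma integrable_gfun x : 0 <= x -> mu.-integrable `[x, +oo[ (EFin \o gfun).
Proof.
move=> x0; apply/integrableP; split.
  by apply/measurable_EFinP; exact: measurable_funTS measurable_gfun.
have -> : (\int[mu]_(u in `[x, +oo[) `|(EFin \o gfun) u| =
    \int[mu]_(u in `[x, +oo[) (gfun u)%:E)%E.
  apply: eq_integral => u; rewrite inE/= in_itv/= andbT => xu.
  by rewrite /= ger0_norm// mulr_ge0 ?expR_ge0// mulr_ge0// (le_trans x0).
rewrite (@ge0_continuous_FTC2y _ gfun (fun y => - expR (- y ^+ 2)) x 0) ?ltry//.
- by move=> u xu; rewrite mulr_ge0 ?expR_ge0// mulr_ge0// (le_trans x0).
- by apply: continuous_subspaceT; exact: continuous_gfun.
- rewrite -[X in _ --> X]oppr0; apply: cvgN; exact: cvg_gauss_fun.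
- have cc : continuous (fun y => - expR (- y ^+ 2) : R).
    move=> u; apply: differentiable_continuous; apply/derivable1_diffP.
    by have [] := is_derive_gauss u.
  exact: cvg_at_right_filter (cc x).
- by move=> u _; rewrite derive1E; have [] := is_derive_gauss u.
Qed.

Lemma integrable_gauss2 x : mu.-integrable `[x, +oo[ (EFin \o (fun u => 2 * gauss_fun u)).
Proof.
have gi : mu.-integrable `[x, +oo[ (EFin \o @gauss_fun R).
  exact: integrableS (@integrableT_gauss R).
by apply: (@integrableZl _ _ _ mu _ _ 2 _ gi).
Qed.

(** The whole half-line gives sqrt pi, and the missing piece [0, x[ weighs at most 2 x because the
    Gaussian function is at most 1. *)
Lemma gauss_tail_bound x : 0 <= x ->
  Num.sqrt pi - 2 * x <= \int[mu]_(u in `[x, +oo[) (2 * gauss_fun u) <= Num.sqrt pi.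
Proof.
move=> x0.
have gi D : measurable D -> mu.-integrable D (EFin \o @gauss_fun R).
  by move=> mD; apply: integrableS (@integrableT_gauss R).
rewrite RintegralZl//; last exact: gi.
have E : \int[mu]_(u in `[0, +oo[) gauss_fun u = Num.sqrt pi / 2.
  by rewrite /Rintegral integral0y_gauss.
have S : \int[mu]_(u in `[0, +oo[) gauss_fun u =
    \int[mu]_(u in `[0, x[) gauss_fun u + \int[mu]_(u in `[x, +oo[) gauss_fun u.
  rewrite -Rintegral_setU//=.
  - by rewrite -itv_bndbnd_setU// bnd_simp.
  - by apply: gi; apply: measurableU.
  - by apply/disj_setPS => u [/=]; rewrite !in_itv/= andbT => /andP[_ h1] h2;
      move: (lt_le_trans h1 h2); rewrite ltxx.
have I0 : 0 <= \int[mu]_(u in `[0, x[) gauss_fun u.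
  by apply: Rintegral_ge0 => u _; exact: gauss_fun_ge0.
have I1 : \int[mu]_(u in `[0, x[) gauss_fun u <= x.
  apply: le_trans (_ : \int[mu]_(u in `[0, x[) 1 <= _).
    apply: le_Rintegral => //; [exact: gi| |by move=> u _; exact: gauss_fun_le1].
    apply: measurable_bounded_integrable => //.
      by rewrite /= lebesgue_measure_itv/=; case: ifP => _; rewrite ?ltry// -EFinB ltry.
    by exists 1; split; [exact: num_real|move=> z z1 u _ /=; rewrite normr1 ltW].
  rewrite Rintegral_cst//= lebesgue_measure_itv/= mul1r; case: ifP => _ /=; rewrite ?subr0//.
move: S I0 I1; rewrite E; move: (\int[mu]_(u in `[0, x[) gauss_fun u)
  (\int[mu]_(u in `[x, +oo[) gauss_fun u) (Num.sqrt pi) => A B s *.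
by apply/andP; split; lra.
Qed.

End gauss.

Section laplace_exponent.
Context d (T : measurableType d) (R : realType) (P : probability T R).
Variable Y : T -> R.
Hypothesis mY : measurable_fun setT Y.
Hypothesis Y0 : forall w, 0 <= Y w.
Variable l : R -> R.
Hypothesis l_sv : slowly_varying l.
Hypothesis tail_l : tail P Y x / (x^-1 * l x) @[x --> +oo] --> (1 : R).
Hypothesis EY : 'E_P[Y]%E = +oo%E.
Implicit Types x y z c : R.
Local Notation mu := (@lebesgue_measure R).
Local Notation tail := (tail P Y).
Local Notation m := (truncated_mean P Y).

Let tail0 x : 0 < tail x.
Proof. exact: (tail_gt0 mY l_sv tail_l). Qed.

Let tail_nd x y : x <= y -> tail y <= tail x.
Proof. exact: tail_nonincreasing. Qed.

Let tailrv c : 0 < c -> tail (c * x) / tail x @[x --> +oo] --> c^-1.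
Proof. exact: (tail_rv mY l_sv tail_l). Qed.

Let v z := \int[P]_w (Num.min (Y w) z ^+ 2).

Let mbv z : 0 <= z -> mbounded (fun w => Num.min (Y w) z ^+ 2).
Proof.
move=> z0; have h : mbounded (fun w => Num.min (Y w) z) by exact: mbounded_min.
exact: (mboundedM h h).
Qed.

Lemma second_moment_incr x y : 0 <= x -> x <= y -> v y <= v x + (y ^+ 2 - x ^+ 2) * tail x.
Proof.
move=> x0 xy; have y0 := le_trans x0 xy.
rewrite tailE// -ExZ; last by apply: mbounded_indic; exact: measurable_fun_gt.
have mi : mbounded (fun w => (y ^+ 2 - x ^+ 2) * \1_[set w0 | x < Y w0] w).
  apply: mboundedM; first exact: mbounded_cst.
  by apply: mbounded_indic; exact: measurable_fun_gt.
rewrite -ExD//; [|exact: mbv].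
apply: Ex_le; [exact: mbv|by apply: mboundedD => //; exact: mbv|].
move=> w; rewrite indic_set; have [h|h] := ltP x (Y w).
  rewrite mulr1 addrC subrK ler_pXn2r ?nnegrE ?ge_min ?lexx ?orbT//.
  by rewrite le_min Y0.
by rewrite mulr0 addr0 min_l// (le_trans h).
Qed.

(** A Karamata-type bound: the index -1 is above -2, so the truncated second moment is dominated by
    its last dyadic scale. Halving gives v(z) <= v(z / 2) + 3/4 z^2 tail(z / 2) with tail(z / 2) <=
    3 tail(z), so C propagates from z / 2 to z as soon as 3 (C / 4 + 3 / 4) <= C. *)
Lemma second_moment_bound : exists C z0 : R, [/\ 0 < C, 0 < z0 &
  forall z, z0 <= z -> v z <= C * (z ^+ 2 * tail z)].
Proof.
have [M [_ HM]] : \forall z \near +oo, tail (2^-1 * z) <= 3 * tail z.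
  have h2 : (0 : R) < 2^-1 by rewrite invr_gt0.
  have h3 : (2^-1)^-1 < (3 : R) by rewrite invrK; lra.
  have /cvgr_lt/(_ _ h3) := tailrv h2.
  by apply: filterS => z; rewrite ltr_pdivrMr// => /ltW.
pose z0 := Num.max (M + 1) 1.
have z00 : 0 < z0 by rewrite lt_max ltr01 orbT.
have Mz0 z : z0 <= z -> M < z.
  by move=> h; apply: lt_le_trans h; rewrite lt_max ltrDl ltr01.
(* 9 is the least C with 3 (C / 4 + 3 / 4) <= C; the other term covers the base range [z0, 2 z0],
   where v(z) <= z^2 is enough. *)
pose C := Num.max 9 (tail (2 * z0))^-1.
have C9 : 9 <= C by rewrite le_max lexx.
have C0 : 0 < C by apply: lt_le_trans C9.
exists C, z0; split => //.
have base z : z0 <= z -> z <= 2 * z0 -> v z <= C * (z ^+ 2 * tail z).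
  move=> z0z zz; have zp : 0 < z by apply: lt_le_trans z0z.
  apply: le_trans (_ : z ^+ 2 <= _).
    rewrite -[leRHS](Ex_cst P); apply: Ex_le; [by apply: mbv; exact: ltW|exact: mbounded_cst|].
    move=> w; rewrite ler_pXn2r ?nnegrE ?ge_min ?lexx ?orbT ?(ltW zp)//.
    by rewrite le_min Y0 ltW.
  rewrite mulrCA ler_peMr ?sqr_ge0//.
  rewrite -[leLHS](mulVf (lt0r_neq0 (tail0 (2 * z0)))).
  apply: ler_pM; rewrite ?invr_ge0 ?tail_ge0// ?tail_nd//.
  by rewrite le_max lexx orbT.
have step n z : z0 <= z -> z <= 2 ^+ n * (2 * z0) -> v z <= C * (z ^+ 2 * tail z).
  elim: n z => [|n IH] z z0z; first by rewrite expr0 mul1r; exact: base.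
  rewrite exprS => zz; have [zs|zb] := leP z (2 * z0); first exact: base.
  have z2 : z0 <= 2^-1 * z by lra.
  have z2' : 2^-1 * z <= 2 ^+ n * (2 * z0).
    lra.
  have zp : 0 < z by apply: lt_le_trans z0z.
  have h1 := IH _ z2 z2'.
  have h2 := @second_moment_incr (2^-1 * z) z (ltac:(lra)) (ltac:(lra)).
  have h3 := HM _ (Mz0 _ z0z).
  apply: le_trans h2 _.
  apply: le_trans (_ : (C * 4^-1 + 3 / 4) * (z ^+ 2 * tail (2^-1 * z)) <= _).
    rewrite [leRHS]mulrDl; apply: lerD.
      rewrite (_ : C * 4^-1 * _ = C * ((2^-1 * z) ^+ 2 * tail (2^-1 * z)))//; by field.
    by rewrite le_eqVlt; apply/orP; left; apply/eqP; field.
  apply: le_trans (_ : (C * 4^-1 + 3 / 4) * (z ^+ 2 * (3 * tail z)) <= _).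
    by rewrite ler_wpM2l ?ler_wpM2l ?sqr_ge0//; lra.
  have : 0 <= z ^+ 2 * tail z by rewrite mulr_ge0 ?sqr_ge0 ?tail_ge0.
  set q := z ^+ 2 * tail z => q0.
  rewrite (_ : z ^+ 2 * _ = 3 * q); last by rewrite /q; ring.
  by rewrite mulrA ler_wpM2r//; lra.
move=> z z0z.
have [n hn] : exists n : nat, z / z0 <= n%:R.
  by exists (Num.truncn (z / z0)).+1; apply/ltW/Num.Theory.truncnS_gt.
apply: (step n) => //.
move: hn; rewrite ler_pdivrMr// => /le_trans; apply.
apply: ler_pM; rewrite ?ler0n ?(ltW z00)//; last by lra.
by rewrite -natrX ler_nat ltnW// ltn_expl.
Qed.

(** The layer-cake formula with weight 2 u exp (- u^2) turns t tail(u b_t) --> c / u into a Gaussian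
    integral. A dominating function is at hand only for u >= e, so the part below level e is
    separated and shown to be O(e) by the second moment bound. *)
Lemma laplace_square_exponent (b : R -> R) (c : R) : 0 <= c ->
  b t @[t --> +oo] --> +oo -> t * tail (b t) @[t --> +oo] --> c ->
  t * (1 - \int[P]_w expR (- (Y w / b t) ^+ 2)) @[t --> +oo] --> c * Num.sqrt pi.
Proof.
move=> c0 boo tb.
have [C [z0 [C0 z00 Hv]]] := second_moment_bound.
have b_ge A : \forall t \near +oo, A <= b t by move/cvgryPge : boo; apply.
have b_gt0 : \forall t \near +oo, 0 < b t.
  by have := b_ge 1; apply: filterS => t; exact: lt_le_trans.
have t_gt0 := nbhs_pinfty_gt (num_real (0 : R)).
have ttail y : 0 < y -> t * tail (y * b t) @[t --> +oo] --> c / y.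
  move=> y0; have h1 := cvg_at_pinfty_comp (tailrv y0) boo.
  have h2 : t * tail (b t) * (tail (y * b t) / tail (b t)) @[t --> +oo] --> c / y.
    exact: cvgM.
  apply: cvg_trans h2; apply: near_eq_cvg; apply: nearW => t.
  by field; rewrite lt0r_neq0.
pose G z : R := 1 - expR (- z ^+ 2).
have G01 z : 0 <= G z <= 1.
  rewrite /G subr_ge0 lerBlDr lerDl expR_ge0 andbT.
  by rewrite -[leRHS]expR0 ler_expR oppr_le0 sqr_ge0.
have mG f : measurable_fun setT f -> mbounded (fun w : T => G (f w)).
  move=> mf; apply: (@mboundedP _ _ _ _ 1) => //.
  apply: measurable_funB => //; apply: measurableT_comp => //.
  by apply: measurableT_comp => //; exact: measurable_funX.
have mYb t : measurable_fun setT (fun w => Y w / b t) by exact: measurable_funM.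
have Glip z : G z <= z ^+ 2.
  by rewrite /G; have := expR_ge1Dx (- z ^+ 2); lra.
(* The cut is made in the argument: G x = G (min x e) + (G (max x e) - G e), since of the minimum
   and the maximum one is x and the other is e. *)
pose near_part (e t : R) := \int[P]_w G (Num.min (Y w / b t) e).
pose far_part (e t : R) := \int[P]_w (G (Num.max (Y w / b t) e) - G e).
have split e t : 1 - \int[P]_w expR (- (Y w / b t) ^+ 2) = near_part e t + far_part e t.
  rewrite -ExD; last 2 first.
  - by apply: mG; exact: measurable_minr.
  - apply: mboundedB; [by apply: mG; exact: measurable_maxr|exact: mbounded_cst].
  rewrite -{1}(Ex_cst P 1) -ExB; [|exact: mbounded_cst|]; last first.
    have := mboundedB (mbounded_cst T (1 : R)) (mG _ (mYb t)).
    by under eq_fun do rewrite /cst /G opprB addrC subrK.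
  apply: eq_Rintegral => w _; rewrite -/(G (Y w / b t)).
  by have [h|h] := leP (Y w / b t) e; rewrite ?subrr ?addr0// addrC subrK.
have near_le e : 0 < e -> \forall t \near +oo, 0 <= t * near_part e t <= C * e ^+ 2 * (t * tail (e * b t)).
  move=> e0; have := b_ge (z0 / e).
  apply: filterS3 b_gt0 t_gt0 => t bt tt; rewrite ler_pdivrMr// mulrC => zb.
  apply/andP; split.
    rewrite mulr_ge0 ?(ltW tt)//; apply: Ex_ge0 => w.
    by have /andP[] := G01 (Num.min (Y w / b t) e).
  rewrite mulrCA ler_wpM2l ?(ltW tt)//.
  apply: le_trans (_ : (b t) ^- 2 * v (e * b t) <= _).
    rewrite /v -ExZ; last by apply: mbv; rewrite mulr_ge0 ?ltW.
    apply: Ex_le; first by apply: mG; exact: measurable_minr.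
      apply: mboundedM; [exact: mbounded_cst|apply: mbv; by rewrite mulr_ge0 ?ltW].
    move=> w; apply: le_trans (Glip _) _.
    have -> : Num.min (Y w / b t) e = Num.min (Y w) (e * b t) / b t.
      by rewrite minr_pMl ?invr_ge0 ?(ltW bt)// mulfK// lt0r_neq0.
    by rewrite exprMn mulrC exprVn.
  apply: le_trans (ler_wpM2l _ (Hv _ zb)) _; first by rewrite invr_ge0 sqr_ge0.
  rewrite le_eqVlt; apply/orP; left; apply/eqP; field.
  exact: lt0r_neq0.
have far_cvg e : 0 < e -> t * far_part e t @[t --> +oo] -->
    c * \int[mu]_(u in `[e, +oo[) (2 * gauss_fun u).
  move=> e0.
  pose g u : R := (2 * u * expR (- u ^+ 2)) * \1_(`[e, +oo[%classic) u.
  have mg : measurable_fun setT g.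
    by apply: measurable_funM; [exact: measurable_gfun|exact: measurable_indic].
  have g0 u : 0 <= g u.
    rewrite /g indicE; case: (boolP (u \in _)); rewrite ?mulr0// mulr1 inE/= in_itv/= andbT => eu.
    by rewrite mulr_ge0 ?expR_ge0// mulr_ge0// (le_trans (ltW e0)).
  have farE t : 0 < b t -> far_part e t =
      \int[mu]_(u in `[e, +oo[) (2 * u * expR (- u ^+ 2) * tail (u * b t)).
    move=> bt; rewrite /far_part /Rintegral; congr fine.
    have := layer_cake P (mYb t) mg g0.
    have -> : (\int[P]_w \int[mu]_(u in `]0%R, (Y w / b t)%R[) (g u)%:E =
        \int[P]_w (G (Num.max (Y w / b t) e) - G e)%R%:E)%E.
      apply: eq_integral => w _.
      have [h|h] := leP (Y w / b t) e.
        rewrite subrr; apply: integral0_eq => u /=; rewrite in_itv/= => /andP[_ u1].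
        rewrite /g indicE memNset ?mulr0//= in_itv/= andbT.
        by apply/negP; rewrite -ltNge (lt_le_trans u1).
      transitivity (\int[mu]_(u in `[e, (Y w / b t)%R[) (2 * u * expR (- u ^+ 2))%R%:E)%E.
        rewrite [RHS]integral_mkcond [LHS]integral_mkcond; apply: eq_integral => u _.
        rewrite !patchE /g indicE.
        have -> : (u \in (`[e, (Y w / b t)[%classic : set R)) =
            (u \in (`]0, (Y w / b t)[%classic : set R)) && (u \in (`[e, +oo[%classic : set R)).
          apply/idP/idP; rewrite !inE/= !in_itv/= ?andbT.
            move=> /andP[h1 h2]; apply/andP.
            by split; rewrite inE/= in_itv/= ?andbT// (lt_le_trans e0 h1).
          by move=> /andP[]; rewrite !inE/= !in_itv/= andbT => /andP[_ ->] ->.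
        by case: (u \in _); case: (u \in _) => //=; rewrite ?mulr1 ?mulr0.
      rewrite integral_itv_bndo_bndc; last first.
        by apply/measurable_EFinP; by apply: measurable_funTS; exact: measurable_gfun.
      rewrite integral_gfun ?(ltW h)//; congr EFin; rewrite /G; ring.
    move=> ->; rewrite [RHS]integral_mkcond [LHS]integral_mkcond.
    apply: eq_integral => u _; rewrite !patchE /g indicE.
    have [/= ue|ue] := boolP (u \in (`[e, +oo[%classic : set R)).
      rewrite ifT; last first.
        by move: ue; rewrite !inE/= !in_itv/= !andbT; exact: lt_le_trans.
      rewrite mulr1 [in RHS]EFinM EFin_tail//; congr (_ * _)%E.
      by congr (P _); apply/seteqP; split => w /=; rewrite ltr_pdivlMr.
    by rewrite mulr0 mul0e; case: ifP.
  have lim : \int[mu]_(u in `[e, +oo[) (2 * u * expR (- u ^+ 2) * (t * tail (u * b t)))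
      @[t --> +oo] --> \int[mu]_(u in `[e, +oo[) (2 * u * expR (- u ^+ 2) * (c / u)).
    (* As [tail] is nonincreasing, t tail(u b_t) <= t tail(e b_t), which is eventually below c / e +
       1, a bound independent of u. *)
    apply: (@cvg_dominated_pinfty _ _ _ mu _ _ _ (fun u => 2 * u * expR (- u ^+ 2) * (c / e + 1))) => //.
    - move=> t; apply: measurable_funM; first by apply: measurable_funTS; exact: measurable_gfun.
      apply: measurable_funM => //; apply: measurable_funTS.
      by apply: measurableT_comp; [exact: measurable_tail|exact: measurable_funM].
    - apply: measurable_funM; first by apply: measurable_funTS; exact: measurable_gfun.
      apply: measurable_funTS; apply: measurable_funM => //; exact: measurable_invr.
    - by apply: (@integrableZr _ _ _ mu _ _ (c / e + 1) _ (integrable_gfun (ltW e0))).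
    - apply: aeW => u /=; rewrite in_itv/= andbT => eu.
      apply: cvgM; first exact: cvg_cst.
      by apply: ttail; exact: lt_le_trans eu.
    - have h : c / e < c / e + 1 by rewrite ltrDl.
      have /cvgr_lt/(_ _ h) := ttail _ e0.
      apply: filterS3 b_gt0 t_gt0 => t bt tt hh u /=; rewrite in_itv/= andbT => eu.
      have u0 : 0 <= u := le_trans (ltW e0) eu.
      have tu : 0 <= t * tail (u * b t) by rewrite mulr_ge0 ?tail_ge0 ?ltW.
      have gu : 0 <= 2 * u * expR (- u ^+ 2) by rewrite mulr_ge0 ?expR_ge0 ?mulr_ge0.
      rewrite (ger0_norm (mulr_ge0 gu tu)); apply: (ler_wpM2l gu).
      apply: le_trans (ltW hh); apply: (ler_wpM2l (ltW tt)).
      by apply: tail_nd; exact: (ler_wpM2r (ltW bt)).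
  have -> : c * \int[mu]_(u in `[e, +oo[) (2 * gauss_fun u) =
      \int[mu]_(u in `[e, +oo[) (2 * u * expR (- u ^+ 2) * (c / u)).
    rewrite -RintegralZl//; last exact: integrable_gauss2.
    apply: eq_Rintegral => u; rewrite inE/= in_itv/= andbT => eu.
    by rewrite /gauss_fun; field; rewrite gt_eqF// (lt_le_trans e0).
  apply: cvg_trans lim; apply: near_eq_cvg.
  apply: filterS b_gt0 => t bt; rewrite farE// -RintegralZl//.
    by apply: eq_Rintegral => u _; ring.
  apply: le_integrable (integrable_gfun (ltW e0)) => //.
    apply/measurable_EFinP; apply: measurable_funM; first by apply: measurable_funTS; exact: measurable_gfun.
    apply: measurable_funTS; apply: measurableT_comp; [exact: measurable_tail|exact: measurable_funM].
  move=> u _; rewrite /= lee_fin normrM ler_piMr// ger0_norm ?tail_ge0//.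
  exact: tail_le1.
apply/cvgrPdist_le => eps eps0.
(* The errors are C (c + 1) e from the near part and 2 c e from [gauss_tail_bound]; the final 1
   keeps K positive, and e is chosen so that K e = eps / 2. *)
pose K := C * (c + 1) + 2 * c + 1.
have K0 : 0 < K by rewrite /K; nra.
pose e := eps / (2 * K).
have e0 : 0 < e by rewrite divr_gt0// mulr_gt0.
have eps2 : 0 < eps / 2 by lra.
have /cvgrPdist_le/(_ _ eps2) := far_cvg _ e0.
have h : c / e < (c + 1) / e by rewrite ltr_pM2r ?invr_gt0// ltrDl.
have /cvgr_lt/(_ _ h) := ttail _ e0.
apply: filterS3 (near_le _ e0) => t /andP[n0 n1] tl.
have /andP[g1 g2] := gauss_tail_bound (ltW e0).
rewrite (split e) mulrDr !ler_norml => /andP[f1 f2].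
have n2 : t * near_part e t <= C * (c + 1) * e.
  apply: le_trans n1 _.
  apply: le_trans (ler_wpM2l _ (ltW tl)) _; first by rewrite mulr_ge0 ?sqr_ge0 ?ltW.
  by rewrite le_eqVlt; apply/orP; left; apply/eqP; field; rewrite gt_eqF.
have Ke : C * (c + 1) * e + 2 * c * e + e = eps / 2.
  by rewrite (_ : _ + e = K * e); [rewrite /e; field; rewrite gt_eqF|rewrite /K; ring].
have g1' := ler_wpM2l c0 g1; have g2' := ler_wpM2l c0 g2.
have ce : 0 <= C * (c + 1) * e by rewrite mulr_ge0 ?(ltW e0)// mulr_ge0 ?(ltW C0)// addr_ge0.
have ce' : 0 <= c * e by rewrite mulr_ge0// ltW.
move: f1 f2 g1' g2'; set I := \int[mu]_(u in _) _; set s := Num.sqrt pi => f1 f2 g1' g2'.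
by apply/andP; split; lra.
Qed.

End laplace_exponent.

(** * The joint exponent *)

Section joint_exponent.
Context d (T : measurableType d) (R : realType) (P : probability T R).
Variable Y : T -> R.
Hypothesis mY : measurable_fun setT Y.
Hypothesis Y0 : forall w, 0 <= Y w.
Variable l : R -> R.
Hypothesis l_sv : slowly_varying l.
Hypothesis tail_l : tail P Y x / (x^-1 * l x) @[x --> +oo] --> (1 : R).
Hypothesis EY : 'E_P[Y]%E = +oo%E.
Implicit Types x y z c : R.
Local Notation tail := (tail P Y).
Local Notation m := (truncated_mean P Y).

Let tail0 x : 0 < tail x.
Proof. exact: (tail_gt0 mY l_sv tail_l). Qed.

Let tailrv c : 0 < c -> tail (c * x) / tail x @[x --> +oo] --> c^-1.
Proof. exact: (tail_rv mY l_sv tail_l). Qed.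

Let m0 x : 0 < x -> 0 < m x.
Proof. exact: (truncated_mean_gt0 mY Y0 l_sv tail_l). Qed.

Let msv c : 0 < c -> m (c * x) / m x @[x --> +oo] --> (1 : R).
Proof. exact: (truncated_mean_sv mY Y0 l_sv tail_l). Qed.

Variables a b : R -> R.
Hypothesis aoo : a t @[t --> +oo] --> +oo.
Hypothesis boo : b t @[t --> +oo] --> +oo.
Hypothesis ta : t * tail (a t) @[t --> +oo] --> (1 : R).
Hypothesis tb : t * m (b t) / b t @[t --> +oo] --> (1 : R).

Let a_gt0 : \forall t \near +oo, 0 < a t.
Proof. by move/cvgryPgt : aoo; apply. Qed.

Let b_gt0 : \forall t \near +oo, 0 < b t.
Proof. by move/cvgryPgt : boo; apply. Qed.

Let t_gt0 := @nbhs_pinfty_gt R 0 (num_real 0).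

Let ttail y : 0 < y -> t * tail (y * a t) @[t --> +oo] --> y^-1.
Proof.
move=> y0; have h1 := cvg_at_pinfty_comp (tailrv y0) aoo.
have h2 : t * tail (a t) * (tail (y * a t) / tail (a t)) @[t --> +oo] --> 1 * y^-1.
  exact: cvgM.
rewrite mul1r in h2; apply: cvg_trans h2; apply: near_eq_cvg; apply: nearW => t.
by field; rewrite lt0r_neq0.
Qed.

(** Slopes of chords from the origin decrease for a concave function vanishing at 0; in terms of
    increments this rests on x tail(x) <= m(x). *)
Lemma truncated_mean_div_nonincreasing x y : 0 < x -> x <= y -> m y / y <= m x / x.
Proof.
move=> x0 xy; have y0 := lt_le_trans x0 xy.
rewrite ler_pdivrMr// mulrAC ler_pdivlMr//.
have /andP[_ h1] := truncated_mean_incr P mY Y0 (ltW x0) xy.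
have h2 := truncated_mean_ge P mY Y0 (ltW x0).
have : (y - x) * (x * tail x) <= (y - x) * m x by rewrite ler_wpM2l// subr_ge0.
have : x * (m y - m x) <= x * ((y - x) * tail x) by rewrite ler_wpM2l// ltW.
lra.
Qed.

(* If [b < K a], then [t m(b) / b] exceeds [t m(K a) / (K a)], which tends to infinity. *)
Lemma norming_ratio_pinfty (K : R) : 0 < K -> \forall t \near +oo, K * a t <= b t.
Proof.
move=> K0.
(* At K a_t, the bounds t tail > 1 / (2 K) and K a_t tail < m / (4 K) give t m(K a_t) / (K a_t) > 2,
   against the eventual bound t m(b_t) / b_t < 2. *)
have K4 : 0 < (4 * K)^-1 by rewrite invr_gt0 mulr_gt0.
have Kaoo : K * a t @[t --> +oo] --> +oo := cvg_comp _ _ aoo (cvg_scale_pinfty K0).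
have h1 := cvg_at_pinfty_comp (tail_truncated_mean mY Y0 l_sv tail_l) Kaoo.
have /cvgr_lt/(_ _ K4) := h1.
have K2 : (2 * K)^-1 < K^-1 by rewrite ltf_pV2 ?posrE ?mulr_gt0//; lra.
have /cvgr_gt/(_ _ K2) := ttail K0.
have lt12 : 1 < (2 : R) by lra.
have /cvgr_lt/(_ _ lt12) := tb.
have pos := near_pinfty_and a_gt0 (near_pinfty_and b_gt0 t_gt0).
move=> n1 n2 n3; apply: filterS3 (near_pinfty_and n1 n2) n3 pos => t [tb2 tt] tm [at0 [bt0 tp]].
rewrite leNgt; apply/negP => bK.
have Ka : 0 < K * a t by rewrite mulr_gt0.
have h2 := truncated_mean_div_nonincreasing bt0 (ltW bK).
have h3 : t * (m (K * a t) / (K * a t)) < 2.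
  by apply: le_lt_trans tb2; rewrite -mulrA ler_wpM2l// ltW.
have mK := m0 Ka.
move: tm; rewrite ltr_pdivrMr// => tm.
have h4 : (2 * K)^-1 * (K * a t) < t * ((4 * K)^-1 * m (K * a t)).
  apply: lt_trans (_ : t * tail (K * a t) * (K * a t) < _).
    by rewrite ltr_pM2r.
  by rewrite -mulrA ltr_pM2l// mulrC.
have h5 : t * m (K * a t) < 2 * (K * a t) by move: h3; rewrite mulrA ltr_pdivrMr.
have h6 : (4 * K)^-1 * (t * m (K * a t)) < (4 * K)^-1 * (2 * (K * a t)).
  by rewrite ltr_pM2l.
have e1 : (4 * K)^-1 * (2 * (K * a t)) = (2 * K)^-1 * (K * a t).
  by field; rewrite gt_eqF.
have h6' : t * ((4 * K)^-1 * m (K * a t)) < (4 * K)^-1 * (2 * (K * a t)).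
  by rewrite mulrCA.
by move: (lt_trans h4 h6'); rewrite e1 ltxx.
Qed.

Lemma norming_ratio0 : a t / b t @[t --> +oo] --> (0 : R).
Proof.
apply/cvgrPdist_le => e e0.
have h := norming_ratio_pinfty (_ : 0 < e^-1).
apply: filterS3 a_gt0 b_gt0 (h _); rewrite ?invr_gt0// => t at0 bt0 ab.
rewrite sub0r normrN ger0_norm; last by rewrite divr_ge0 ?ltW.
by rewrite ler_pdivrMr// -ler_pdivrMl.
Qed.

(** This decouples the two scales. From K a_t to b_t, m grows by at most b_t tail(K a_t), about b_t
    / (K t) and hence about m(b_t) / K, which is small for large K; from e a_t to K a_t slow
    variation applies. *)
Lemma truncated_mean_norming_ratio (e : R) : 0 < e ->
  m (e * a t) / m (b t) @[t --> +oo] --> (1 : R).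
Proof.
move=> e0; apply/cvgrPdist_le => eps eps0.
(* K >= 4 / eps brings K^-1 below eps / 2, and K >= e gives e a_t <= K a_t. *)
pose K := Num.max e (4 / eps).
have Ke : e <= K by rewrite le_max lexx.
have K0 : 0 < K := lt_le_trans e0 Ke.
have Kaoo : K * a t @[t --> +oo] --> +oo := cvg_comp _ _ aoo (cvg_scale_pinfty K0).
have eK : 0 < e / K by rewrite divr_gt0.
have h1 := cvg_at_pinfty_comp (msv eK) Kaoo.
have eps2 : 0 < eps / 2 by lra.
have /cvgrPdist_le/(_ _ eps2) := h1.
have invb : (t * m (b t) / b t)^-1 @[t --> +oo] --> (1^-1 : R).
  by apply: cvgV; rewrite ?oner_neq0.
have h2 : t * tail (K * a t) * (t * m (b t) / b t)^-1 @[t --> +oo] --> K^-1 * 1^-1.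
  by apply: cvgM => //; exact: ttail.
have K2 : K^-1 * 1^-1 < eps / 2.
  rewrite invr1 mulr1 -[ltRHS]invrK ltf_pV2 ?posrE ?invr_gt0//.
  rewrite invf_div; apply: lt_le_trans (_ : 4 / eps <= _); last by rewrite le_max lexx orbT.
  by rewrite ltr_pM2r ?invr_gt0//; lra.
have /cvgr_lt/(_ _ K2) := h2.
have pos := near_pinfty_and a_gt0 (near_pinfty_and b_gt0 t_gt0).
move=> n1 n2; apply: filterS3 (near_pinfty_and n1 n2) (norming_ratio_pinfty K0) pos.
move=> t [H2 H1] Kab [at0 [bt0 tp]].
have Ka : 0 < K * a t by rewrite mulr_gt0.
have mb := m0 bt0; have mK := m0 Ka.
have ea : 0 < e * a t by rewrite mulr_gt0.
have eaKa : e * a t <= K * a t by rewrite ler_wpM2r// ltW.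
have me := truncated_mean_nd P mY Y0 (ltW ea) eaKa.
have mKb := truncated_mean_nd P mY Y0 (ltW Ka) Kab.
have /andP[_ inc] := truncated_mean_incr P mY Y0 (ltW Ka) Kab.
rewrite mulrA divfK ?gt_eqF// in H1.
have H1' : (1 - eps / 2) * m (K * a t) <= m (e * a t).
  rewrite -ler_pdivlMr//; move: H1; rewrite ler_norml => /andP[_]; lra.
have H3 : m (b t) - m (K * a t) <= eps / 2 * m (b t).
  apply: le_trans inc _.
  apply: le_trans (_ : b t * tail (K * a t) <= _).
    by rewrite ler_wpM2r ?tail_ge0// lerBlDr lerDl ltW.
  move: H2 => /ltW; rewrite -(ler_pM2r mb); apply: le_trans.
  rewrite le_eqVlt; apply/orP; left; apply/eqP; field.
  by rewrite !gt_eqF.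
have r1 : m (e * a t) / m (b t) <= 1.
  by rewrite ler_pdivrMr// mul1r (le_trans me).
rewrite ger0_norm ?subr_ge0// lerBlDr -lerBlDl ler_pdivlMr//.
have := ler_wpM2l (ltW eps2) mKb.
lra.
Qed.

(** Upper bound: the quadratic factor is dropped and 1 - exp (- z) <= min z 1 yields (s / b_t) m(b_t
    / s). Lower bound: only Y <= e a_t is kept, where the quadratic factor is at least exp (- r e^2)
    and 1 - exp (- z) >= z exp (- z); the discarded term e a_t tail(e a_t) is negligible after
    scaling because a_t / b_t --> 0. *)
Lemma laplace_linear_exponent (r s : R) : 0 <= r -> 0 <= s ->
  t * \int[P]_w (expR (- (r * (Y w / a t) ^+ 2)) * (1 - expR (- (s * (Y w / b t)))))
  @[t --> +oo] --> s.
Proof.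
move=> r0; rewrite le_eqVlt => /predU1P[<-|s0].
  apply: cvg_near_cst; apply: nearW => t.
  rewrite (_ : (fun w => _) = cst 0) ?Ex_cst ?mulr0//.
  by apply/funext => w; rewrite mul0r oppr0 expR0 subrr mulr0.
have mYc z : measurable_fun setT (fun w => Y w / z) by exact: measurable_funM.
have e01 z : 0 <= z -> 0 <= expR (- z) <= 1.
  by move=> z0; rewrite expR_ge0/= -[leRHS]expR0 ler_expR oppr_le0.
have mint t : 0 < b t -> mbounded (fun w => expR (- (r * (Y w / a t) ^+ 2)) *
    (1 - expR (- (s * (Y w / b t))))).
  move=> bt0; apply: mboundedM; apply: (@mboundedP _ _ _ _ 1).
  - apply: measurableT_comp => //; apply: measurableT_comp => //.
    by apply: measurable_funM => //; exact: measurable_funX.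
  - by move=> w; apply: e01; rewrite mulr_ge0// sqr_ge0.
  - apply: measurable_funB => //; apply: measurableT_comp => //.
    by apply: measurableT_comp => //; exact: measurable_funM.
  - move=> w; have : 0 <= s * (Y w / b t) by rewrite mulr_ge0 ?divr_ge0 ?(ltW s0) ?(ltW bt0).
    by move=> /e01/andP[h1 h2]; rewrite subr_ge0 h2 lerBlDr lerDl.
have up : s * (t * m (b t) / b t) * (m (s^-1 * b t) / m (b t)) @[t --> +oo] --> s * 1 * 1.
  apply: cvgM; first by apply: cvgM => //; exact: cvg_cst.
  have si : 0 < s^-1 by rewrite invr_gt0.
  exact: cvg_at_pinfty_comp (msv si) boo.
rewrite !mulr1 in up.
have upper : \forall t \near +oo, t * \int[P]_w (expR (- (r * (Y w / a t) ^+ 2)) *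
    (1 - expR (- (s * (Y w / b t))))) <=
    s * (t * m (b t) / b t) * (m (s^-1 * b t) / m (b t)).
  apply: filterS2 b_gt0 t_gt0 => t bt0 tp.
  rewrite [leRHS](_ : _ = t * ((s / b t) * m (s^-1 * b t))); last first.
    by field; rewrite !gt_eqF ?m0.
  rewrite ler_wpM2l ?(ltW tp)// -ExZ; last first.
    by apply: mbounded_min => //; rewrite mulr_ge0 ?invr_ge0 ?ltW.
  apply: Ex_le; first exact: mint.
    apply: mboundedM; first exact: mbounded_cst.
    by apply: mbounded_min => //; rewrite mulr_ge0 ?invr_ge0 ?ltW.
  move=> w; have sY : 0 <= s * (Y w / b t) by rewrite mulr_ge0 ?divr_ge0 ?(ltW s0) ?(ltW bt0).
  have /andP[h1 h2] := e01 _ sY.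
  apply: le_trans (_ : 1 - expR (- (s * (Y w / b t))) <= _).
    rewrite ler_piMl ?subr_ge0//.
    by have /andP[] := e01 (r * (Y w / a t) ^+ 2) (mulr_ge0 r0 (sqr_ge0 _)).
  have := expR_ge1Dx (- (s * (Y w / b t))).
  have [h|h] := leP (Y w) (s^-1 * b t) => h3.
    by rewrite [leRHS](_ : _ = s * (Y w / b t)); [lra|field; rewrite gt_eqF].
  by rewrite [leRHS](_ : _ = 1); [lra|field; rewrite !gt_eqF].
pose low e t := expR (- (r * e ^+ 2 + s * e * (a t / b t))) * s *
  ((t * m (b t) / b t) * (m (e * a t) / m (b t)) - e * (t * tail (e * a t)) * (a t / b t)).
have lower e : 0 < e -> \forall t \near +oo, low e t <=
    t * \int[P]_w (expR (- (r * (Y w / a t) ^+ 2)) * (1 - expR (- (s * (Y w / b t))))).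
  move=> e0; apply: filterS3 a_gt0 b_gt0 t_gt0 => t at0 bt0 tp.
  have ea : 0 < e * a t by rewrite mulr_gt0.
  pose E := expR (- (r * e ^+ 2 + s * e * (a t / b t))).
  have EE : 0 <= E by exact: expR_ge0.
  rewrite [leLHS](_ : _ = t * (E * (s / b t) * (m (e * a t) - e * a t * tail (e * a t)))); last first.
    by rewrite /low -/E; field; rewrite !gt_eqF ?m0.
  rewrite ler_wpM2l ?(ltW tp)// tailE// -ExZ; last by apply: mbounded_indic; exact: measurable_fun_gt.
  have mi : mbounded (fun w => e * a t * \1_[set w0 | e * a t < Y w0] w).
    by apply: mboundedM; [exact: mbounded_cst|apply: mbounded_indic; exact: measurable_fun_gt].
  have mm : mbounded (fun w => Num.min (Y w) (e * a t)) by apply: mbounded_min => //; exact: ltW.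
  rewrite -ExB// -ExZ; last exact: mboundedB.
  apply: Ex_le; [|exact: mint|].
    by apply: mboundedM; [exact: mbounded_cst|exact: mboundedB].
  move=> w; rewrite indic_set.
  have sY : 0 <= s * (Y w / b t) by rewrite mulr_ge0 ?divr_ge0 ?(ltW s0) ?(ltW bt0).
  have /andP[h1 h2] := e01 _ sY.
  have [h|h] := leP (Y w) (e * a t); last first.
    by rewrite mulr1 subrr mulr0 mulr_ge0 ?expR_ge0 ?subr_ge0.
  rewrite mulr0 subr0.
  apply: le_trans (_ : expR (- (r * (Y w / a t) ^+ 2)) * (expR (- (s * (Y w / b t))) * (s * (Y w / b t))) <= _).
    rewrite [leRHS]mulrA -expRD -[leLHS]mulrA (_ : s / b t * Y w = s * (Y w / b t)); last ring.
    rewrite ler_wpM2r// ler_expR -opprD lerN2.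
    apply: lerD.
      rewrite ler_wpM2l// ler_pXn2r ?nnegrE ?divr_ge0 ?(ltW e0) ?(ltW at0)//.
      by rewrite ler_pdivrMr.
    rewrite -mulrA ler_wpM2l ?(ltW s0)// mulrA ler_wpM2r ?invr_ge0 ?(ltW bt0)//.
  rewrite ler_wpM2l ?expR_ge0//.
  have h3 := expR_ge1Dx (s * (Y w / b t)).
  have h4 : expR (- (s * (Y w / b t))) * expR (s * (Y w / b t)) = 1.
    by rewrite -expRD addNr expR0.
  have := ler_wpM2l h1 h3; rewrite h4 mulrDr mulr1; lra.
have low_cvg e : 0 < e -> low e t @[t --> +oo] --> expR (- (r * e ^+ 2)) * s.
  move=> e0; rewrite -[X in _ --> X](_ : expR (- (r * e ^+ 2 + s * e * 0)) * s *
    (1 * 1 - e * e^-1 * 0) = _); last by rewrite !mulr0 addr0 mulr1 subr0 mulr1.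
  apply: cvgM.
    apply: cvgM; last exact: cvg_cst.
    apply: (continuous_cvg _ (@continuous_expR R _)).
    apply: cvgN; apply: cvgD; first exact: cvg_cst.
    by apply: cvgM; [exact: cvg_cst|exact: norming_ratio0].
  apply: cvgB.
    by apply: cvgM => //; exact: truncated_mean_norming_ratio.
  apply: cvgM; last exact: norming_ratio0.
  by apply: cvgM; [exact: cvg_cst|exact: ttail].
apply/cvgrPdist_le => eps eps0.
have [e e0 He] : exists2 e : R, 0 < e & s - eps / 2 <= expR (- (r * e ^+ 2)) * s.
  (* For e <= 1, exp (- r e^2) s >= s - r s e^2 >= s - (r s + 1) e; adding 1 to r s avoids a zero
     denominator when r = 0. *)
  pose e := Num.min 1 (eps / (2 * (r * s + 1))).
  have rs : 0 < r * s + 1 by rewrite ltr_wpDl// mulr_ge0// ltW.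
  have e0 : 0 < e by rewrite lt_min ltr01 divr_gt0// mulr_gt0.
  exists e => //.
  have h1 := expR_ge1Dx (- (r * e ^+ 2)).
  have := ler_wpM2r (ltW s0) h1; apply: le_trans.
  rewrite mulrDl mul1r lerD2l mulNr lerN2.
  apply: le_trans (_ : (r * s + 1) * e <= _).
    have e1 : e <= 1 by rewrite ge_min lexx.
    have : r * s * e ^+ 2 <= r * s * e.
      by rewrite ler_wpM2l ?mulr_ge0 ?(ltW s0)// expr2 ler_piMl// ltW.
    rewrite mulrDl mul1r; lra.
  rewrite mulrC -ler_pdivlMr//; apply: le_trans (_ : eps / (2 * (r * s + 1)) <= _).
    by rewrite ge_min lexx orbT.
  by rewrite invfM mulrA.
have eps2 : 0 < eps / 2 by lra.
have /cvgrPdist_le/(_ _ eps2) := low_cvg _ e0.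
have /cvgrPdist_le/(_ _ eps2) := up.
move=> n1 n2; apply: filterS3 (near_pinfty_and n1 n2) upper (lower _ e0) => t [].
rewrite !ler_norml => /andP[u1 u2] /andP[u3 u4] u5 u6.
move: u1 u2 u3 u4 u5 u6 He; set I := t * \int[P]_w _; set p := low e t; set q := expR _ * s.
set z := s * _ * _ => *.
by apply/andP; split; lra.
Qed.

(** 1 - exp (- x - y) = (1 - exp (- x)) + exp (- x) (1 - exp (- y)) splits the exponent into the
    purely quadratic one and the linear one weighted by the quadratic factor. *)
Lemma laplace_joint_exponent (r s : R) : 0 <= r -> 0 <= s ->
  t * (1 - \int[P]_w expR (- (r * (Y w / a t) ^+ 2 + s * (Y w / b t))))
  @[t --> +oo] --> Num.sqrt (r * pi) + s.
Proof.
move=> r0 s0.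
have mYc z : measurable_fun setT (fun w => Y w / z) by exact: measurable_funM.
have e01 z : 0 <= z -> 0 <= expR (- z) <= 1.
  by move=> z0; rewrite expR_ge0/= -[leRHS]expR0 ler_expR oppr_le0.
have first : t * (1 - \int[P]_w expR (- (r * (Y w / a t) ^+ 2))) @[t --> +oo] -->
    Num.sqrt (r * pi).
  move: r0; rewrite le_eqVlt => /predU1P[<-|r0].
    rewrite mul0r sqrtr0; apply: cvg_near_cst; apply: nearW => t.
    rewrite (_ : (fun w => _) = cst 1) ?Ex_cst ?subrr ?mulr0//.
    by apply/funext => w; rewrite mul0r oppr0 expR0.
  have sr : 0 < Num.sqrt r by rewrite sqrtr_gt0.
  have sri : 0 < (Num.sqrt r)^-1 by rewrite invr_gt0.
  (* r is absorbed into the norming: t tail(a_t / sqrt r) --> sqrt r, so [laplace_square_exponent]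
     applies with c = sqrt r. *)
  have aroo : (Num.sqrt r)^-1 * a t @[t --> +oo] --> +oo := cvg_comp _ _ aoo (cvg_scale_pinfty sri).
  have tr := ttail sri; rewrite invrK in tr.
  have h := laplace_square_exponent mY Y0 l_sv tail_l (ltW sr) aroo tr.
  have -> : Num.sqrt (r * pi) = Num.sqrt r * Num.sqrt pi by rewrite sqrtrM// ltW.
  have E t : t * (1 - \int[P]_w expR (- (r * (Y w / a t) ^+ 2))) =
      t * (1 - \int[P]_w expR (- (Y w / ((Num.sqrt r)^-1 * a t)) ^+ 2)).
    congr (_ * (1 - _)); apply: eq_Rintegral => w _; congr (expR (- _)).
    have -> : Y w / ((Num.sqrt r)^-1 * a t) = Num.sqrt r * (Y w / a t).
      by rewrite invfM invrK mulrCA.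
    by rewrite [RHS]exprMn sqr_sqrtr// ltW.
  by rewrite (eq_cvg _ _ E).
have h : t * (1 - \int[P]_w expR (- (r * (Y w / a t) ^+ 2))) +
    t * \int[P]_w (expR (- (r * (Y w / a t) ^+ 2)) * (1 - expR (- (s * (Y w / b t)))))
    @[t --> +oo] --> Num.sqrt (r * pi) + s.
  by apply: cvgD => //; exact: laplace_linear_exponent.
apply: cvg_trans h; apply: near_eq_cvg; apply: filterS2 b_gt0 t_gt0 => t bt0 tp /=.
have m1 : mbounded (fun w => expR (- (r * (Y w / a t) ^+ 2))).
  apply: (@mboundedP _ _ _ _ 1) => [|w]; last by apply: e01; rewrite mulr_ge0// sqr_ge0.
  apply: measurableT_comp => //; apply: measurableT_comp => //.
  by apply: measurable_funM => //; exact: measurable_funX.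
have m2 : mbounded (fun w => 1 - expR (- (s * (Y w / b t)))).
  apply: mboundedB; first exact: mbounded_cst.
  apply: (@mboundedP _ _ _ _ 1) => [|w].
    apply: measurableT_comp => //; apply: measurableT_comp => //.
    exact: measurable_funM.
  by apply: e01; rewrite mulr_ge0 ?divr_ge0 ?(ltW bt0).
rewrite -mulrDr; congr (_ * _).
have m12 : mbounded (fun w => expR (- (r * (Y w / a t) ^+ 2 + s * (Y w / b t)))).
  have := mboundedB m1 (mboundedM m1 m2).
  rewrite (_ : (fun w => _ - _) = (fun w => expR (- (r * (Y w / a t) ^+ 2 + s * (Y w / b t)))))//.
  by apply/funext => w; rewrite opprD expRD; ring.
have -> : \int[P]_w (expR (- (r * (Y w / a t) ^+ 2)) * (1 - expR (- (s * (Y w / b t))))) =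
    \int[P]_w expR (- (r * (Y w / a t) ^+ 2)) -
    \int[P]_w expR (- (r * (Y w / a t) ^+ 2 + s * (Y w / b t))).
  by rewrite -ExB//; apply: eq_Rintegral => w _; rewrite opprD expRD; ring.
ring.
Qed.

End joint_exponent.

(** * Independence and random indices *)

Section independence.
Context d (T : measurableType d) (R : realType) (P : probability T R).
Local Notation mu := (@lebesgue_measure R).

Lemma integral_itvoo1 (x : R) : 0 <= x ->
  (\int[mu]_(y in `]0%R, x[) (cst 1%R y)%:E = x%:E)%E.
Proof.
move=> x0; rewrite (integral_cst mu (measurable_itv _) 1%:E)/= mul1e lebesgue_measure_itv/= lte_fin oppr0 adde0.
by case: ltgtP x0 => // <-.
Qed.

(** Factorisation is asked only on the events f > u; the weighted layer-cake formula integrates it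
    over u > 0. *)
Lemma expectation_mul_of_gt (W f : T -> R) : mbounded W -> (forall w, 0 <= W w) ->
  mbounded f -> (forall w, 0 <= f w) ->
  (forall u, \int[P]_w (W w * \1_[set w | u < f w] w) =
    (\int[P]_w W w) * fine (P [set w | u < f w])) ->
  \int[P]_w (W w * f w) = (\int[P]_w W w) * \int[P]_w f w.
Proof.
move=> mW W0 mf f0 H.
have mb u : mbounded (fun w => W w * \1_[set w | u < f w] w).
  by apply: mboundedM => //; apply: mbounded_indic; apply: measurable_fun_gt; case: mf.
apply: EFin_inj; rewrite EFinM !EFin_Ex//; last exact: mboundedM.
have [mW' _] := mW; have [mf' _] := mf.
have WL := @weighted_layer_cake _ _ _ P W f (cst 1) mW' W0 mf' (measurable_cst _) (fun=> ler01).
have fL := @layer_cake _ _ _ P f (cst 1) mf' (measurable_cst _) (fun=> ler01).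
transitivity (\int[P]_w ((W w)%:E * \int[mu]_(y in `]0%R, f w[) (cst 1%R y)%:E))%E.
  by apply: eq_integral => w _; rewrite integral_itvoo1// -EFinM.
rewrite WL.
transitivity (\int[mu]_(y in `]0%R, +oo[) ((\int[P]_w (W w))%:E * P [set w | (y < f w)%R]))%E.
  apply: eq_integral => y _; rewrite mul1e -EFin_Ex// H EFinM; congr (_ * _)%E.
  by rewrite fineK// fin_num_measure//; exact: measurable_fun_gt.
rewrite -EFin_Ex// ge0_integralZl_EFin//.
- congr (_ * _)%E; transitivity (\int[P]_w (\int[mu]_(y in `]0%R, f w[) (cst 1%R y)%:E))%E.
    by rewrite fL; apply: eq_integral => y _; rewrite mul1e.
  by apply: eq_integral => w _; rewrite integral_itvoo1.
- rewrite (_ : (fun y => _) = EFin \o (fun y => fine (P [set w | y < f w]))); last first.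
    apply/funext => y /=; rewrite fineK// fin_num_measure//; exact: measurable_fun_gt.
  apply/measurable_EFinP; apply: measurable_funTS.
  apply: nonincreasing_measurable => // y z yz.
  rewrite fine_le ?fin_num_measure//; try exact: measurable_fun_gt.
  apply: le_measure; rewrite ?inE; try exact: measurable_fun_gt.
  by move=> w /=; exact: le_lt_trans.
- exact: Ex_ge0.
Qed.

Definition unit_fun (phi : R -> R) := measurable_fun setT phi /\ forall x, 0 <= phi x <= 1.

Variables (n : nat) (A : set T) (Z : nat -> T -> R).
Hypothesis mA : measurable A.
Hypothesis mZ : forall i, measurable_fun setT (Z i).
Hypothesis indep : forall B : nat -> set R, (forall i, measurable (B i)) ->
  fine (P (A `&` \bigcap_(i in [set` iota 0 n]) Z i @^-1` B i)) =
  fine (P A) * \prod_(i < n) fine (P (Z i @^-1` B i)).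

Let unit_comp phi i : unit_fun phi -> mbounded (fun w => phi (Z i w)).
Proof.
move=> [mphi phi01]; apply: (@mboundedP _ _ _ _ 1) => //.
exact: measurableT_comp.
Qed.

Let EZ (B : set R) i : measurable B ->
  \int[P]_w (\1_B (Z i w) : R) = fine (P (Z i @^-1` B)).
Proof.
move=> mB; rewrite -Ex_indic; first by apply: eq_Rintegral => w _; rewrite !indicE.
by rewrite -[X in measurable X]setTI; exact: mZ.
Qed.

Let indicU (B : set R) : measurable B -> unit_fun (\1_B).
Proof.
move=> mB; split; first exact: measurable_indic.
by move=> x; rewrite indicE; case: (_ \in _); rewrite ?lexx ler01.
Qed.

(** Indicators are traded for general functions one factor at a time. At stage k the factors of
    index at least k are still indicators; the next one is upgraded by [expectation_mul_of_gt], with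
    the event A and all the other factors as weight W. *)
Lemma expectation_prod (phi : nat -> R -> R) : (forall i, unit_fun (phi i)) ->
  \int[P]_w (\1_A w * \prod_(i < n) phi i (Z i w)) =
  fine (P A) * \prod_(i < n) \int[P]_w phi i (Z i w).
Proof.
move=> uphi.
suff H k : forall phi, (forall i, unit_fun (phi i)) ->
    (forall i, (k <= i)%N -> exists2 B, measurable B & phi i = \1_B) ->
    \int[P]_w (\1_A w * \prod_(i < n) phi i (Z i w)) =
    fine (P A) * \prod_(i < n) \int[P]_w phi i (Z i w).
  pose psi i := if (i < n)%N then phi i else \1_setT.
  have := H n psi.
  have E w : \prod_(i < n) phi i (Z i w) = \prod_(i < n) psi i (Z i w).
    by apply: eq_bigr => i _; rewrite /psi ltn_ord.
  under eq_Rintegral do rewrite -E.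
  have -> : \prod_(i < n) \int[P]_w phi i (Z i w) = \prod_(i < n) \int[P]_w psi i (Z i w).
    by apply: eq_bigr => i _; rewrite /psi ltn_ord.
  apply => i; rewrite /psi.
    by case: ifP => // _; exact: indicU.
  by rewrite leqNgt => /negbTE ->; exists setT.
elim: k {phi uphi} => [|k IH] phi uphi Hphi.
  have [B HB] := choice (fun i => let: ex_intro2 B mB e := Hphi i (leq0n i) in
    ex_intro (fun B => measurable B /\ phi i = \1_B) B (conj mB e)).
  have mB i : measurable (B i) by have [] := HB i.
  have eB i : phi i = \1_(B i) by have [] := HB i.
  have mI : measurable (A `&` \bigcap_(i in [set` iota 0 n]) Z i @^-1` B i).
    apply: measurableI => //; apply: fin_bigcap_measurable; first exact: finite_seq.
    by move=> i _; rewrite -[X in measurable X]setTI; exact: mZ.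
  under [in RHS]eq_bigr do rewrite eB EZ//.
  rewrite -indep// -Ex_indic//; apply: eq_Rintegral => w _.
  rewrite (eq_bigr (fun i : 'I_n => \1_(Z i @^-1` B i) w)); last first.
    by move=> i _; rewrite eB !indicE.
  have [wA|wA] := boolP (w \in A); last first.
    rewrite !indicE (negbTE wA) mul0r memNset// => -[Aw _].
    by move: wA; rewrite notin_setE.
  rewrite indicE wA mul1r.
  have [wI|wI] := pselect (forall i : 'I_n, B i (Z i w)).
    rewrite big1; last by move=> i _; rewrite indicE mem_set//; exact: wI.
    rewrite indicE mem_set//; split; first by rewrite inE in wA.
    by move=> i /=; rewrite mem_iota add0n => /andP[_ h]; exact: (wI (Ordinal h)).
  have [i hi] : exists i : 'I_n, ~ B i (Z i w) by apply/existsNP.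
  rewrite (bigD1 i)//= indicE memNset// mul0r indicE memNset//.
  by move=> [_ /(_ i)]; rewrite /= mem_iota add0n ltn_ord => /(_ isT).
(* If n <= k, index k does not occur in the product, and [phi k] may be replaced by a trivial
   indicator to meet the induction hypothesis. *)
have [nk|kn] := leqP n k.
  pose psi i := if i == k then \1_setT else phi i.
  have ne (i : 'I_n) : (i == k :> nat) = false by rewrite ltn_eqF// (leq_trans _ nk).
  have := IH psi.
  under eq_Rintegral do under eq_bigr do rewrite /psi ne.
  under eq_bigr do rewrite /psi; under eq_bigr do rewrite ne.
  apply => i; rewrite /psi; case: eqP => [_|/eqP ik].
  - exact: indicU.
  - exact: uphi.
  - by exists setT.
  - by move=> ki; apply: Hphi; rewrite ltn_neqAle eq_sym ik.
pose i0 := Ordinal kn.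
pose W w : R := \1_A w * \prod_(i < n | i != i0) phi i (Z i w).
pose c := \prod_(i < n | i != i0) \int[P]_w phi i (Z i w).
have mW : mbounded W.
  apply: mboundedM; first exact: mbounded_indic.
  by apply: mbounded_prod => i; exact: unit_comp.
have key B : measurable B ->
    \int[P]_w (W w * \1_B (Z k w)) = fine (P A) * c * fine (P (Z k @^-1` B)).
  move=> mB; pose psi i := if i == k then \1_B else phi i.
  have upsi i : unit_fun (psi i) by rewrite /psi; case: eqP => _ //; exact: indicU.
  have ipsi i : (k <= i)%N -> exists2 B, measurable B & psi i = \1_B.
    rewrite /psi; case: eqP => [_ _|/eqP ik ki]; first by exists B.
    by apply: Hphi; rewrite ltn_neqAle eq_sym ik.
  have ne (i : 'I_n) : i != i0 -> (i == k :> nat) = false by move=> h; apply/negbTE.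
  have psik : psi k = \1_B by rewrite /psi eqxx.
  have := IH psi upsi ipsi; rewrite (bigD1 i0)//= psik EZ//.
  rewrite [X in _ * (_ * X)](_ : _ = c); last first.
    by apply: eq_bigr => i ii0; rewrite /psi ne.
  rewrite mulrCA mulrC => <-; apply: eq_Rintegral => w _.
  rewrite [in RHS](bigD1 i0)//= psik /W -mulrA; congr (_ * _).
  rewrite mulrC; congr (_ * _); apply: eq_bigr => i ii0.
  by rewrite /psi ne.
(* Taking the whole line for B in [key] identifies the expectation of W. *)
have EW : \int[P]_w W w = fine (P A) * c.
  have := key setT measurableT; rewrite preimage_setT probability_setT mulr1 => <-.
  by apply: eq_Rintegral => w _; rewrite indicT mulr1.
rewrite [in RHS](bigD1 i0)//= mulrCA mulrC -/c -EW -expectation_mul_of_gt//.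
- by apply: eq_Rintegral => w _; rewrite (bigD1 i0)//= mulrCA mulrC.
- move=> w; rewrite /W mulr_ge0 ?indicE//; apply: prodr_ge0 => i _.
  by have [_ /(_ (Z i w))/andP[]] := uphi i.
- exact: unit_comp.
- by move=> w; have [_ /(_ (Z k w))/andP[]] := uphi k.
- move=> u; have mB : measurable [set z | u < phi k z].
    by apply: measurable_fun_gt; have [] := uphi k.
  transitivity (\int[P]_w (W w * \1_[set z | u < phi k z] (Z k w))); last by rewrite EW key.
  by apply: eq_Rintegral.
Qed.

End independence.

Section random_index.
Context d (T : measurableType d) (R : realType) (P : probability T R).
Variable N : T -> nat.
Hypothesis mN : measurable_fun setT N.

Lemma measurable_index n : measurable [set w | N w = n].
Proof.
rewrite (_ : [set w | _] = N @^-1` [set n])//.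
by rewrite -[X in measurable X]setTI; exact: mN.
Qed.

Lemma measurable_random_index (h : nat -> T -> R) :
  (forall n, measurable_fun setT (h n)) -> measurable_fun setT (fun w => h (N w) w).
Proof.
move=> mh _ B mB; rewrite setTI.
rewrite (_ : _ @^-1` _ = \bigcup_n ([set w | N w = n] `&` h n @^-1` B)).
  apply: bigcup_measurable => n _; apply: measurableI; first exact: measurable_index.
  by rewrite -[X in measurable X]setTI; exact: mh.
apply/seteqP; split => w /=; first by move=> Bw; exists (N w).
by move=> [n _ [/= <-]].
Qed.

(** Conditioning on N in elementary form: the events N = n partition the space, and an integral is
    the series of the integrals over them. *)
Lemma expectation_eq_index (F G : T -> R) : mbounded F -> mbounded G ->
  (forall w, 0 <= F w) -> (forall w, 0 <= G w) ->
  (forall n, \int[P]_w (\1_[set w | N w = n] w * F w) =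
             \int[P]_w (\1_[set w | N w = n] w * G w)) ->
  \int[P]_w F w = \int[P]_w G w.
Proof.
move=> mF mG F0 G0 FG; apply: EFin_inj; rewrite !EFin_Ex//.
have UT : setT = \bigcup_n [set w | N w = n].
  by apply/seteqP; split => // w _; exists (N w).
have tI : trivIset setT (fun n => [set w | N w = n]).
  by move=> i j _ _ [w /= [<- <-]].
have mI n := measurable_index n.
have E (H : T -> R) : mbounded H -> (forall w, 0 <= H w) ->
    (\int[P]_w (H w)%:E = \sum_(n <oo) (\int[P]_w (\1_[set w | N w = n] w * H w))%:E)%E.
  move=> mH H0; rewrite [in LHS]UT ge0_integral_bigcup//=.
  - apply: eq_eseriesr => n _; rewrite EFin_Ex.
      rewrite integral_mkcond; apply: eq_integral => w _; rewrite patchE indicE.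
      by case: ifP => _; rewrite ?mul1r ?mul0r.
    by apply: mboundedM => //; exact: mbounded_indic.
  - by rewrite -UT; apply/measurable_EFinP; case: mH.
  - by move=> w _; rewrite lee_fin.
by rewrite !E//; apply: eq_eseriesr => n _; rewrite FG.
Qed.

End random_index.

(** * Laplace transforms of the random index *)

Section laplace_of_distribution.
Context (R : realType).
Local Notation mu := (@lebesgue_measure R).
Implicit Types c x y : R.

(** A monotone function has countably many discontinuities. Convergence in distribution, given at
    continuity points only, thus becomes convergence Lebesgue almost everywhere on the half-line. *)
Lemma cdf_ae_continuous d (T : measurableType d) (P : probability T R) (Z : {RV P >-> R}) :
  {ae mu, forall x, 0 < x ->
     {for x, continuous (fun y => P [set w | Z w <= y])}}.
Proof.
have ZE y : P [set w | Z w <= y] = cdf Z y.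
  by congr (P _); apply/seteqP; split => w /=; rewrite in_itv.
pose F y := fine (cdf Z y).
have Ffin y : (F y)%:E = cdf Z y by rewrite fineK// fin_num_measure.
have F_nd : {homo F : x y / x <= y}.
  by move=> x y xy; rewrite fine_le ?fin_num_measure// cdf_nondecreasing.
pose D n : set R := [set x | x \in (`]0, n%:R[) /\ discontinuity F x].
have D0 n : mu.-negligible (D n).
  have cD : countable (D n).
    by apply: discontinuity_countable => x y _ _; exact: F_nd.
  exists (D n); split => //; first exact: countable_measurable.
  exact: countable_lebesgue_measure0.
apply: (negligibleS _ (negligible_bigcup D0)) => x /=.
move/not_implyP => [x0 nc].
exists (Num.truncn x).+1 => //; split; first by rewrite in_itv/= x0 truncnS_gt.
have Fr : F y @[y --> x^'+] --> F x.
  apply: (fine_cvg (f := cdf Z)); rewrite Ffin; exact: cdf_right_continuous.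
have [Fl cFl] : exists l : R, F y @[y --> x^'-] --> l.
  apply/cvg_ex; apply: nondecreasing_at_left_is_cvgr; apply: nearW => z.
  - by move=> y y' _ _; exact: F_nd.
  - exists (F x); apply/ubP => _ [y /= + <-]; rewrite in_itv/= => /andP[_ /ltW yx]; exact: F_nd.
split.
- by apply/cvg_ex; exists Fl.
- by apply/cvg_ex; exists (F x).
- apply/eqP; rewrite (cvg_lim _ cFl)// (cvg_lim _ Fr)// => FlE; apply: nc.
  have cF : F y @[y --> x] --> F x.
    by apply/left_right_continuousP; split => //; rewrite -FlE.
  rewrite (_ : (fun y => _) = EFin \o F); last by apply/funext => y; rewrite /= ZE Ffin.
  by apply: cvg_EFin; [exact: nearW|exact: cF].
Qed.

Lemma integral_exponential_itvoo c x : 0 < c -> 0 <= x ->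
  (\int[mu]_(y in `]0%R, x[) (exponential_pdf c y)%:E = (1 - expR (- (c * x)))%:E)%E.
Proof.
move=> c0; rewrite le_eqVlt => /predU1P[<-|x0].
  by rewrite set_itvoo0 integral_set0 mulr0 oppr0 expR0 subrr.
have me : measurable_fun setT (exponential_pdf c) by exact: measurable_exponential_pdf.
have meE (B : set R) : measurable_fun B (EFin \o exponential_pdf c).
  by apply/measurable_EFinP; exact: measurable_funTS.
rewrite integral_itv_obnd_cbnd// integral_itv_bndo_bndc//.
by have := exponential_prob_itv0c c x0; rewrite /exponential_prob mulNr EFinB => <-.
Qed.

Section laplace_layer_cake.
Context d (T : measurableType d) (P : probability T R).
Variable X : T -> R.
Hypothesis mX : measurable_fun setT X.

Lemma mbounded_laplace c : 0 <= c -> mbounded (fun w => expR (- (c * Num.max (X w) 0))).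
Proof.
move=> c0; apply: (@mboundedP _ _ _ _ 1).
  apply: measurableT_comp => //; apply: measurableT_comp => //.
  by apply: measurable_funM => //; exact: measurable_maxr.
move=> w; rewrite expR_ge0 -[leRHS]expR0 ler_expR oppr_le0 mulr_ge0//.
by rewrite le_max lexx orbT.
Qed.

(** The exponential density integrated up to X is 1 - exp (- c X), so a Laplace transform becomes an
    integral of tails. The positive part matches the interval ]0, X[ being empty when X <= 0. *)
Lemma laplace_layer_cake c : 0 < c ->
  1 - \int[P]_w expR (- (c * Num.max (X w) 0)) =
  \int[mu]_(y in `]0, +oo[) (exponential_pdf c y * tail P X y).
Proof.
move=> c0; have mb := mbounded_laplace (ltW c0).
rewrite -[X in X - _](Ex_cst P) -ExB//; last exact: mbounded_cst.
have := @layer_cake _ _ _ P X (exponential_pdf c) mX (measurable_exponential_pdf c)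
  (exponential_pdf_ge0 (ltW c0)).
rewrite /Rintegral => H; congr fine.
transitivity (\int[P]_w (\int[mu]_(y in `]0%R, X w[) (exponential_pdf c y)%:E))%E.
  apply: eq_integral => w _; have [X0|X0] := leP (X w) 0.
    by rewrite set_itv_ge ?integral_set0 ?mulr0 ?oppr0 ?expR0 ?subrr// bnd_simp -leNgt.
  by rewrite integral_exponential_itvoo// ltW.
by rewrite H; apply: eq_integral => y _; rewrite EFinM EFin_tail.
Qed.

End laplace_layer_cake.

(** In the form of [laplace_layer_cake], tails converge almost everywhere and the exponential
    density dominates. The positive part keeps the integrand bounded wherever V is negative, as N_t
    / t may be for t < 0. *)
Lemma cvg_laplace_of_distribution d (T : measurableType d) (P : probability T R)
    d' (T' : measurableType d') (P' : probability T' R) (V : R -> T -> R)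
    (Z : {RV P' >-> R}) c :
  (forall t, measurable_fun setT (V t)) -> cvg_in_distribution P V P' Z -> 0 < c ->
  \int[P]_w expR (- (c * Num.max (V t w) 0)) @[t --> +oo] -->
  \int[P']_w expR (- (c * Num.max (Z w) 0)).
Proof.
move=> mV VZ c0.
have mZ : measurable_fun setT Z by [].
have E dd (S : measurableType dd) (Q : probability S R) (X : S -> R) :
    measurable_fun setT X -> \int[Q]_w expR (- (c * Num.max (X w) 0)) =
    1 - \int[mu]_(y in `]0, +oo[) (exponential_pdf c y * tail Q X y).
  by move=> mX; rewrite -laplace_layer_cake// subKr.
rewrite E//; under eq_fun do rewrite E//.
apply: cvgB; first exact: cvg_cst.
have me : measurable_fun setT (exponential_pdf c) by exact: measurable_exponential_pdf.
apply: (@cvg_dominated_pinfty _ _ _ mu `]0, +oo[%classic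
  (fun t y => exponential_pdf c y * tail P (V t) y)
  (fun y => exponential_pdf c y * tail P' Z y) (exponential_pdf c)) => //.
- move=> t; apply: measurable_funM; first exact: measurable_funTS.
  by apply: measurable_funTS; exact: measurable_tail.
- apply: measurable_funM; first exact: measurable_funTS.
  by apply: measurable_funTS; exact: measurable_tail.
- by apply: integrableS (integrable_exponential_pdf c0).
- have [B [mB B0 sB]] := cdf_ae_continuous Z; exists B; split => // x nH.
  apply: sB => /= Hx; apply: nH => /=; rewrite in_itv/= andbT => x0.
  apply: cvgM; first exact: cvg_cst.
  have tE dd (S : measurableType dd) (Q : probability S R) (X : S -> R) :
      measurable_fun setT X -> tail Q X x = 1 - fine (Q [set w | X w <= x]).
    move=> mX; have mgt := measurable_fun_gt x mX.
    have -> : [set w | X w <= x] = ~` [set w | x < X w].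
      by apply/seteqP; split => w /=; rewrite leNgt => /negP.
    by rewrite probability_setC// -EFin_tail// /= subKr.
  rewrite tE//; under eq_fun do rewrite tE//.
  apply: cvgB; first exact: cvg_cst.
  apply: fine_cvg; rewrite fineK ?fin_num_measure//; last first.
    by rewrite -[X in measurable X]setTI; exact: measurable_fun_le.
  by apply: VZ; exact: Hx.
- apply: nearW => t x _; rewrite ger0_norm ?mulr_ge0 ?tail_ge0//; last first.
    by apply: exponential_pdf_ge0; exact: ltW.
  by rewrite ler_piMr ?tail_le1//; apply: exponential_pdf_ge0; exact: ltW.
Qed.

End laplace_of_distribution.

(** * Powers with a random exponent *)

Section random_power.
Context (R : realType).
Implicit Types c y t : R.

(** The bound has to be uniform in y, which will be an unbounded random variable: the linear growth
    of (v - u) y is paid for by u y exp (- u y) <= 1. *)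
Lemma expR_lipschitz (u v y : R) : 0 < u -> u <= v -> 0 <= y ->
  `|expR (- (u * y)) - expR (- (v * y))| <= (v - u) / u.
Proof.
move=> u0 uv y0; have uy0 : 0 <= u * y by rewrite mulr_ge0// ltW.
have uvy : u * y <= v * y by rewrite ler_wpM2r.
rewrite ger0_norm; last by rewrite subr_ge0 ler_expR lerN2.
have -> : expR (- (u * y)) - expR (- (v * y)) =
    expR (- (u * y)) * (1 - expR (- ((v - u) * y))).
  by rewrite mulrBr mulr1 -expRD; congr (_ - expR _); ring.
apply: le_trans (_ : expR (- (u * y)) * ((v - u) * y) <= _).
  apply: ler_wpM2l; first exact: expR_ge0.
  have := expR_ge1Dx (- ((v - u) * y)).
  by move: (expR _) => E; lra.
rewrite ler_pdivlMr//.
have -> : expR (- (u * y)) * ((v - u) * y) * u = (v - u) * (u * y * expR (- (u * y))) by ring.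
rewrite -[leRHS]mulr1; apply: ler_wpM2l; first lra.
rewrite expRN ler_pdivrMr ?expR_gt0// mul1r.
have := expR_ge1Dx (u * y).
by move: (expR _) => E; lra.
Qed.

(** A squeeze by 1 - x <= - ln x <= (1 - x) / x, as chi t --> 1. *)
Lemma cvg_opp_ln (chi : R -> R) c : (forall t, chi t <= 1) ->
  t * (1 - chi t) @[t --> +oo] --> c -> t * - ln (chi t) @[t --> +oo] --> c.
Proof.
move=> chi1 chic.
have chi_cvg : chi t @[t --> +oo] --> (1 : R).
  have h : t^-1 * (t * (1 - chi t)) @[t --> +oo] --> 0 * c.
    apply: cvgM => //; apply/(gtr0_cvgV0 (f := fun t : R => t)); last exact: cvg_id.
    exact: nbhs_pinfty_gt.
  have h' : 1 - t^-1 * (t * (1 - chi t)) @[t --> +oo] --> 1 - 0 * c.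
    by apply: cvgB => //; exact: cvg_cst.
  rewrite mul0r subr0 in h'; apply: cvg_trans h'; apply: near_eq_cvg.
  have := @nbhs_pinfty_gt R 0 (num_real 0); apply: filterS => t t0.
  by field; rewrite gt_eqF.
have up : t * (1 - chi t) / chi t @[t --> +oo] --> c.
  rewrite -[X in _ --> X]divr1; apply: cvgM => //; apply: cvgV => //; exact: oner_neq0.
have chi_pos : \forall t \near +oo, 0 < chi t.
  by have /cvgr_gt/(_ _ ltr01) := chi_cvg.
apply: (squeeze_cvgr _ chic up).
have t0 := @nbhs_pinfty_gt R 0 (num_real 0).
apply: filterS2 t0 chi_pos => t t0 ct0; apply/andP; split.
  apply: ler_wpM2l; first exact: ltW.
  have := expR_ge1Dx (ln (chi t)); rewrite lnK ?posrE//.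
  by move: (ln _) => E; lra.
rewrite -mulrA; apply: ler_wpM2l; first exact: ltW.
have := expR_ge1Dx (- ln (chi t)); rewrite expRN lnK ?posrE// mulrBl divff ?gt_eqF// mul1r.
by move: (ln _) => E; lra.
Qed.

(** chi^N = exp (- e_t N / t) with e_t = - t ln chi --> c, so only the rate e_t has to be replaced
    by c, which [expR_lipschitz] does uniformly in N / t. *)
Lemma cvg_random_power d (T : measurableType d) (P : probability T R)
    (N : R -> T -> nat) (chi : R -> R) (c z : R) :
  (forall t, measurable_fun setT (N t)) -> (forall t, 0 <= chi t <= 1) -> 0 < c ->
  \int[P]_w expR (- (c * Num.max ((N t w)%:R / t) 0)) @[t --> +oo] --> z ->
  t * (1 - chi t) @[t --> +oo] --> c ->
  \int[P]_w chi t ^+ N t w @[t --> +oo] --> z.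
Proof.
move=> mN chi01 c0 Nz chic.
have chi1 t : chi t <= 1 by have /andP[] := chi01 t.
pose e t := t * - ln (chi t).
have ec : e t @[t --> +oo] --> c by exact: cvg_opp_ln.
have mV t : measurable_fun setT (fun w => (N t w)%:R / t : R).
  by apply: measurable_funM => //; exact: (measurable_random_index (mN t) (h := fun n _ => n%:R)).
have mb1 t := mbounded_laplace (mV t) (ltW c0).
have mb2 t : mbounded (fun w => chi t ^+ N t w).
  apply: (@mboundedP _ _ _ _ 1) => [|w].
    exact: (measurable_random_index (mN t) (h := fun n _ => chi t ^+ n)).
  by have /andP[x0 x1] := chi01 t; rewrite exprn_ge0// exprn_ile1.
suff H : \int[P]_w chi t ^+ N t w - \int[P]_w expR (- (c * Num.max ((N t w)%:R / t) 0))
    @[t --> +oo] --> (0 : R).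
  have h : \int[P]_w chi t ^+ N t w - \int[P]_w expR (- (c * Num.max ((N t w)%:R / t) 0)) +
      \int[P]_w expR (- (c * Num.max ((N t w)%:R / t) 0)) @[t --> +oo] --> 0 + z.
    exact: cvgD.
  rewrite add0r in h; apply: cvg_trans h; apply: near_eq_cvg.
  by apply: nearW => t /=; rewrite subrK.
(* Eventually both c and e_t exceed c / 2, so this quotient bounds the error whichever of the two is
   smaller. *)
have lim0 : `|e t - c| / (c / 2) @[t --> +oo] --> (0 : R).
  rewrite -[X in _ --> X](mul0r (c / 2)^-1); apply: cvgM; last exact: cvg_cst.
  rewrite -[X in _ --> X](@normr0 R R); apply: cvg_norm; rewrite -(subrr c).
  by apply: cvgB => //; exact: cvg_cst.
apply/norm_cvg0P; apply: (squeeze_cvgr _ _ lim0); last exact: cvg_cst.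
have e_gt : \forall t \near +oo, c / 2 < e t.
  by have /cvgr_gt := ec; apply; lra.
have t0 := @nbhs_pinfty_gt R 0 (num_real 0).
apply: filterS2 t0 e_gt => t t0 et; rewrite normr_ge0/=.
rewrite -ExB//; apply: le_trans (Ex_abs _ _) _; first exact: mboundedB.
rewrite -[leRHS](Ex_cst P); apply: Ex_le.
- have [m [M hM]] := mboundedB (mb2 t) (mb1 t); split; first exact: measurableT_comp.
  by exists M => w; rewrite normr_id.
- exact: mbounded_cst.
move=> w; have V0 : 0 <= (N t w)%:R / t by rewrite divr_ge0// ltW.
rewrite max_l//.
(* If chi t were 0, [ln] would return its default value 0 and e_t would vanish, against e_t > c /
   2. *)
have ct0 : 0 < chi t.
  rewrite lt_neqAle; have /andP[-> _] := chi01 t; rewrite andbT; apply/negP => /eqP ct.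
  by move: et; rewrite /e -ct ln0// oppr0 mulr0; lra.
have -> : chi t ^+ N t w = expR (- (e t * ((N t w)%:R / t))).
  rewrite -[X in X ^+ _](lnK ct0) -expRM_natl; congr expR.
  by rewrite /e; field; rewrite gt_eqF.
have [ce|ec'] := leP c (e t).
  rewrite distrC; apply: le_trans (expR_lipschitz c0 ce V0) _.
  rewrite ger0_norm ?subr_ge0//; apply: ler_wpM2l; first by rewrite subr_ge0.
  by rewrite lef_pV2 ?posrE; lra.
have e0 : 0 < e t by lra.
apply: le_trans (expR_lipschitz e0 (ltW ec') V0) _.
rewrite distrC ger0_norm ?subr_ge0 ?(ltW ec')//; apply: ler_wpM2l; first by rewrite subr_ge0 ltW.
by rewrite lef_pV2 ?posrE; lra.
Qed.

End random_power.

Section random_products.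
Context d (T : measurableType d) (R : realType) (P : probability T R).
Variable X : nat -> {RV P >-> R}.

Lemma identically_distributed_expectation (g : R -> R) i :
  identically_distributed X -> unit_fun g ->
  \int[P]_w g (X i w) = \int[P]_w g (X 0%N w).
Proof.
move=> iX [mg g01]; rewrite /Rintegral; congr fine.
have E j : (\int[P]_w (g (X j w))%:E = \int[distribution P (X j)]_x (g x)%:E)%E.
  rewrite ge0_integral_distribution//; first exact/measurable_EFinP.
  by move=> y; rewrite lee_fin; have /andP[] := g01 y.
by rewrite !E; apply: eq_measure_integral => B mB _; exact: iX.
Qed.

Lemma mbounded_random_product (N : T -> nat) (g : R -> R) :
  measurable_fun setT N -> unit_fun g ->
  mbounded (fun w => \prod_(i < N w) g (X i w)).
Proof.
move=> mN [mg g01]; apply: (@mboundedP _ _ _ _ 1) => [|w].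
  apply: (measurable_random_index mN (h := fun n w => \prod_(i < n) g (X i w))) => n.
  apply: measurable_prod => i _; exact: measurableT_comp.
apply/andP; split; first by apply: prodr_ge0 => i _; have /andP[] := g01 (X i w).
by apply: prodr_ile1 => i _; exact: g01.
Qed.

Lemma expectation_random_product (N : T -> nat) (g : R -> R) :
  measurable_fun setT N -> identically_distributed X -> unit_fun g ->
  (forall n (B : nat -> set R), (forall i, measurable (B i)) ->
    fine (P ([set w | N w = n] `&` \bigcap_(i in [set` iota 0 n]) X i @^-1` B i)) =
    fine (P [set w | N w = n]) * \prod_(i < n) fine (P (X i @^-1` B i))) ->
  \int[P]_w \prod_(i < N w) g (X i w) = \int[P]_w (\int[P]_w g (X 0%N w)) ^+ N w.
Proof.
move=> mN iX ug indep; have [mg g01] := ug.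
set chi := \int[P]_w g _.
have mgX : mbounded (fun w => g (X 0%N w)).
  by apply: (@mboundedP _ _ _ _ 1) => //; exact: measurableT_comp.
have chi0 : 0 <= chi by apply: Ex_ge0 => w; have /andP[] := g01 (X 0%N w).
have chi1 : chi <= 1.
  rewrite -[leRHS](Ex_cst P); apply: Ex_le => //; first exact: mbounded_cst.
  by move=> w; have /andP[] := g01 (X 0%N w).
have mchi : mbounded (fun w => chi ^+ N w).
  apply: (@mboundedP _ _ _ _ 1) => [|w].
    exact: (measurable_random_index mN (h := fun n _ => chi ^+ n)).
  by rewrite exprn_ge0// exprn_ile1.
apply: (expectation_eq_index mN) => //.
- exact: mbounded_random_product.
- by move=> w; apply: prodr_ge0 => i _; have /andP[] := g01 (X i w).
- by move=> w; rewrite exprn_ge0.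
move=> n; have mI := measurable_index mN n.
transitivity (\int[P]_w (\1_[set w | N w = n] w * \prod_(i < n) g (X i w))).
  apply: eq_Rintegral => w _; rewrite indicE.
  by have [|] := boolP (w \in _); rewrite ?mul0r// inE/= => ->.
rewrite (expectation_prod mI _ (@indep n) (fun=> ug))//.
under eq_bigr do rewrite identically_distributed_expectation//.
rewrite -/chi prodr_const card_ord mulrC -Ex_indic// -ExZ; last exact: mbounded_indic.
apply: eq_Rintegral => w _; rewrite mulrC indicE.
by have [|] := boolP (w \in _); rewrite ?mul0r// inE/= => ->.
Qed.

(** The event N t = n belongs to the sigma-algebra of the process and the finite intersection to
    that of the X_i, so independence of the two separates them; mutual independence then factors the
    intersection. *)
Lemma process_independent_index (N : R -> {RV P >-> nat}) t : 0 <= t ->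
  mutually_independent X -> process_independent_of N X ->
  forall n (B : nat -> set R), (forall i, measurable (B i)) ->
    fine (P ([set w | N t w = n] `&` \bigcap_(i in [set` iota 0 n]) X i @^-1` B i)) =
    fine (P [set w | N t w = n]) * \prod_(i < n) fine (P (X i @^-1` B i)).
Proof.
move=> t0 iX NX n B mB.
have mXB i : measurable (X i @^-1` B i).
  by apply: measurable_funPTI.
have -> : P ([set w | N t w = n] `&` \bigcap_(i in [set` iota 0 n]) X i @^-1` B i) =
    (P [set w | N t w = n] * P (\bigcap_(i in [set` iota 0 n]) X i @^-1` B i))%E.
  apply: NX.
    apply: sub_sigma_algebra; exists t; first by rewrite /= in_itv/= t0.
    by exists [set n] => //; rewrite setTI.
  pose G := \bigcup_(i in [set: nat]) preimage_set_system setT (X i : T -> R) measurable.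
  have mG i : <<s G >> (X i @^-1` B i).
    by apply: sub_sigma_algebra; exists i => //; exists (B i) => //; rewrite setTI.
  have := @fin_bigcap_measurable _ (g_sigma_algebraType G) nat [set` iota 0 n]
    (fun i => X i @^-1` B i) (finite_seq _) (fun i _ => mG i).
  exact.
rewrite iX ?iota_uniq// fineM ?fin_num_measure//; last 2 first.
- by exact: measurable_index.
- rewrite -iX ?iota_uniq// fin_num_measure//.
  by apply: fin_bigcap_measurable => //; exact: finite_seq.
congr (_ * _); rewrite -(big_mkord xpredT (fun i => fine (P (X i @^-1` B i)))) /index_iota subn0.
elim: (iota 0 n) => [|i s IH]; first by rewrite !big_nil.
rewrite !big_cons fineM ?IH// ?fin_num_measure//.
by rewrite prode_fin_num// => j _; rewrite fin_num_measure.
Qed.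

End random_products.

(** * Almost sure equalities and the limit law *)

Section almost_sure.
Context d (T : measurableType d) (R : realType) (P : probability T R).

Lemma probability_bigcap1 (A : nat -> set T) : (forall i, measurable (A i)) ->
  (forall i, P (A i) = 1%E) -> P (\bigcap_i A i) = 1%E.
Proof.
move=> mA A1.
have nA i : P.-negligible (~` A i).
  exists (~` A i); split => //; first exact: measurableC.
  by have := probability_setC P (mA i); rewrite A1 subee.
have mB : measurable (\bigcup_i ~` A i) by apply: bigcupT_measurable => i; exact: measurableC.
have /(negligibleP P mB) B0 := negligible_bigcup nA.
rewrite -[X in P X]setCK setC_bigcap; have := probability_setC P mB.
by rewrite B0 sube0.
Qed.

Lemma probability_setI1 (A B : set T) : measurable A -> measurable B ->
  P A = 1%E -> P B = 1%E -> P (A `&` B) = 1%E.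
Proof.
move=> mA mB A1 B1.
rewrite (_ : A `&` B = \bigcap_i (if i is 0%N then A else B)).
  by apply: probability_bigcap1; case.
apply/seteqP; split => w; first by move=> [Aw Bw] [|i].
by move=> H; split; [exact: (H 0%N)|exact: (H 1%N)].
Qed.

Lemma probability_ae_eq (A B C : set T) : measurable A -> measurable B -> measurable C ->
  P A = 1%E -> (forall w, A w -> (B w <-> C w)) -> P B = P C.
Proof.
move=> mA mB mC A1 BC.
rewrite -[LHS]fineK ?fin_num_measure// -[RHS]fineK ?fin_num_measure//; congr EFin.
rewrite -!Ex_indic//; apply: (Ex_ae_eq (A := A)) => //.
move=> w Aw; rewrite !indicE; congr ((nat_of_bool _)%:R).
by apply/idP/idP; rewrite !inE => /BC; apply.
Qed.

End almost_sure.

Section limit_law.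
Context (R : realType) d (T : measurableType d) (P : probability T R).
Context d' (T' : measurableType d') (P' : probability T' R).
Variables (Lam : {RV P >-> R}) (U L : {RV P' >-> R}).
Hypothesis Lam_pos : P [set w | 0 < Lam w] = 1%E.
Hypothesis UL : limit_vector Lam U L.

Lemma limit_vector_pos : P' [set w | 0 < L w] = 1%E.
Proof.
have [_ LE _] := UL.
have E dd (S : measurableType dd) (Q : probability S R) (X : {RV Q >-> R}) :
    Q [set w | 0 < X w] = distribution Q X `]0, +oo[.
  by congr (Q _); apply/seteqP; split => w /=; rewrite in_itv/= andbT.
by rewrite E LE// -E.
Qed.

(** [limit_vector] fixes the signs of U and L almost surely only; on this event of probability one
    they agree with their absolute values. *)
Let pos_set : set T' := [set w | 0 <= U w] `&` [set w | 0 < L w].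

Let mpos_set : measurable pos_set.
Proof.
apply: measurableI; last exact: measurable_fun_gt.
by rewrite -[X in measurable X]setTI; exact: measurable_fun_le.
Qed.

Let pos_set1 : P' pos_set = 1%E.
Proof.
have [U0 _ _] := UL; apply: probability_setI1 => //; last exact: limit_vector_pos.
  by rewrite -[X in measurable X]setTI; exact: measurable_fun_le.
exact: measurable_fun_gt.
Qed.

Lemma ae_eq_limit_vector (f g : R -> R -> R) :
  measurable_fun setT (fun w => f (U w) (L w)) ->
  measurable_fun setT (fun w => g (U w) (L w)) ->
  (forall u v, 0 <= u -> 0 < v -> f u v = g u v) ->
  \int[P']_w f (U w) (L w) = \int[P']_w g (U w) (L w).
Proof.
by move=> mf mg fg; apply: (Ex_ae_eq mf mg mpos_set) => // w [u v]; exact: fg.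
Qed.

Lemma limit_vector_laplace (r s : R) : 0 <= r -> 0 <= s ->
  \int[P']_w expR (- (r * `|U w| + s * `|L w|)) =
  \int[P]_w expR (- ((Num.sqrt (r * pi) + s) * Num.max (Lam w) 0)).
Proof.
move=> r0 s0; have [_ LE lapl] := UL.
have mU : measurable_fun setT (U : T' -> R) by [].
have mL : measurable_fun setT (L : T' -> R) by [].
have mLam : measurable_fun setT (Lam : T -> R) by [].
have mabs dd (S : measurableType dd) (h : S -> R) : measurable_fun setT h ->
    measurable_fun setT (fun w => `|h w|) by move=> mh; exact: measurableT_comp.
have mexp dd (S : measurableType dd) (h : S -> R) : measurable_fun setT h ->
    measurable_fun setT (fun w => expR (h w)) by move=> mh; exact: measurableT_comp.
have mopp dd (S : measurableType dd) (h : S -> R) : measurable_fun setT h ->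
    measurable_fun setT (fun w => - h w) by move=> mh; exact: measurableT_comp.
set c := Num.sqrt (r * pi) + s.
have c0 : 0 <= c by rewrite addr_ge0// sqrtr_ge0.
transitivity (\int[P']_w expR (- (c * Num.max (L w) 0))).
  (* The prescribed transform covers r > 0 only; for r = 0 the two integrands coincide almost
     surely. *)
  move: r0; rewrite le_eqVlt => /predU1P[r0|r0].
    apply: (@ae_eq_limit_vector (fun u v => expR (- (r * `|u| + s * `|v|)))
      (fun u v => expR (- (c * Num.max v 0)))).
    - apply: mexp; apply: mopp; apply: measurable_funD; apply: measurable_funM => //; exact: mabs.
    - apply: mexp; apply: mopp; apply: measurable_funM => //; exact: measurable_maxr.
    - move=> u v u0 v0; rewrite /c -r0 !mul0r sqrtr0 !add0r max_l ?ltW//.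
      by rewrite gtr0_norm.
  transitivity (\int[P']_w expR (- r * U w - s * L w)).
    apply: (@ae_eq_limit_vector (fun u v => expR (- (r * `|u| + s * `|v|)))
      (fun u v => expR (- r * u - s * v))).
    - apply: mexp; apply: mopp; apply: measurable_funD; apply: measurable_funM => //; exact: mabs.
    - by apply: mexp; apply: measurable_funB; apply: measurable_funM.
    - by move=> u v u0 v0; rewrite ger0_norm// gtr0_norm//; congr expR; ring.
  transitivity (\int[P']_w expR (- s * L w - Num.sqrt (r * pi) * L w)).
    by have := lapl r s r0 s0; rewrite unlock /Rintegral => ->.
  apply: (@ae_eq_limit_vector (fun u v => expR (- s * v - Num.sqrt (r * pi) * v))
      (fun u v => expR (- (c * Num.max v 0)))).
  - by apply: mexp; apply: measurable_funB; apply: measurable_funM.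
  - apply: mexp; apply: mopp; apply: measurable_funM => //; exact: measurable_maxr.
  - by move=> u v u0 v0; rewrite max_l ?ltW//; congr expR; rewrite /c; ring.
have mg : measurable_fun setT (fun v : R => expR (- (c * Num.max v 0))).
  by apply: mexp; apply: mopp; apply: measurable_funM => //; exact: measurable_maxr.
have E dd (S : measurableType dd) (Q : probability S R) (X : {RV Q >-> R}) :
    (\int[Q]_w (expR (- (c * Num.max (X w) 0)))%:E =
     \int[distribution Q X]_v (expR (- (c * Num.max v 0)))%:E)%E.
  rewrite ge0_integral_distribution//; first exact/measurable_EFinP.
by rewrite /Rintegral (E _ _ P' L) (E _ _ P Lam); congr fine; apply: eq_measure_integral => B mB _; exact: LE.
Qed.

Lemma probability_limit_ratio (y : R) :
  P' [set w | U w / L w ^+ 2 <= y] = P' [set w | `|U w| / `|L w| ^+ 2 <= y].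
Proof.
have m : measurable_fun setT (fun w => U w / L w ^+ 2).
  apply: measurable_funM => //; apply: (measurableT_comp (@measurable_invr R)).
  exact: measurable_funX.
have m' : measurable_fun setT (fun w => `|U w| / `|L w| ^+ 2).
  apply: measurable_funM; first exact: measurableT_comp.
  apply: (measurableT_comp (@measurable_invr R)).
  by apply: measurable_funX; exact: measurableT_comp.
apply: (probability_ae_eq (A := pos_set)) => //.
- by rewrite -[X in measurable X]setTI; exact: measurable_fun_le.
- by rewrite -[X in measurable X]setTI; exact: measurable_fun_le.
- by move=> w [U0 L0]; rewrite /= ger0_norm// gtr0_norm.
Qed.

End limit_law.

(** * Convergence of the self-normalised statistic *)

Section convergence.
Context (R : realType) (d : measure_display) (Omega : measurableType d) (P : probability Omega R).
Variables (X : nat -> {RV P >-> R}) (l : R -> R).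
Hypothesis X_pos : forall i, P [set w | 0 < X i w] = 1%E.
Hypothesis X_pareto : pareto_type (fun x => fine (cdf (X 0%N) x)) 1 l.
Hypothesis X_mean : 'E_P[X 0%N]%E = +oo%E.
Hypothesis l_int : log_integrable l.

(** X is positive only almost surely, whereas the analysis of the exponents asks for a variable that
    is nonnegative at every point. *)
Let Y w := `|X 0%N w|.

Let mX i : measurable_fun setT (X i : Omega -> R).
Proof. by []. Qed.

Let mY : measurable_fun setT Y.
Proof. exact: measurableT_comp. Qed.

Let Y0 w : 0 <= Y w.
Proof. exact: normr_ge0. Qed.

Let l_sv : slowly_varying l.
Proof. by have [] := X_pareto. Qed.

Lemma tail_abs_pareto : tail P Y x / (x^-1 * l x) @[x --> +oo] --> (1 : R).
Proof.
have [_ H] := X_pareto; apply: cvg_trans H; apply: near_eq_cvg.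
have := @nbhs_pinfty_ge R 0 (num_real 0); apply: filterS => x x0.
rewrite powR_inv1//; congr (_ / _).
have mle : measurable [set w | X 0%N w <= x].
  by rewrite -[X in measurable X]setTI; exact: measurable_fun_le.
have cE : cdf (X 0%N) x = P [set w | X 0%N w <= x].
  by congr (P _); apply/seteqP; split => w /=; rewrite in_itv.
rewrite cE; transitivity (fine (P (~` [set w | X 0%N w <= x]))).
  by rewrite probability_setC// -[P _]fineK ?fin_num_measure.
rewrite /tail; congr fine; apply: (probability_ae_eq (A := [set w | 0 < X 0%N w])) => //.
- exact: measurable_fun_gt.
- exact: measurableC.
- exact: measurable_fun_gt.
- move=> w /= X0; rewrite /Y gtr0_norm//; split; first by move=> /negP; rewrite -ltNge.
  by move=> xX; apply/negP; rewrite -ltNge.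
Qed.

Lemma expectation_abs_pareto : 'E_P[Y]%E = +oo%E.
Proof.
rewrite -X_mean unlock; apply: ae_eq_integral => //.
- exact/measurable_EFinP.
- exact/measurable_EFinP.
- exists (~` [set w | 0 < X 0%N w]); split.
  + by apply: measurableC; exact: measurable_fun_gt.
  + have := probability_setC P (measurable_fun_gt 0 (mX 0%N)).
    by rewrite X_pos subee.
  + by move=> w /= H X0; apply: H => _; rewrite /Y gtr0_norm.
Qed.

Lemma log_primitive_slowly_varying : slowly_varying (log_primitive l).
Proof.
exact: (log_primitive_sv mY Y0 l_sv tail_abs_pareto expectation_abs_pareto l_int).
Qed.

Variables a a' : R -> R.
Hypothesis a_norming : norming l a.
Hypothesis a'_norming : norming (log_primitive l) a'.

Lemma norming_tail : t * tail P Y (a t) @[t --> +oo] --> (1 : R).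
Proof.
have [aoo al] := a_norming.
have h : t * (a t)^-1 * l (a t) * (tail P Y (a t) / ((a t)^-1 * l (a t))) @[t --> +oo] -->
    (1 * 1 : R).
  by apply: cvgM => //; exact: (cvg_at_pinfty_comp tail_abs_pareto aoo).
rewrite mulr1 in h; apply: cvg_trans h; apply: near_eq_cvg.
have a0 : \forall t \near +oo, 0 < a t by move/cvgryPgt : aoo; apply.
have l0 : \forall t \near +oo, 0 < l (a t) by have [_ lp _] := l_sv; exact: (aoo _ lp).
by apply: filterS2 a0 l0 => t a0 l0; field; rewrite !gt_eqF.
Qed.

Lemma norming_truncated_mean :
  t * truncated_mean P Y `|a' t| / `|a' t| @[t --> +oo] --> (1 : R).
Proof.
have [aoo al] := a'_norming.
have e : truncated_mean P Y x / log_primitive l x @[x --> +oo] --> (1 : R).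
  have h := log_primitive_equiv mY Y0 l_sv tail_abs_pareto expectation_abs_pareto l_int.
  have h' : (log_primitive l x / truncated_mean P Y x)^-1 @[x --> +oo] --> (1^-1 : R).
    by apply: cvgV => //; exact: oner_neq0.
  rewrite invr1 in h'; apply: cvg_trans h'; apply: near_eq_cvg; apply: nearW => x.
  by rewrite invfM invrK mulrC.
have h : t * (a' t)^-1 * log_primitive l (a' t) *
    (truncated_mean P Y (a' t) / log_primitive l (a' t)) @[t --> +oo] --> (1 * 1 : R).
  by apply: cvgM => //; exact: (cvg_at_pinfty_comp e aoo).
rewrite mulr1 in h; apply: cvg_trans h; apply: near_eq_cvg.
have a0 : \forall t \near +oo, 0 < a' t by move/cvgryPgt : aoo; apply.
have l0 : \forall t \near +oo, 0 < log_primitive l (a' t).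
  by have [_ lp _] := log_primitive_slowly_varying; exact: (aoo _ lp).
by apply: filterS2 a0 l0 => t a0 l0; rewrite gtr0_norm//; field; rewrite !gt_eqF.
Qed.

Let abs_a'oo : `|a' t| @[t --> +oo] --> +oo.
Proof.
have [aoo _] := a'_norming.
have a0 : \forall t \near +oo, 0 < a' t by move/cvgryPgt : aoo; apply.
apply: cvg_trans aoo; apply: near_eq_cvg.
by apply: filterS a0 => t a0; rewrite gtr0_norm.
Qed.

Variable N : R -> {RV P >-> nat}.
Hypothesis X_indep : mutually_independent X.
Hypothesis X_ident : identically_distributed X.
Hypothesis N_indep : process_independent_of N X.
Context (dL : measure_display) (OmegaL : measurableType dL) (PL : probability OmegaL R).
Variable Lam : {RV PL >-> R}.
Hypothesis N_averages : D_averages_in_time N Lam.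

(** [cvg_ratio_of_laplace] wants nonnegative variables for every t, and a norming is positive only
    eventually: hence the division by |a' t| in [B], while a sum of squares is nonnegative
    anyway. *)
Let A t w := \sum_(i < N t w) (`|X i w| / a t) ^+ 2.
Let B t w := \sum_(i < N t w) `|X i w| / `|a' t|.

Let mabsX i c : measurable_fun setT (fun w => `|X i w| / c).
Proof. by apply: measurable_funM => //; exact: measurableT_comp. Qed.

Let mA t : measurable_fun setT (A t).
Proof.
apply: (measurable_random_index (N := N t) _ (h := fun n w => \sum_(i < n) (`|X i w| / a t) ^+ 2)) => // n.
by apply: measurable_sum => i; exact: measurable_funX.
Qed.

Let mB t : measurable_fun setT (B t).
Proof.
apply: (measurable_random_index (N := N t) _ (h := fun n w => \sum_(i < n) `|X i w| / `|a' t|)) => // n.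
by apply: measurable_sum => i.
Qed.

Lemma cvg_laplace_random_sums (r s : R) : 0 <= r -> 0 <= s ->
  \int[P]_w expR (- (r * A t w + s * B t w)) @[t --> +oo] -->
  \int[PL]_w expR (- ((Num.sqrt (r * pi) + s) * Num.max (Lam w) 0)).
Proof.
move=> r0 s0.
pose g t (x : R) := expR (- (r * (`|x| / a t) ^+ 2 + s * (`|x| / `|a' t|))).
have ug t : unit_fun (g t).
  split.
    have mn (c : R) : measurable_fun setT (fun x : R => `|x| / c).
      by apply: measurable_funM => //; exact: measurableT_comp.
    apply: measurableT_comp => //; apply: measurableT_comp => //.
    by apply: measurable_funD; apply: measurable_funM => //; exact: measurable_funX.
  move=> x; rewrite expR_ge0/= -[leRHS]expR0 ler_expR oppr_le0.
  by rewrite addr_ge0// mulr_ge0 ?sqr_ge0 ?divr_ge0.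
pose chi t := \int[P]_w g t (X 0%N w).
have mg t : mbounded (fun w => g t (X 0%N w)).
  have [m01 g01] := ug t; apply: (@mboundedP _ _ _ _ 1) => //; exact: measurableT_comp.
have chi01 t : 0 <= chi t <= 1.
  have [_ g01] := ug t; apply/andP; split.
    by apply: Ex_ge0 => w; have /andP[] := g01 (X 0%N w).
  rewrite -[leRHS](Ex_cst P); apply: Ex_le => //; first exact: mbounded_cst.
  by move=> w; have /andP[] := g01 (X 0%N w).
have key : \forall t \near +oo, \int[P]_w chi t ^+ N t w =
    \int[P]_w expR (- (r * A t w + s * B t w)).
  have := @nbhs_pinfty_ge R 0 (num_real 0); apply: filterS => t t0.
  rewrite /chi -(expectation_random_product _ X_ident (ug t))//; last first.
    exact: process_independent_index.
  apply: eq_Rintegral => w _; rewrite /A /B !mulr_sumr -big_split/= -sumrN expR_sum.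
  by apply: eq_bigr.
apply: cvg_trans (near_eq_cvg key) _.
have c0 : 0 <= Num.sqrt (r * pi) + s by rewrite addr_ge0 ?sqrtr_ge0.
have chic : t * (1 - chi t) @[t --> +oo] --> Num.sqrt (r * pi) + s.
  apply: (laplace_joint_exponent mY Y0 l_sv tail_abs_pareto
    _ abs_a'oo norming_tail norming_truncated_mean r0 s0).
  by have [] := a_norming.
(* [cvg_random_power] asks for a positive rate; a zero rate forces r = s = 0, where both sides are
   1. *)
move: c0; rewrite le_eqVlt => /predU1P[c0|c0].
  have [r00 s00] : r = 0 /\ s = 0.
    move/esym/eqP : c0; rewrite paddr_eq0 ?sqrtr_ge0// sqrtr_eq0 pmulr_lle0 ?pi_gt0//.
    by move=> /andP[rn /eqP ->]; split => //; apply/eqP; rewrite eq_le rn r0.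
  have e1 dd (S : measurableType dd) (Q : probability S R) (h : S -> R) :
      (forall w, h w = 0) -> \int[Q]_w expR (h w) = 1.
    by move=> h0; under eq_Rintegral do rewrite h0 expR0; rewrite Ex_cst.
  have chi_eq1 t : chi t = 1.
    by rewrite /chi /g; apply: e1 => w; rewrite r00 s00 !mul0r addr0 oppr0.
  have pow1 t : \int[P]_w chi t ^+ N t w = 1.
    by under eq_Rintegral do rewrite chi_eq1 expr1n; rewrite Ex_cst.
  rewrite (eq_cvg _ _ pow1) e1; first exact: cvg_cst.
  by move=> w; rewrite -c0 mul0r oppr0.
apply: (cvg_random_power _ chi01 c0) => //.
have [_ NL] := N_averages.
apply: cvg_laplace_of_distribution NL c0 => t.
by apply: measurable_funM => //; exact: (measurable_random_index (N := N t) _ (h := fun n _ => n%:R)).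
Qed.

Context (d' : measure_display) (Omega' : measurableType d') (P' : probability Omega' R).
Variables U L : {RV P' >-> R}.
Hypothesis UL : limit_vector Lam U L.

Let Tn t w := (a' t / a t) ^+ 2 * T_stat (fun i => X i : Omega -> R) (N t) w.

Let Tn_ratio t w : (forall i, 0 < X i w) -> Tn t w = A t w / B t w ^+ 2.
Proof.
move=> Xw; rewrite /Tn /A /B /T_stat.
have S2 : \sum_(i < N t w) (`|X i w| / a t) ^+ 2 = (\sum_(i < N t w) X i w ^+ 2) / a t ^+ 2.
  by rewrite mulr_suml; apply: eq_bigr => i _; rewrite gtr0_norm// expr_div_n.
have S1 : \sum_(i < N t w) `|X i w| / `|a' t| = (\sum_(i < N t w) X i w) / `|a' t|.
  by rewrite mulr_suml; apply: eq_bigr => i _; rewrite gtr0_norm.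
rewrite S1 S2; case: ifP => [_|].
  rewrite !expr_div_n real_normK ?num_real//.
  move: (\sum_(i < N t w) X i w ^+ 2) (\sum_(i < N t w) X i w) => s2 s1.
  by rewrite (invfM (s1 ^+ 2)) invrK; ring.
(* For N = 0 the default value of [T_stat] agrees with 0 / 0 = 0 for the empty sums. *)
by rewrite lt0n => /negbFE/eqP ->; rewrite big_ord0 !mul0r mulr0.
Qed.

Theorem cvg_T_stat : cvg_in_distribution P Tn P' (fun w => U w / L w ^+ 2).
Proof.
have [Lam_pos _] := N_averages.
move=> x; rewrite (_ : (fun y => _) = fun y => P' [set w | `|U w| / `|L w| ^+ 2 <= y]); last first.
  by apply/funext => y; exact: (probability_limit_ratio Lam_pos UL).
rewrite (probability_limit_ratio Lam_pos UL) => cx.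
have mr dd (S : measurableType dd) (f g : S -> R) : measurable_fun setT f ->
    measurable_fun setT g -> measurable [set w | f w / g w ^+ 2 <= x].
  move=> mf mg; rewrite -[X in measurable X]setTI; apply: measurable_fun_le => //.
  apply: measurable_funM => //; apply: (measurableT_comp (@measurable_invr R)).
  exact: measurable_funX.
have mU : measurable_fun setT (fun w => `|U w|) by exact: measurableT_comp.
have mL : measurable_fun setT (fun w => `|L w|) by exact: measurableT_comp.
have key t : P [set w | Tn t w <= x] = (fine (P [set w | A t w / B t w ^+ 2 <= x]))%:E.
  rewrite fineK ?fin_num_measure//; last exact: mr.
  (* A countable intersection of almost sure events: all X_i are positive simultaneously, so
     [Tn_ratio] applies whatever the value of N. *)
  apply: (probability_ae_eq (A := \bigcap_i [set w | 0 < X i w])).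
  - by apply: bigcapT_measurable => i; exact: measurable_fun_gt.
  - rewrite -[X in measurable X]setTI; apply: measurable_fun_le => //.
    apply: measurable_funM => //.
    apply: (measurable_random_index (N := N t) _ (h := fun n w =>
      if (1 <= n)%N then (\sum_(i < n) X i w ^+ 2) / (\sum_(i < n) X i w) ^+ 2 else 0)) => // n.
    case: n => [//|n] /=; apply: measurable_funM.
      by apply: measurable_sum => i; exact: measurable_funX.
    apply: (measurableT_comp (@measurable_invr R)); apply: measurable_funX.
    exact: measurable_sum.
  - exact: mr.
  - by apply: probability_bigcap1 => // i; exact: measurable_fun_gt.
  - by move=> w Xw /=; rewrite Tn_ratio// => i; exact: Xw.
rewrite (eq_cvg _ _ key).
have P'x : P' [set w | `|U w| / `|L w| ^+ 2 <= x] =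
    (fine (P' [set w | `|U w| / `|L w| ^+ 2 <= x]))%:E.
  by rewrite fineK ?fin_num_measure//; exact: mr.
rewrite P'x.
apply: cvg_EFin; first exact: nearW.
apply: (cvg_ratio_of_laplace (A := A) (B := B) (U := fun w => `|U w|) (L := fun w => `|L w|)) => //.
- by move=> t w; apply: sumr_ge0 => i _; exact: sqr_ge0.
- by move=> t w; apply: sumr_ge0 => i _; exact: divr_ge0.
- have L1 := limit_vector_pos Lam_pos UL; rewrite -L1.
  apply: (probability_ae_eq (A := [set w | 0 < L w])) => //; try exact: measurable_fun_gt.
  by move=> w /= L0; rewrite gtr0_norm.
- by move=> j k; rewrite (limit_vector_laplace Lam_pos UL)//; exact: cvg_laplace_random_sums.
- apply: fine_cvg; rewrite fineK ?fin_num_measure//; exact: mr.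
Qed.

End convergence.

(** * Gaussian integrals *)

Section improper_integral.
Context (R : realType).
Local Notation mu := (@lebesgue_measure R).
Implicit Types x y : R.

(** Both ends are improper: the half-lines [1 / (n + 1), +oo[ increase to ]0, +oo[, and monotone
    convergence moves the left end to 0, where only the limit k of F is given. *)
Lemma ge0_FTC2_open (f F : R -> R) (k l : R) :
  (forall x, 0 < x -> 0 <= f x) -> (forall x, 0 < x -> {for x, continuous f}) ->
  (forall x, 0 < x -> is_derive x 1 F (f x)) ->
  F x @[x --> 0^'+] --> k -> F x @[x --> +oo] --> l ->
  (\int[mu]_(x in `]0%R, +oo[) (f x)%:E = (l - k)%:E)%E.
Proof.
move=> f0 cf dF Fk Fl.
have pos n : 0 < n.+1%:R^-1 :> R by rewrite invr_gt0.
have cF x : 0 < x -> {for x, continuous F}.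
  move=> x0; apply: differentiable_continuous; apply/derivable1_diffP.
  by have [] := dF _ x0.
pose S n := `[n.+1%:R^-1 : R, +oo[%classic.
have US : \bigcup_n S n = `]0, +oo[%classic.
  apply/seteqP; split => x /=.
    by move=> [n _]; rewrite /S/= !in_itv/= !andbT; exact: lt_le_trans.
  rewrite in_itv/= andbT => x0; have [n hn] := ltr_add_invr x0.
  by exists n => //; rewrite /S/= in_itv/= andbT ltW// -[X in X < _]add0r.
have mf0 : measurable_fun (`]0, +oo[ : set R) f.
  apply: open_continuous_measurable_fun => //.
  by move=> x; rewrite inE/= in_itv/= andbT; exact: cf.
have mf n : measurable_fun (S n) (EFin \o f).
  apply/measurable_EFinP; apply: measurable_funS mf0 => //.
  by move=> x; rewrite /S/= !in_itv/= !andbT; exact: lt_le_trans.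
have I n : (\int[mu]_(x in S n) (f x)%:E = (l - F n.+1%:R^-1)%:E)%E.
  rewrite (@ge0_continuous_FTC2y _ f F _ l)//.
  - by move=> x nx; apply: f0; exact: lt_le_trans nx.
  - apply: continuous_in_subspaceT => x; rewrite inE/= in_itv/= andbT => nx.
    by apply: cf; exact: lt_le_trans nx.
  - by move=> x nx; have [] := dF _ (lt_trans (pos n) nx).
  - by apply: cvg_at_right_filter; exact: cF.
  - move=> x; rewrite in_itv/= andbT => nx; rewrite derive1E.
    by have [] := dF _ (lt_trans (pos n) nx).
have ndS : nondecreasing_seq S.
  move=> n m nm; apply/subsetPset => x; rewrite /S/= !in_itv/= !andbT; apply: le_trans.
  by rewrite lef_pV2 ?posrE// ler_nat.
have H : (\int[mu]_(x in S n) (f x)%:E)%E @[n --> \oo] -->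
    (\int[mu]_(x in `]0%R, +oo[) (f x)%:E)%E.
  rewrite -US; apply: ge0_nondecreasing_set_cvg_integral => //.
    by move=> n; exact: measurable_itv.
  move=> n x Sx; rewrite lee_fin; apply: f0; move: Sx; rewrite /S/= in_itv/= andbT.
  exact: lt_le_trans.
apply: (cvg_unique _ H) => //=.
rewrite (eq_cvg _ _ I); apply: cvg_EFin; first exact: nearW.
apply: cvgB; first exact: cvg_cst.
move/cvg_at_rightP : Fk; apply; split => //.
exact: cvg_harmonic.
Qed.

End improper_integral.

Section gauss_primitive.
Context (R : realType).
Local Notation mu := (@lebesgue_measure R).
Implicit Types x y : R.

(** This is sqrt pi times the distribution function of the centred Gaussian law of variance 1/2; it
    provides explicit primitives for [Gamma_half] and [integral_levy]. *)
Definition gauss_primitive y := \int[mu]_(u in `]-oo, y]) gauss_fun u.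
Local Notation G := gauss_primitive.

Let ig y : mu.-integrable `]-oo, y] (EFin \o @gauss_fun R).
Proof. by apply: integrableS (@integrableT_gauss R). Qed.

Lemma is_derive_gauss_primitive y : is_derive y 1 G (gauss_fun y).
Proof.
have y1 : y < y + 1 by rewrite ltrDl.
have [dG GE] := continuous_FTC1 y1 (ig _) (ltNyr y) (@continuous_gauss_fun R y).
by split; [exact: dG|rewrite -derive1E; exact: GE].
Qed.

Lemma gauss_primitiveE y : G y = \int[mu]_u (gauss_fun u * \1_(`]-oo, y]%classic) u).
Proof.
rewrite /G /Rintegral integral_mkcond; congr fine; apply: eq_integral => u _.
by rewrite patchE indicE; case: ifP => _; rewrite ?mulr1 ?mulr0.
Qed.

Let mg y : measurable_fun setT (fun u => gauss_fun u * \1_(`]-oo, y]%classic) u).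
Proof.
by apply: measurable_funM; [exact: measurable_gauss_fun|exact: measurable_indic].
Qed.

Let norm_bound y u : `|gauss_fun u * \1_(`]-oo, y]%classic) u| <= gauss_fun u.
Proof.
rewrite ger0_norm ?mulr_ge0 ?gauss_fun_ge0// ler_piMr ?gauss_fun_ge0//.
Qed.

Lemma cvg_gauss_primitivey : G y @[y --> +oo] --> Num.sqrt pi.
Proof.
have -> : Num.sqrt pi = \int[mu]_u gauss_fun u :> R by rewrite /Rintegral integralT_gauss.
rewrite (eq_cvg _ _ gauss_primitiveE).
apply: (@cvg_dominated_pinfty _ _ _ mu setT _ _ gauss_fun) => //.
- exact: measurable_gauss_fun.
- exact: integrableT_gauss.
- apply: aeW => u _; apply: cvg_near_cst.
  have := @nbhs_pinfty_ge R u (num_real u); apply: filterS => y uy.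
  by rewrite indicE mem_set ?mulr1//= in_itv.
- by apply: nearW => y u _; exact: norm_bound.
Qed.

Lemma cvg_gauss_primitiveNy : G (- y) @[y --> +oo] --> (0 : R).
Proof.
have -> : 0 = \int[mu]_u (cst 0 u) :> R by rewrite /Rintegral integral0.
rewrite (eq_cvg _ _ (fun y => gauss_primitiveE (- y))).
apply: (@cvg_dominated_pinfty _ _ _ mu setT _ _ gauss_fun) => //.
- by move=> t; exact: mg.
- exact: integrableT_gauss.
- apply: aeW => u _; apply: cvg_near_cst.
  have := @nbhs_pinfty_gt R (- u) (num_real _); apply: filterS => y uy.
  by rewrite indicE memNset ?mulr0//= in_itv/= lerNr leNgt uy.
- by apply: nearW => y u _; exact: norm_bound.
Qed.

Lemma gauss_primitive0 : G 0 = Num.sqrt pi / 2.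
Proof.
have mG : measurable_fun setT (@gauss_fun R) by exact: measurable_gauss_fun.
have h := @integralT_gauss R.
have -> : G 0 = \int[mu]_u gauss_fun u - \int[mu]_(u in `[0, +oo[) gauss_fun u.
  have U : setT = `]-oo, (0:R)]%classic `|` `]0, +oo[%classic.
    by rewrite -itv_bndbnd_setU// set_itvNyy.
  rewrite U Rintegral_setU//; last 2 first.
  - by rewrite -U; exact: integrableT_gauss.
  - apply/disj_setPS => u /= []; rewrite !in_itv/= andbT => u0.
    by rewrite ltNge u0.
  rewrite -addrA; rewrite [X in _ + X](_ : _ = 0) ?addr0//.
  apply/eqP; rewrite subr_eq0; apply/eqP; rewrite /Rintegral integral_itv_obnd_cbnd//.
  exact/measurable_EFinP/measurable_funTS.
rewrite /Rintegral integralT_gauss integral0y_gauss/=; lra.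
Qed.

End gauss_primitive.

Section gauss_integrals.
Context (R : realType).
Local Notation mu := (@lebesgue_measure R).
Local Notation G := (@gauss_primitive R).
Implicit Types x y : R.

Let cG : continuous G.
Proof.
move=> y; apply: differentiable_continuous; apply/derivable1_diffP.
by have [] := is_derive_gauss_primitive y.
Qed.

(** The substitution x = y^2, carried out through the primitive 2 G(sqrt x), which runs from sqrt pi
    at 0 to 2 sqrt pi at infinity. *)
Lemma Gamma_half : Gamma (2^-1 : R) = Num.sqrt pi.
Proof.
rewrite /Gamma /Rintegral.
pose f x := (Num.sqrt x)^-1 * expR (- x).
transitivity (fine (\int[mu]_(x in `]0%R, +oo[) (f x)%:E)%E).
  congr fine; apply: eq_integral => x; rewrite inE/= in_itv/= andbT => x0.
  have -> : 2^-1 - 1 = - 2^-1 :> R by lra.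
  by rewrite powRN powR12_sqrt// ltW.
pose k := Num.sqrt pi : R; pose l := 2 * Num.sqrt pi : R.
suff -> : (\int[mu]_(x in `]0%R, +oo[) (f x)%:E = (l - k)%:E)%E by rewrite /= /l /k; lra.
apply: (@ge0_FTC2_open R f (fun x => 2 * G (Num.sqrt x)) k l).
- by move=> x x0; rewrite mulr_ge0 ?invr_ge0 ?sqrtr_ge0 ?expR_ge0.
- move=> x x0; apply: cvgM.
    by apply: cvgV; [rewrite gt_eqF ?sqrtr_gt0|exact: sqrt_continuous].
  by apply: continuous_comp; [exact: opp_continuous|exact: continuous_expR].
- move=> x x0.
  have h := is_derive1_comp (is_derive_gauss_primitive (Num.sqrt x)) (is_derive1_sqrt x0).
  apply: (is_derive_eq (is_deriveZ 2 h)).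
  transitivity (2 * (gauss_fun (Num.sqrt x) / (2 * Num.sqrt x))) => //.
  by rewrite /f /gauss_fun sqr_sqrtr ?ltW//; field; rewrite gt_eqF ?sqrtr_gt0.
- have -> : k = 2 * G (Num.sqrt 0) by rewrite sqrtr0 gauss_primitive0 /k; field.
  apply: cvg_at_right_filter; apply: cvgM; first exact: cvg_cst.
  by apply: continuous_comp; [exact: sqrt_continuous|exact: cG].
- apply: cvgM; first exact: cvg_cst.
  apply: (cvg_comp (Num.sqrt : R -> R) G _ (@cvg_gauss_primitivey R)).
  apply/cvgryPge => A; have := @nbhs_pinfty_ge R (A ^+ 2) (num_real _).
  apply: filterS => x Ax; apply: le_trans (ler_norm A) _.
  by rewrite -sqrtr_sqr ler_wsqrtr.
Qed.

Lemma integral_levy (la : R) : 0 < la ->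
  (\int[mu]_(x in `]0%R, +oo[) (expR (- (x ^+ 2 + la ^+ 2 / x ^+ 2)))%:E =
   (Num.sqrt pi / 2 * expR (- (2 * la)))%:E)%E.
Proof.
move=> la0; set sp := Num.sqrt pi.
(* (x + la / x)^2 - 2 la = (x - la / x)^2 + 2 la = x^2 + la^2 / x^2, while the derivatives
   of x + la / x and x - la / x add up to 2. *)
pose F x := 2^-1 * (expR (2 * la) * G (x + la / x) + expR (- (2 * la)) * G (x - la / x)).
have near0 A : \forall x \near 0^'+, A <= la / x - x.
  have B0 : 0 < la / (`|A| + 1) by rewrite divr_gt0// ltr_wpDl.
  have h1 := @nbhs_right_lt R 0 _ (@ltr01 R).
  have h2 := @nbhs_right_lt R 0 _ B0.
  have h3 := @nbhs_right_gt R 0.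
  apply: filterS3 h1 h2 h3 => x x1 xB x0.
  have : `|A| + 1 <= la / x.
    by rewrite ler_pdivlMr// mulrC -ler_pdivlMr ?ltr_wpDl// ltW.
  have := ler_norm A; lra.
pose f x := expR (- (x ^+ 2 + la ^+ 2 / x ^+ 2)).
(* At infinity both x + la / x and x - la / x tend to +oo; at 0+ the second tends to -oo, where G
   vanishes. The difference l - k thus keeps only the second term. *)
pose l := 2^-1 * (expR (2 * la) * sp + expR (- (2 * la)) * sp).
pose k := 2^-1 * (expR (2 * la) * sp + expR (- (2 * la)) * 0).
have -> : sp / 2 * expR (- (2 * la)) = l - k.
  by rewrite /l /k; move: (expR _) (expR _) => e1 e2; field.
apply: (@ge0_FTC2_open R f F k l).
- by move=> x x0; exact: expR_ge0.
- move=> x x0; apply: (@continuous_comp _ _ _ (fun x => - (x ^+ 2 + la ^+ 2 / x ^+ 2)) expR);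
    last exact: continuous_expR.
  apply: cvgN; apply: cvgD; first exact: exprn_continuous.
  apply: cvgM; first exact: cvg_cst.
  apply: cvgV; last exact: exprn_continuous.
  by rewrite expf_neq0// gt_eqF.
- move=> x x0; have xn : x != 0 by rewrite gt_eqF.
  have dV : is_derive x 1 (fun y : R => y^-1) (- x ^- 2).
    have := @is_deriveV R id x 1 1 xn (is_derive_id _ _).
    by rewrite /GRing.scale/= mulr1.
  pose p y := y + la * y^-1; pose m y := y - la * y^-1.
  have dp : is_derive x 1 p (1 + la * - x ^- 2) by exact: is_deriveD.
  have dm : is_derive x 1 m (1 - la * - x ^- 2) by exact: is_deriveB.
  have h1 := @is_derive1_comp R G p x _ _ (is_derive_gauss_primitive (p x)) dp.
  have h2 := @is_derive1_comp R G m x _ _ (is_derive_gauss_primitive (m x)) dm.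
  have h := is_deriveZ 2^-1 (is_deriveD (is_deriveZ (expR (2 * la)) h1)
    (is_deriveZ (expR (- (2 * la))) h2)).
  apply: (is_derive_eq h).
  transitivity (2^-1 * (expR (2 * la) * (gauss_fun (p x) * (1 + la * - x ^- 2)) +
    expR (- (2 * la)) * (gauss_fun (m x) * (1 - la * - x ^- 2)))) => //.
  rewrite /gauss_fun !mulrA -!expRD /p /m.
  have -> : 2 * la - (x + la * x^-1) ^+ 2 = - (x ^+ 2 + la ^+ 2 / x ^+ 2) by field.
  have -> : - (2 * la) - (x - la * x^-1) ^+ 2 = - (x ^+ 2 + la ^+ 2 / x ^+ 2) by field.
  by rewrite -/(f x); move: (f x) => e; field.
- apply: cvgM; first exact: cvg_cst.
  apply: cvgD; (apply: cvgM; first exact: cvg_cst).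
    apply: (cvg_comp (fun x => x + la / x) G _ (@cvg_gauss_primitivey R)).
    apply/cvgryPge => A; apply: filterS2 (near0 A) (@nbhs_right_gt R 0) => x Ax x0; lra.
  rewrite (_ : (fun x => _) = (fun y => G (- y)) \o (fun x => la / x - x)); last first.
    by apply/funext => x /=; rewrite opprB.
  apply: (cvg_comp (fun x => la / x - x) (fun y => G (- y)) _ (@cvg_gauss_primitiveNy R)).
  by apply/cvgryPge => A; exact: near0.
- have h0 := @nbhs_pinfty_gt R 1 (num_real 1).
  have v01 x : 1 < x -> 0 < la / x < la.
    move=> x1; have x0 : 0 < x by lra.
    by rewrite divr_gt0//= ltr_pdivrMr// ltr_pMr.
  apply: cvgM; first exact: cvg_cst.
  apply: cvgD; (apply: cvgM; first exact: cvg_cst).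
    apply: (cvg_comp (fun x => x + la / x) G _ (@cvg_gauss_primitivey R)).
    apply/cvgryPge => A; apply: filterS2 h0 (@nbhs_pinfty_ge R A (num_real A)) => x x1 Ax.
    by have /andP[] := v01 _ x1; lra.
  apply: (cvg_comp (fun x => x - la / x) G _ (@cvg_gauss_primitivey R)).
  apply/cvgryPge => A; apply: filterS2 h0 (@nbhs_pinfty_ge R (A + la) (num_real _)) => x x1 Ax.
  by have /andP[] := v01 _ x1; lra.
Qed.

End gauss_integrals.

(** * The vector (U, L) *)

Section density.
Context (R : realType) (nu : probability (measurableTypeR R) R) (W : R -> R).
Local Notation mu := (@lebesgue_measure R).
Hypothesis mW : measurable_fun setT W.
Hypothesis W0 : forall x, 0 <= W x.
Hypothesis nuE : forall A, measurable A -> nu A = (\int[mu]_(x in A) (W x)%:E)%E.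

(** [nu] is known through its values on sets; layer cake for [nu], and its weighted form for
    Lebesgue measure, reduce both integrals to the sets g > y. *)
Lemma integral_density (g : R -> R) : measurable_fun setT g -> (forall x, 0 <= g x) ->
  (\int[nu]_x (g x)%:E = \int[mu]_x (W x * g x)%:E)%E.
Proof.
move=> mg g0.
have gL := @layer_cake _ _ _ nu g (cst 1) mg (measurable_cst _) (fun=> ler01).
have WL := @weighted_layer_cake _ _ _ mu W g (cst 1) mW W0 mg (measurable_cst _) (fun=> ler01).
transitivity (\int[nu]_w (\int[mu]_(y in `]0%R, g w[) (cst 1%R y)%:E))%E.
  by apply: eq_integral => w _; rewrite integral_itvoo1.
transitivity (\int[mu]_w ((W w)%:E * \int[mu]_(y in `]0%R, g w[) (cst 1%R y)%:E))%E; last first.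
  by apply: eq_integral => w _; rewrite integral_itvoo1// -EFinM.
rewrite gL WL; apply: eq_integral => y _; congr (_ * _)%E.
transitivity (\int[mu]_(w in [set w | (y < g w)%R]) (W w)%:E)%E.
  exact: (nuE (measurable_fun_gt y mg)).
rewrite integral_mkcond; apply: eq_integral => w _; rewrite patchE indicE.
by case: ifP; rewrite ?mulr1 ?mulr0.
Qed.

End density.

Section levy.
Context (R : realType).
Local Notation mu := (@lebesgue_measure R).
Implicit Types x la : R.

(** Variance 1/2 makes the Gaussian density exactly exp (- x^2) / sqrt pi. *)
Let sigma : R := Num.sqrt 2^-1.
Local Notation Q := (normal_prob 0 sigma).

Let sigma2 : sigma ^+ 2 = 2^-1.
Proof. by rewrite sqr_sqrtr. Qed.

Let pdfE x : normal_pdf 0 sigma x = (Num.sqrt pi)^-1 * expR (- x ^+ 2).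
Proof.
rewrite normal_pdfE ?gt_eqF ?sqrtr_gt0// /normal_peak /normal_fun sigma2 subr0.
congr (_^-1 * expR _); last by rewrite -mulr_natl; field.
by congr Num.sqrt; rewrite -mulr_natl; field.
Qed.

Lemma integral_levy_sym la : 0 < la ->
  (\int[mu]_x (expR (- (x ^+ 2 + la ^+ 2 / x ^+ 2)))%:E =
   (Num.sqrt pi * expR (- (2 * la)))%:E)%E.
Proof.
move=> la0; pose f x := expR (- (x ^+ 2 + la ^+ 2 / x ^+ 2)).
(* As the inverse of 0 is 0, f takes the value 1 at 0 while its limit there is 0; h repairs this
   single point and is a continuous even function, to which the symmetry argument applies. *)
pose h x := if x == 0 then 0 else f x.
have h0 x : 0 <= h x by rewrite /h; case: ifP => // _; exact: expR_ge0.
have hev : h =1 h \o -%R by move=> x; rewrite /h /f /= oppr_eq0 sqrrN.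
have hle x : h x <= x ^+ 2 / la ^+ 2.
  rewrite /h; case: eqP => [->|/eqP xn]; first by rewrite expr0n/= mul0r.
  have x2 : 0 < x ^+ 2 by rewrite exprn_even_gt0.
  have l2 : 0 < la ^+ 2 by rewrite exprn_gt0.
  apply: le_trans (_ : expR (- (la ^+ 2 / x ^+ 2)) <= _).
    by rewrite ler_expR lerN2 lerDr ltW.
  rewrite -[leRHS]invf_div expRN lef_pV2 ?posrE ?expR_gt0 ?divr_gt0//.
  by apply: le_trans (expR_ge1Dx _); rewrite lerDr.
have ch : continuous h.
  move=> x; have [->|xn] := eqVneq x 0.
    have c2 : x ^+ 2 / la ^+ 2 @[x --> (0 : R)] --> (0 : R).
      rewrite [X in _ --> X](_ : 0 = 0 ^+ 2 / la ^+ 2); last by rewrite expr0n/= mul0r.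
      by apply: cvgM; [exact: exprn_continuous|exact: cvg_cst].
    rewrite /continuous_at {2}/h eqxx.
    apply: (squeeze_cvgr _ (cvg_cst 0) c2).
    by apply: nearW => y; rewrite h0 hle.
  have cf : f y @[y --> x] --> h x.
    rewrite /h (negbTE xn).
    apply: (@continuous_comp _ _ _ (fun x => - (x ^+ 2 + la ^+ 2 / x ^+ 2)) expR);
      last exact: continuous_expR.
    apply: cvgN; apply: cvgD; first exact: exprn_continuous.
    apply: cvgM; first exact: cvg_cst.
    apply: cvgV; last exact: exprn_continuous.
    by rewrite expf_neq0.
  have xn' : \forall y \near x, y != 0.
    by apply: open_nbhs_nbhs; split; [exact: open_neq|exact: xn].
  apply: cvg_trans cf; apply: near_eq_cvg.
  by apply: filterS xn' => y yn; rewrite /h (negbTE yn).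
have mf : measurable_fun setT f.
  apply: measurableT_comp => //; apply: measurableT_comp => //.
  apply: measurable_funD; first exact: measurable_funX.
  apply: measurable_funM => //; apply: (measurableT_comp (@measurable_invr R)).
  exact: measurable_funX.
have mh : measurable_fun setT h by exact: continuous_measurable_fun.
transitivity (\int[mu]_x (h x)%:E)%E.
  apply: ae_eq_integral => //; [exact/measurable_EFinP|exact/measurable_EFinP|].
  exists [set 0]; split => //; first exact: lebesgue_measure_set1.
  move=> x /= H; apply: contrapT => x0; apply: H => _.
  by rewrite /h; case: eqP.
rewrite ge0_symfun_integralT// (_ : [set x | 0 <= x] = `[0, +oo[%classic); last first.
  by apply/seteqP; split => x /=; rewrite in_itv/= andbT.
rewrite -integral_itv_obnd_cbnd//; last exact/measurable_EFinP/measurable_funTS.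
transitivity (2%:E * \int[mu]_(x in `]0%R, +oo[) (f x)%:E)%E.
  congr (_ * _)%E; apply: eq_integral => x; rewrite inE/= in_itv/= andbT => x0.
  by rewrite /h gt_eqF.
by rewrite integral_levy// -EFinM; congr EFin; field.
Qed.

Lemma normal_levy_laplace la : 0 < la ->
  (\int[Q]_x (expR (- (la ^+ 2 / x ^+ 2)))%:E = (expR (- (2 * la)))%:E)%E.
Proof.
move=> la0.
have mg : measurable_fun setT (fun x : R => expR (- (la ^+ 2 / x ^+ 2))).
  apply: measurableT_comp => //; apply: measurableT_comp => //.
  apply: measurable_funM => //; apply: (measurableT_comp (@measurable_invr R)).
  exact: measurable_funX.
rewrite (@integral_density R Q (normal_pdf 0 sigma))//; last 2 first.
- exact: measurable_normal_pdf.
- by move=> x; exact: normal_pdf_ge0.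
transitivity (\int[mu]_x ((Num.sqrt pi)^-1%:E * (expR (- (x ^+ 2 + la ^+ 2 / x ^+ 2)))%:E))%E.
  apply: eq_integral => x _; rewrite pdfE -EFinM -mulrA -expRD.
  by congr ((_ * expR _)%:E); ring.
rewrite ge0_integralZl_EFin//.
- by rewrite integral_levy_sym// -EFinM mulKf// gt_eqF// sqrtr_gt0 pi_gt0.
- apply/measurable_EFinP; apply: measurableT_comp => //; apply: measurableT_comp => //.
  apply: measurable_funD; first exact: measurable_funX.
  apply: measurable_funM => //; apply: (measurableT_comp (@measurable_invr R)).
  exact: measurable_funX.
Qed.

Lemma limit_vector_exists d (T : measurableType d) (P : probability T R) (Lam : {RV P >-> R}) :
  P [set w | 0 < Lam w] = 1%E ->
  exists (d' : measure_display) (Omega' : measurableType d')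
    (P' : probability Omega' R) (U L : {RV P' >-> R}), limit_vector Lam U L.
Proof.
move=> Lam_pos.
pose P' := (P \x Q)%E.
(* Given Lam, u has a one-sided stable law of index 1/2. The factor pi / 4 makes r u = la^2 / z^2
   with la = Lam sqrt (r pi) / 2, so that exp (- 2 la) = exp (- sqrt (r pi) Lam). *)
pose u (z : T * measurableTypeR R) := pi / 4 * (Lam z.1 / z.2) ^+ 2.
pose v (z : T * measurableTypeR R) := Lam z.1.
have mv : measurable_fun setT v by apply: measurableT_comp => //; exact: measurable_fst.
have mu' : measurable_fun setT u.
  apply: measurable_funM => //; apply: measurable_funX; apply: measurable_funM => //.
  by apply: (measurableT_comp (@measurable_invr R)); exact: measurable_snd.
pose V : {mfun (T * measurableTypeR R)%type >-> R} := HB.pack v (isMeasurableFun.Build _ _ _ _ v mv).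
pose U : {mfun (T * measurableTypeR R)%type >-> R} := HB.pack u (isMeasurableFun.Build _ _ _ _ u mu').
exists _, _, P', U, V; split.
- rewrite (_ : [set w | _] = setT); first exact: probability_setT.
  by apply/seteqP; split => // z _ /=; rewrite mulr_ge0 ?sqr_ge0// divr_ge0 ?pi_ge0.
- move=> B mB; rewrite /distribution/= /pushforward.
  rewrite (_ : v @^-1` B = (Lam @^-1` B) `*` setT); last first.
    by apply/seteqP; split => z /=; [|case].
  rewrite product_measure1E//; last exact: measurable_funPTI.
  transitivity (P (Lam @^-1` B) * 1)%E; last by rewrite mule1.
  by congr (_ * _)%E; exact: (probability_setT Q).
- move=> r s r0 s0; rewrite unlock.
  have Fub (h : T * measurableTypeR R -> R) : measurable_fun setT h -> (forall z, 0 <= h z) ->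
      (\int[P']_z (h z)%:E = \int[P]_x \int[Q]_y (h (x, y))%:E)%E /\
      measurable_fun setT (fun x : T => \int[Q]_y (h (x, y))%:E)%E.
    move=> mh h0; have mh' : measurable_fun setT (EFin \o h) by exact/measurable_EFinP.
    have h0' z : (0 <= (EFin \o h) z)%E by rewrite lee_fin h0.
    have H := @measurable_fun_fubini_tonelli_F _ _ _ _ R Q _ mh' h0'.
    split; first exact: fubini_tonelli1.
    exact H.
  pose h1 z := expR (- r * u z - s * v z).
  pose h2 z := expR (- s * v z - Num.sqrt (r * pi) * v z).
  have mh1 : measurable_fun setT h1.
    by apply: measurableT_comp => //; apply: measurable_funB; apply: measurable_funM.
  have mh2 : measurable_fun setT h2.
    by apply: measurableT_comp => //; apply: measurable_funB; apply: measurable_funM.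
  have [E1 m1] := Fub h1 mh1 (fun=> expR_ge0 _).
  have [E2 m2] := Fub h2 mh2 (fun=> expR_ge0 _).
  suff key : (\int[P']_z (h1 z)%:E = \int[P']_z (h2 z)%:E)%E by exact: key.
  rewrite E1 E2; apply: (ae_eq_integral _ _ measurableT m1 m2).
  exists (~` [set w | 0 < Lam w]); split.
  + by apply: measurableC; exact: measurable_fun_gt.
  + have mL : measurable_fun setT (Lam : T -> R) by [].
    by have := probability_setC P (measurable_fun_gt 0 mL); rewrite Lam_pos subee.
  move=> w /= H Lw; apply: H => _; rewrite /h1 /h2.
  pose la := Lam w * Num.sqrt (r * pi) / 2.
  have la0 : 0 < la by rewrite divr_gt0// mulr_gt0// sqrtr_gt0 mulr_gt0// pi_gt0.
  transitivity ((expR (- s * Lam w))%:E * \int[Q]_x (expR (- (la ^+ 2 / x ^+ 2)))%:E)%E.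
    rewrite -ge0_integralZl_EFin//.
    + apply: eq_integral => x _; rewrite -EFinM -expRD; congr (expR _)%:E.
      rewrite /u /v /la/= !expr_div_n exprMn sqr_sqrtr; last by rewrite mulr_ge0 ?pi_ge0 ?ltW.
      by have [->|xn] := eqVneq x 0; [rewrite expr0n/= invr0; ring|field].
    + apply/measurable_EFinP; apply: measurableT_comp => //; apply: measurableT_comp => //.
      apply: measurable_funM => //; apply: (measurableT_comp (@measurable_invr R)).
      exact: measurable_funX.
  rewrite normal_levy_laplace// -EFinM -expRD.
  rewrite -[LHS]mule1 -[X in (_ * X)%E](probability_setT Q) -integral_cst//.
  by apply: eq_integral => y _; congr (expR _)%:E; rewrite /v /la/=; field.
Qed.

End levy.

(** The prescribed transform at s = 0, with sqrt pi read as Gamma(1/2); at r = 0, outside its range,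
    both integrands are 1. *)
Lemma limit_vector_marginal (R : realType) d (T : measurableType d) (P : probability T R)
    d' (T' : measurableType d') (P' : probability T' R)
    (Lam : {RV P >-> R}) (U L : {RV P' >-> R}) (r : R) :
  limit_vector Lam U L -> 0 <= r ->
  ('E_P'[fun w => expR (- r * U w)] =
   'E_P'[fun w => expR (- (r `^ 2^-1 * Gamma 2^-1) * L w)])%E.
Proof.
move=> [_ _ lapl]; rewrite le_eqVlt => /predU1P[<-|r0].
  rewrite powR0 ?invr_eq0// mul0r oppr0; congr ('E_P'[_])%E.
  by apply/funext => w; rewrite !mul0r.
have := lapl r 0 r0 (lexx 0).
rewrite Gamma_half powR12_sqrt ?(ltW r0)// -sqrtrM ?(ltW r0)// => H.
transitivity ('E_P'[fun w => expR (- r * U w - 0 * L w)])%E.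
  by congr ('E_P'[_])%E; apply/funext => w; rewrite mul0r subr0.
rewrite H; congr ('E_P'[_])%E; apply/funext => w.
by rewrite oppr0 mul0r add0r mulNr.
Qed.

(** The limit vector is quantified over all its realisations, on any probability space; the separate
    existence clause keeps this from being vacuous. *)
Theorem theorem2 (R : realType)
    (d : measure_display) (Omega : measurableType d) (P : probability Omega R)
    (X : nat -> {RV P >-> R}) (N : R -> {RV P >-> nat})
    (dL : measure_display) (OmegaL : measurableType dL)
    (PL : probability OmegaL R) (Lam : {RV PL >-> R})
    (l a a' : R -> R)
    (X_indep : mutually_independent X)
    (X_ident : identically_distributed X)
    (X_pos : forall i, P [set w | 0 < X i w] = 1%E)
    (N_counting : counting_process N)
    (N_indep : process_independent_of N X)
    (X_pareto : pareto_type (fun x => fine (cdf (X 0%N) x)) 1 l)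
    (X_mean : 'E_P[X 0%N]%E = +oo%E)
    (N_averages : D_averages_in_time N Lam)
    (l_int : log_integrable l)
    (a_norming : norming l a)
    (a'_norming : norming (log_primitive l) a') :
  [/\ slowly_varying (log_primitive l),
      (exists (d' : measure_display) (Omega' : measurableType d')
          (P' : probability Omega' R) (U L : {RV P' >-> R}),
        limit_vector Lam U L) &
      forall (d' : measure_display) (Omega' : measurableType d')
          (P' : probability Omega' R) (U L : {RV P' >-> R}),
        limit_vector Lam U L ->
        cvg_in_distribution P
          (fun t w => (a' t / a t) ^+ 2 *
             T_stat (fun i => X i : Omega -> R) (N t) w)
          P' (fun w => U w / L w ^+ 2) /\
        (forall r : R, 0 <= r ->
          ('E_P'[fun w => expR (- r * U w)] =
           'E_P'[fun w => expR (- (r `^ 2^-1 * Gamma 2^-1) * L w)])%E)].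
Proof.
split.
- exact: (log_primitive_slowly_varying X_pos X_pareto X_mean l_int).
- by apply: limit_vector_exists; case: N_averages.
- move=> d' Omega' P' U L UL; split.
    exact: (cvg_T_stat X_pos X_pareto X_mean l_int a_norming a'_norming X_indep X_ident N_indep
      N_averages UL).
  by move=> r r0; exact: limit_vector_marginal UL r0.
Qed.
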